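(* Let $p$ be a prime number and $k$ a field of characteristic zero. Let $\mathsf{D}(\mathrm{VI}\text{-}\mathrm{Mod})$ be the derived category of VI-modules over $k$, with pointwise tensor product. For $M\in\mathsf{D}(\mathrm{VI}\text{-}\mathrm{Mod})$ put $\mathrm{type}(M)=\{n\in\mathbb{N}\mid H_*(M(\mathbb{F}_p^{\oplus n}))\neq 0\}$. Then the assignment $M\mapsto \mathrm{type}(M)$ induces a well-defined bijection from the set of tt-equivalence classes of compact objects $M\in\mathsf{D}(\mathrm{VI}\text{-}\mathrm{Mod})$ to the set consisting of all cofinite subsets of $\mathbb{N}$ together with $\varnothing$.
   Context: $\mathbb{N}=\{0,1,2,\dots\}$. $\mathrm{VI}$ is the category of finite-dimensional $\mathbb{F}_p$-vector spaces and injective linear maps. $\mathrm{VI}\text{-}\mathrm{Mod}=\mathrm{Fun}(\mathrm{VI},\mathrm{Mod}_k)$ is the abelian category of functors, with pointwise tensor product over $k$ (which is exact in each variable, so it passes to the derived category without deriving). An object $M$ of a triangulated category with coproducts is compact if $\mathrm{Hom}(M,-)$ preserves coproducts. The compact objects $\mathsf{D}(\mathrm{VI}\text{-}\mathrm{Mod})^c$ form an essentially small tensor-triangulated category. A thick ideal is a full triangulated subcategory closed under retracts and under tensoring with arbitrary objects of the ambient category. Two compact objects $M,N$ are tt-equivalent if they generate the same thick ideal of $\mathsf{D}(\mathrm{VI}\text{-}\mathrm{Mod})^c$. *)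

(* Defs.v *)
From HB Require Import structures.
From mathcomp Require Import all_boot all_order all_algebra.
From mathcomp Require Import boolp classical_sets functions cardinality.
Set Implicit Arguments.
Unset Strict Implicit.
Unset Printing Implicit Defensive.
Import GRing.Theory.
Local Open Scope ring_scope.
Local Obligation Tactic := try by [].

(* [lker f == 0] says that [f] is injective, so the arguments [(f, fi)] range
   over the morphisms of VI.  The proof [hi] in [vi_comp] exists whenever [fi]
   and [gi] do, and is unique. *)
Record vi_mod (p : nat) (k : fieldType) : Type := ViMod {
  vi_obj :> vectType 'F_p -> lmodType k;
  vi_map : forall (U V : vectType 'F_p) (f : 'Hom(U, V)),
    lker f == 0%VS -> {linear vi_obj U -> vi_obj V};
  vi_id : forall (U : vectType 'F_p) (fi : lker (\1%VF : 'End(U)) == 0%VS)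
      (x : vi_obj U), vi_map fi x = x;
  vi_comp : forall (U V W : vectType 'F_p) (g : 'Hom(V, W)) (f : 'Hom(U, V))
      (gi : lker g == 0%VS) (fi : lker f == 0%VS)
      (hi : lker (g \o f)%VF == 0%VS) (x : vi_obj U),
    vi_map hi x = vi_map gi (vi_map fi x) }.

Record vi_nat (p : nat) (k : fieldType) (A B : vi_mod p k) : Type := ViNat {
  nt_map :> forall V : vectType 'F_p, {linear A V -> B V};
  nt_natural : forall (U V : vectType 'F_p) (f : 'Hom(U, V))
      (fi : lker f == 0%VS) (x : A U),
    nt_map V (vi_map A fi x) = vi_map B fi (nt_map U x) }.

Section ViNatConstructions.
Variables (p : nat) (k : fieldType).
Implicit Types A B C : vi_mod p k.

Program Definition nt_id A : vi_nat A A :=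
  @ViNat p k A A (fun V => idfun : {linear A V -> A V}) _.

Program Definition nt_zero A B : vi_nat A B :=
  @ViNat p k A B (fun V => \0 : {linear A V -> B V}) _.
Next Obligation. by move=> A B U V f fi x /=; rewrite linear0. Qed.

Program Definition nt_comp A B C (g : vi_nat B C) (f : vi_nat A B) :
    vi_nat A C :=
  @ViNat p k A C (fun V => g V \o f V : {linear A V -> C V}) _.
Next Obligation. by move=> A B C g f U V h hi x /=; rewrite !nt_natural. Qed.

Program Definition nt_add A B (f g : vi_nat A B) : vi_nat A B :=
  @ViNat p k A B (fun V => f V \+ g V : {linear A V -> B V}) _.
Next Obligation.
by move=> A B f g U V h hi x /=; rewrite !nt_natural linearD.
Qed.

Program Definition nt_opp A B (f : vi_nat A B) : vi_nat A B :=
  @ViNat p k A B (fun V => \- f V : {linear A V -> B V}) _.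
Next Obligation.
by move=> A B f U V h hi x /=; rewrite !nt_natural linearN.
Qed.

Section Sum.
Variables A B : vi_mod p k.

Section SumMap.
Variables (U V : vectType 'F_p) (f : 'Hom(U, V)) (fi : lker f == 0%VS).
Definition vi_sum_map (x : A U * B U) : A V * B V :=
  (vi_map A fi x.1, vi_map B fi x.2).
Lemma vi_sum_map_linear : linear vi_sum_map.
Proof. by move=> a x y; rewrite /vi_sum_map !linearP. Qed.
HB.instance Definition _ :=
  GRing.isLinear.Build k (A U * B U)%type (A V * B V)%type *:%R vi_sum_map
    vi_sum_map_linear.
End SumMap.

Program Definition vi_sum : vi_mod p k :=
  @ViMod p k (fun V => (A V * B V)%type : lmodType k)
    (fun U V f fi =>
       vi_sum_map fi : {linear (A U * B U)%type -> (A V * B V)%type}) _ _.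
Next Obligation. by move=> U fi [x y]; rewrite /= /vi_sum_map /= !vi_id. Qed.
Next Obligation.
move=> U V W g f gi fi hi [x y].
by rewrite /= /vi_sum_map /= (vi_comp gi fi) (vi_comp gi fi).
Qed.
End Sum.

End ViNatConstructions.

(* Unbounded chain complexes, with homological grading. *)
Record cplx (p : nat) (k : fieldType) : Type := Cplx {
  cx_obj :> int -> vi_mod p k;
  cx_d : forall n : int, vi_nat (cx_obj n) (cx_obj (n - 1));
  cx_dd : forall (n : int) (V : vectType 'F_p) (x : cx_obj n V),
    cx_d (n - 1) V (cx_d n V x) = 0 }.

Record chain_map (p : nat) (k : fieldType) (X Y : cplx p k) : Type := ChainMap {
  cm_map :> forall n : int, vi_nat (X n) (Y n);
  cm_comm : forall (n : int) (V : vectType 'F_p) (x : X n V),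
    cm_map (n - 1) V (cx_d X n V x) = cx_d Y n V (cm_map n V x) }.

Section Complexes.
Variables (p : nat) (k : fieldType).
Implicit Types X Y Z T : cplx p k.

Program Definition cm_id X : chain_map X X :=
  @ChainMap p k X X (fun n => nt_id (X n)) _.

Program Definition cm_zero X Y : chain_map X Y :=
  @ChainMap p k X Y (fun n => nt_zero (X n) (Y n)) _.
Next Obligation. by move=> X Y n V x /=; rewrite linear0. Qed.

Program Definition cm_comp X Y Z (g : chain_map Y Z) (f : chain_map X Y) :
    chain_map X Z :=
  @ChainMap p k X Z (fun n => nt_comp (g n) (f n)) _.
Next Obligation. by move=> X Y Z g f n V x /=; rewrite !cm_comm. Qed.

Program Definition cm_add X Y (f g : chain_map X Y) : chain_map X Y :=
  @ChainMap p k X Y (fun n => nt_add (f n) (g n)) _.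
Next Obligation. by move=> X Y f g n V x /=; rewrite !cm_comm linearD. Qed.

Program Definition shift X : cplx p k :=
  @Cplx p k (fun n => X (n - 1)) (fun n => nt_opp (cx_d X (n - 1))) _.
Next Obligation. by move=> X n V x /=; rewrite linearN cx_dd !oppr0. Qed.

Section Cone.
Variables (X Y : cplx p k) (f : chain_map X Y).

Definition cone_obj (n : int) : vi_mod p k := vi_sum (X (n - 1)) (Y n).

Section ConeD.
Variables (n : int) (V : vectType 'F_p).
Definition cone_d_fun (x : cone_obj n V) : cone_obj (n - 1) V :=
  (- cx_d X (n - 1) V x.1, f (n - 1) V x.1 + cx_d Y n V x.2).
Lemma cone_d_linear : linear cone_d_fun.
Proof.
move=> a x y; rewrite /cone_d_fun !linearP /=.
by congr (_, _); rewrite /= ?opprD ?scalerN // scalerDr addrACA.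
Qed.
HB.instance Definition _ :=
  GRing.isLinear.Build k (cone_obj n V) (cone_obj (n - 1) V) *:%R cone_d_fun
    cone_d_linear.
End ConeD.

Program Definition cone_d (n : int) : vi_nat (cone_obj n) (cone_obj (n - 1)) :=
  @ViNat p k _ _
    (fun V => @cone_d_fun n V : {linear cone_obj n V -> cone_obj (n - 1) V}) _.
Next Obligation.
move=> n U V g gi x /=; rewrite /cone_d_fun /vi_sum_map /=.
by rewrite !nt_natural linearN linearD.
Qed.

Program Definition cone : cplx p k := @Cplx p k cone_obj cone_d _.
Next Obligation.
move=> n V x /=; rewrite /cone_d_fun /=.
by rewrite linearN cx_dd !oppr0 linearD cx_dd addr0 linearN cm_comm addNr.
Qed.
End Cone.

(* Homology of [X V] is taken in degree [n - 1], so that the incoming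
   differential is [cx_d X n V]; [n] ranges over all of [int]. *)
Definition cycle X (n : int) (V : vectType 'F_p) (z : X n V) : Prop :=
  cx_d X n V z = 0.

Definition boundary X (n : int) (V : vectType 'F_p) (z : X (n - 1) V) : Prop :=
  exists y : X n V, cx_d X n V y = z.

Definition homology_nonzero X (V : vectType 'F_p) : Prop :=
  exists (n : int) (z : X (n - 1) V), cycle z /\ ~ boundary z.

(* Injectivity and surjectivity of the induced maps on homology. *)
Definition quasi_iso X Y (f : chain_map X Y) : Prop :=
  forall (n : int) (V : vectType 'F_p),
    (forall z : X (n - 1) V, cycle z -> boundary (f (n - 1) V z) -> boundary z)
    /\ (forall w : Y (n - 1) V, cycle w ->
          exists2 z : X (n - 1) V, cycle z & boundary (f (n - 1) V z - w)).

(* The derived category is the localization of the category of complexes at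
   the quasi-isomorphisms: morphisms are formal expressions in chain maps and
   inverses of quasi-isomorphisms, taken up to the congruence [dhom_eq].
   Sums are included among the generators, so this is the localization among
   preadditive categories; it agrees with the plain one, which is additive
   with additive localization functor because the quasi-isomorphisms are closed
   under finite direct sums.  The opposite of [u] is [(- id) \o u]. *)
Inductive dhom : cplx p k -> cplx p k -> Type :=
| dmap X Y (f : chain_map X Y) : dhom X Y
| dinv X Y (s : chain_map Y X) (hs : quasi_iso s) : dhom X Y
| dcomp X Y Z (v : dhom Y Z) (u : dhom X Y) : dhom X Z
| dadd X Y (u v : dhom X Y) : dhom X Y.

Definition did X : dhom X X := dmap (cm_id X).
Definition dzero X Y : dhom X Y := dmap (cm_zero X Y).

Inductive dhom_eq : forall X Y, dhom X Y -> dhom X Y -> Prop :=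
| dhom_eq_refl X Y (u : dhom X Y) : dhom_eq u u
| dhom_eq_sym X Y (u v : dhom X Y) : dhom_eq u v -> dhom_eq v u
| dhom_eq_trans X Y (u v w : dhom X Y) :
    dhom_eq u v -> dhom_eq v w -> dhom_eq u w
| dhom_eq_dcomp X Y Z (v v' : dhom Y Z) (u u' : dhom X Y) :
    dhom_eq v v' -> dhom_eq u u' -> dhom_eq (dcomp v u) (dcomp v' u')
| dhom_eq_dadd X Y (u u' v v' : dhom X Y) :
    dhom_eq u u' -> dhom_eq v v' -> dhom_eq (dadd u v) (dadd u' v')
| dcompA X Y Z T (w : dhom Z T) (v : dhom Y Z) (u : dhom X Y) :
    dhom_eq (dcomp w (dcomp v u)) (dcomp (dcomp w v) u)
| dcomp1l X Y (u : dhom X Y) : dhom_eq (dcomp (did Y) u) u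
| dcomp1r X Y (u : dhom X Y) : dhom_eq (dcomp u (did X)) u
| daddA X Y (u v w : dhom X Y) :
    dhom_eq (dadd u (dadd v w)) (dadd (dadd u v) w)
| daddC X Y (u v : dhom X Y) : dhom_eq (dadd u v) (dadd v u)
| dadd0l X Y (u : dhom X Y) : dhom_eq (dadd (dzero X Y) u) u
| dcompDl X Y Z (v w : dhom Y Z) (u : dhom X Y) :
    dhom_eq (dcomp (dadd v w) u) (dadd (dcomp v u) (dcomp w u))
| dcompDr X Y Z (w : dhom Y Z) (u v : dhom X Y) :
    dhom_eq (dcomp w (dadd u v)) (dadd (dcomp w u) (dcomp w v))
| dmap_ext X Y (f g : chain_map X Y) :
    (forall n V, f n V =1 g n V) -> dhom_eq (dmap f) (dmap g)
| dmap_comp X Y Z (g : chain_map Y Z) (f : chain_map X Y) :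
    dhom_eq (dmap (cm_comp g f)) (dcomp (dmap g) (dmap f))
| dmap_add X Y (f g : chain_map X Y) :
    dhom_eq (dmap (cm_add f g)) (dadd (dmap f) (dmap g))
| dinvK X Y (s : chain_map Y X) (hs : quasi_iso s) :
    dhom_eq (dcomp (dmap s) (dinv hs)) (did X)
| dmapK X Y (s : chain_map Y X) (hs : quasi_iso s) :
    dhom_eq (dcomp (dinv hs) (dmap s)) (did Y).

Definition dretract X Y : Prop :=
  exists (i : dhom X Y) (r : dhom Y X), dhom_eq (dcomp r i) (did X).

Definition diso X Y : Prop :=
  exists (u : dhom X Y) (v : dhom Y X),
    dhom_eq (dcomp v u) (did X) /\ dhom_eq (dcomp u v) (did Y).

Definition is_dcoproduct (I : eqType) (N : I -> cplx p k) X
    (inj : forall i : I, dhom (N i) X) : Prop :=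
  forall Y (g : forall i : I, dhom (N i) Y),
    exists h : dhom X Y,
      (forall i, dhom_eq (dcomp h (inj i)) (g i)) /\
      (forall h' : dhom X Y,
         (forall i, dhom_eq (dcomp h' (inj i)) (g i)) -> dhom_eq h' h).

Definition dsum (I : eqType) X Y (s : seq I) (h : I -> dhom X Y) : dhom X Y :=
  foldr (fun i u => dadd (h i) u) (dzero X Y) s.

(* Surjectivity and injectivity of the canonical map from the direct sum of the
   groups Hom(M, N i) to Hom(M, X), for every coproduct X of the N i; an element
   of the direct sum is represented by its values on a finite set [s] containing
   its support. *)
Definition compact (M : cplx p k) : Prop :=
  forall (I : eqType) (N : I -> cplx p k) X (inj : forall i : I, dhom (N i) X),
    is_dcoproduct inj ->
    (forall g : dhom M X,
       exists (s : seq I) (h : forall i : I, dhom M (N i)),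
         uniq s /\ dhom_eq (dsum s (fun i => dcomp (inj i) (h i))) g) /\
    (forall (s : seq I) (h : forall i : I, dhom M (N i)),
       uniq s ->
       dhom_eq (dsum s (fun i => dcomp (inj i) (h i))) (dzero M X) ->
       forall i, i \in s -> dhom_eq (h i) (dzero M (N i))).

(* X, Y, Z are the objects of a distinguished triangle X -> Y -> Z -> X[1].  The
   isomorphisms need no compatibility condition, since they can be used to
   transport the maps of the standard triangle of [f]. *)
Definition in_triangle X Y Z : Prop :=
  exists (A B : cplx p k) (f : chain_map A B),
    [/\ diso X A, diso Y B & diso Z (cone f)].

Definition bilinear_map (A B C : lmodType k) (b : A -> B -> C) : Prop :=
  (forall y : B, linear (fun x : A => b x y)) /\ (forall x : A, linear (b x)).

(* [T] is the pointwise tensor product of the complexes [X] and [Y]: in degree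
   [n] it is the sum over [i + j = n] of the [X i V (x) Y j V], characterized by
   the universal property for families of bilinear maps, with the usual
   differential and the diagonal action of VI. *)
Definition is_tensor X Y T : Prop :=
  exists t : forall (V : vectType 'F_p) (i j n : int), i + j = n ->
                 X i V -> Y j V -> T n V,
    [/\ forall (V : vectType 'F_p) (i j n : int) (e : i + j = n),
          bilinear_map (t V i j n e),
        forall (V : vectType 'F_p) (n : int) (W : lmodType k)
            (b : forall i j : int, i + j = n -> X i V -> Y j V -> W),
          (forall i j e, bilinear_map (b i j e)) ->
          exists phi : {linear T n V -> W},
            (forall i j e x y, phi (t V i j n e x y) = b i j e x y) /\
            (forall psi : {linear T n V -> W},
               (forall i j e x y, psi (t V i j n e x y) = b i j e x y) ->
               psi =1 phi),
        forall (V : vectType 'F_p) (i j n : int) (e : i + j = n)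
            (e1 : i - 1 + j = n - 1) (e2 : i + (j - 1) = n - 1)
            (x : X i V) (y : Y j V),
          cx_d T n V (t V i j n e x y) =
            t V (i - 1) j (n - 1) e1 (cx_d X i V x) y
            + (-1) ^+ `|i|%N *: t V i (j - 1) (n - 1) e2 x (cx_d Y j V y) &
        forall (U V : vectType 'F_p) (f : 'Hom(U, V)) (fi : lker f == 0%VS)
            (i j n : int) (e : i + j = n) (x : X i U) (y : Y j U),
          vi_map (T n) fi (t U i j n e x y) =
            t V i j n e (vi_map (X i) fi x) (vi_map (Y j) fi y)].

(* Thick ideals of the category of compact objects, given by their objects.
   Closure under retracts includes closure under isomorphisms. *)
Record thick_ideal (I : cplx p k -> Prop) : Prop := ThickIdeal {
  ti_compact : forall X, I X -> compact X;
  ti_zero : forall X, dhom_eq (did X) (dzero X X) -> I X;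
  ti_shift : forall X, compact X -> (I X <-> I (shift X));
  ti_triangle : forall X Y Z,
    compact X -> compact Y -> compact Z -> in_triangle X Y Z ->
    [/\ I X -> I Y -> I Z, I Y -> I Z -> I X & I X -> I Z -> I Y];
  ti_retract : forall X Y, compact X -> dretract X Y -> I Y -> I X;
  ti_tensor : forall X Y T, I X -> compact Y -> is_tensor X Y T -> I T }.

Definition thick_ideal_gen (M : cplx p k) : cplx p k -> Prop :=
  fun X => forall I : cplx p k -> Prop, thick_ideal I -> I M -> I X.

End Complexes.

Definition compact_obj (p : nat) (k : fieldType) : Type :=
  {M : cplx p k | compact M}.

Definition tt_equiv (p : nat) (k : fieldType) (M N : compact_obj p k) : Prop :=
  forall X : cplx p k,
    thick_ideal_gen (sval M) X <-> thick_ideal_gen (sval N) X.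

(* The class of [M] is the predicate [tt_equiv M]. *)
Definition tt_classes (p : nat) (k : fieldType) : Type :=
  {C : compact_obj p k -> Prop | exists M, C = tt_equiv M}.

Definition tt_class (p : nat) (k : fieldType) (M : compact_obj p k) :
    tt_classes p k :=
  exist _ (tt_equiv M) (ex_intro _ M erefl).

Local Open Scope classical_set_scope.

Definition tt_type (p : nat) (k : fieldType) (M : cplx p k) : set nat :=
  [set n | homology_nonzero M 'rV['F_p]_n].

Definition cofinite_or_empty : Type :=
  {S : set nat | cofinite_set S \/ S = set0}.

(* Main.v *)
From HB Require Import structures.
Require Import Defs.
From mathcomp Require Import all_boot all_order all_algebra.
From mathcomp Require Import boolp classical_sets functions cardinality.
From Stdlib Require Import Setoid Morphisms.
(* [cycle] is shadowed by the one of [path]. *)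
Import Defs.
Set Implicit Arguments.
Unset Strict Implicit.
Unset Printing Implicit Defensive.
Import GRing.Theory.
Local Open Scope ring_scope.

(* Write P(n) for k[Inj(F_p^n, -)], and call "level n" the value at F_p^n.  In
   characteristic zero, averaging over GL_n shows that the induced complexes
   G_n Z = k[Inj(F_p^n, -)] (x)_{GL_n} Z(F_p^n) are projective relative to the
   complexes acyclic at level n.  Coning off the counits G_n Z -> Z for n = 0, 1,
   2, ... kills a complex one level after the other; this gives K-projective
   resolutions, and for compact complexes the process stops after finitely many
   steps.  Since G_n of a compact complex is a finite iterated cone of retracts
   of shifts of P(n), a compact complex acyclic below level M lies in the thick
   subcategory generated by the P(r) with r >= M.

   Let N be compact and not acyclic.  In the last step of its tower there is a
   class w at some level e.  The alternating sum over sets S of nonzero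
   functionals on F_p^e of the injections v |-> (v, (s(v))_{s in S}) kills all that
   is induced from levels below e, so it moves w to a class of N itself at a
   higher level n.  That class splits off P(n) from N (x) P(n), so the thick ideal
   of N contains P(r) for all r >= n.  Hence types are cofinite or empty, and a
   thick ideal containing N2 contains every compact complex acyclic below some
   level M.  If N1 has the same type as N2, descending induction on n shows that
   P(n) (x) N1 lies in the thick ideal of N2, and P(0) is the tensor unit. *)

(** * Linear algebra over a field *)

(** Morphisms of the derived category are formal words, and nothing can be computed from them until
    they become chain maps. The relation [rel] lets words act on homotopy classes of maps out of a
    K-projective complex, and its invariance under [dhom_eq] identifies those classes with derived
    morphisms; compactness then becomes a finiteness statement about chain maps into strict direct
    sums. Two inductions occur. The one with coinvariants has a counit that is invertible at its own
    level; the plain one is left adjoint to a coinduction that commutes with direct sums. Averaging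
    makes the first a retract of the second. Similarly the P(n) are not stable under tensor
    products, whereas k[Hom(F_p^n, -)] and k[Hom(F_p^m, -)] multiply to k[Hom(F_p^(n+m), -)], so
    finiteness is tested on these and P(n) is a retract. The obstacle in the descent is that P(n)
    has homology at all levels from n on, so level n cannot be treated alone. Killing the levels
    strictly between n and M isolates it; there P(n) (x) N is induced from N(F_p^n), and a homology
    class of N2 splits off a cell. Levels from M on are harmless because their cells already lie in
    the ideal. *)

Lemma dchoice (I : Type) (T : I -> Type) (P : forall i, T i -> Prop) :
  (forall i, exists x, P i x) -> exists f : forall i, T i, forall i, P i (f i).
Proof.
move=> H; exists (fun i => sval (cid (H i))) => i.
exact: (svalP (cid (H i))).
Qed.

Section LinearAlgebra.
Variable k : fieldType.

Definition mkl (A B : lmodType k) (f : A -> B) (H : linear f) : {linear A -> B} :=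
  HB.pack f (GRing.isLinear.Build k A B *:%R f H).

(** Zorn's lemma, applied to graphs of partially defined linear maps B -> A that are sections of [d]
    over the part of its image where they are defined. No dimension is assumed finite, and this is
    the only source of complements and functionals on the k-side. *)
Lemma generalized_inverse (A B : lmodType k) (d : {linear A -> B}) :
  exists s : {linear B -> A}, forall x, d (s (d x)) = d x.
Proof.
pose P (G : set (B * A)) := [/\ forall (c : k) u v, G u -> G v ->
    G (c *: u.1 + v.1, c *: u.2 + v.2), forall a, G (0, a) -> a = 0 &
  forall u, G u -> (exists x, d x = u.1) -> d u.2 = u.1].
have [|G [[Glin Gfun Gd] Gmax]] := @Zorn_bigcup (B * A)%type P.
  move=> F FP Ftot; split.
  - move=> c u v [X FX Xu] [Y FY Yv].
    have [XY|YX] := Ftot _ _ FX FY.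
      by exists Y => //; have [H _ _] := FP _ FY; apply: H => //; apply: XY.
    by exists X => //; have [H _ _] := FP _ FX; apply: H => //; apply: YX.
  - by move=> a [X FX]; have [_ H _] := FP _ FX; apply: H.
  - by move=> u [X FX]; have [_ _ H] := FP _ FX; apply: H.
have G0 : G (0, 0).
  apply: contrapT => nG0; apply: (Gmax (G `|` [set (0, 0)])%classic).
    split; first by move=> u Gu; left.
    by move=> /(_ (0, 0)) H; apply/nG0/H; right.
  split.
  - move=> c u v [Gu|->] [Gv|->] /=; rewrite ?scaler0 ?addr0 ?add0r.
    + by left; apply: Glin.
    + have := Glin (c - 1) u u Gu Gu; rewrite !scalerBl !scale1r !subrK.
      by left.
    + by left; rewrite -surjective_pairing.
    + by right.
  - by move=> a [/Gfun//|[->]].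
  - by move=> u [Gu|->] /=; [exact: Gd|rewrite linear0].
have Gsc c u : G u -> G (c *: u.1, c *: u.2).
  by move=> Gu; have := Glin c _ _ Gu G0; rewrite /= !addr0.
have Gadd u v : G u -> G v -> G (u.1 + v.1, u.2 + v.2).
  by move=> Gu Gv; have := Glin 1 _ _ Gu Gv; rewrite !scale1r.
have Guniq b a a' : G (b, a) -> G (b, a') -> a = a'.
  move=> Ga Ga'; apply/subr0_eq/Gfun.
  by have := Glin (-1) _ _ Ga' Ga; rewrite /= !scaleN1r addNr addrC.
have Gtot b0 : exists a, G (b0, a).
  apply: contrapT => nGb0.
  (* The value to assign to the new vector [b0]. If [b0] meets the image of [d] modulo the current
     domain, a preimage corrected by the graph works; otherwise only c = 0 can occur in the
     condition, and 0 works. *)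
  have [a0 Ha0] : exists a0, forall c u, G u ->
      (exists x, d x = c *: b0 + u.1) -> d (c *: a0 + u.2) = c *: b0 + u.1.
    have [[u1 Gu1 [x1 dx1]]|nex] := pselect (exists2 u1, G u1 & exists x, d x = b0 + u1.1).
      exists (x1 - u1.2) => c u Gu [x dx].
      rewrite scalerBr -addrA linearD linearZ /= dx1.
      have := Gd (u.1 - c *: u1.1, u.2 - c *: u1.2).
      rewrite /= [- _ + _]addrC => ->.
      - by rewrite scalerDr -addrA [_ + (_ - _)]addrC subrK.
      - by have := Glin (- c) _ _ Gu1 Gu; rewrite !scaleNr ![- _ + _]addrC.
      - exists (x - c *: x1); rewrite linearB linearZ /= dx dx1 scalerDr opprD.
        by rewrite addrACA subrr add0r.
    exists 0 => c u Gu [x dx].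
    have [c0|c0] := eqVneq c 0.
      rewrite c0 !scale0r !add0r; apply: Gd => //.
      by exists x; rewrite dx c0 scale0r add0r.
    case: nex; exists (c^-1 *: u.1, c^-1 *: u.2); first exact: Gsc.
    by exists (c^-1 *: x); rewrite linearZ /= dx scalerDr scalerA mulVf // scale1r.
  apply: (Gmax [set v | exists c u, G u /\ v = (c *: b0 + u.1, c *: a0 + u.2)]%classic).
    split; first by move=> u Gu; exists 0, u; rewrite !scale0r !add0r -surjective_pairing.
    move=> H; apply: nGb0; exists a0; apply: H; exists 1, (0, 0).
    by rewrite /= !scale1r !addr0.
  split.
  - move=> c _ _ [c1 [u1 [Gu1 ->]]] [c2 [u2 [Gu2 ->]]] /=.
    exists (c * c1 + c2), (c *: u1.1 + u2.1, c *: u1.2 + u2.2); split.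
      exact: Glin.
    by rewrite /= !scalerDr !scalerDl !scalerA; congr (_, _); rewrite addrACA.
  - move=> a [c [u [Gu [e ->]]]].
    have [c0|c0] := eqVneq c 0.
      move: e; rewrite c0 !scale0r !add0r => e; apply: Gfun.
      by rewrite e -surjective_pairing.
    case: nGb0; exists (- c^-1 *: u.2).
    have -> : b0 = - c^-1 *: u.1.
      apply: (scalerI c0); rewrite scalerA mulrN divff // scaleN1r.
      by apply/eqP; rewrite -subr_eq0 opprK -e.
    exact: Gsc.
  - by move=> _ [c [u [Gu ->]]] /= H; apply: Ha0.
have [s Hs] := choice Gtot.
have slin : linear s.
  move=> c x y; apply: (Guniq (c *: x + y)) => //.
  exact: Glin (Hs x) (Hs y).
exists (mkl slin) => x; apply: (Gd _ (Hs (d x))).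
by exists x.
Qed.

End LinearAlgebra.

(* The module generated by [S] and the relations forced by [resp]: two words
   are identified when every map satisfying [resp] identifies them. *)
Section PresentedModule.
Variables (k : fieldType) (S : Type).
Variable resp : forall W : lmodType k, (S -> W) -> Prop.

Definition weval (W : lmodType k) (phi : S -> W) (w : seq (k * S)) : W :=
  \sum_(a <- w) a.1 *: phi a.2.

Definition weq (w w' : seq (k * S)) : Prop :=
  forall (W : lmodType k) (phi : S -> W), resp phi ->
    weval phi w = weval phi w'.

Record pres : Type := Pres {
  pres_class : seq (k * S) -> Prop;
  _ : exists w, pres_class = weq w }.

Definition pword (w : seq (k * S)) : pres :=
  @Pres (weq w) (ex_intro _ w erefl).

Lemma pwordP w w' : weq w w' -> pword w = pword w'.
Proof.
move=> H; rewrite /pword.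
have e : weq w = weq w'.
  apply/funext => v; apply/propext; split => h W phi r.
    by rewrite -(H _ _ r); apply: h.
  by rewrite (H _ _ r); apply: h.
move: (ex_intro _ _ _) (ex_intro _ _ _); rewrite e => p1 p2.
by rewrite (Prop_irrelevance p1 p2).
Qed.

Lemma pword_inj w w' : pword w = pword w' -> weq w w'.
Proof. by move=> [->]. Qed.

Lemma pword_surj x : exists w, x = pword w.
Proof.
case: x => c [w e]; exists w; subst c.
by congr (Pres _); exact: Prop_irrelevance.
Qed.

Definition prepr (x : pres) : seq (k * S) := sval (cid (pword_surj x)).
Lemma preprK x : pword (prepr x) = x.
Proof. by rewrite /prepr; case: cid => w /= ->. Qed.

HB.instance Definition _ := gen_eqMixin pres.
HB.instance Definition _ := gen_choiceMixin pres.

Definition wscale (c : k) (w : seq (k * S)) := [seq (c * a.1, a.2) | a <- w].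

Lemma weval_cat (W : lmodType k) (phi : S -> W) w w' :
  weval phi (w ++ w') = weval phi w + weval phi w'.
Proof. by rewrite /weval big_cat. Qed.

Lemma weval_scale (W : lmodType k) (phi : S -> W) c w :
  weval phi (wscale c w) = c *: weval phi w.
Proof.
by rewrite /weval big_map scaler_sumr; apply: eq_bigr => a _; rewrite scalerA.
Qed.

Lemma weval_repr (W : lmodType k) (phi : S -> W) w : resp phi ->
  weval phi (prepr (pword w)) = weval phi w.
Proof. by move=> r; apply: (pword_inj (preprK _)). Qed.

Definition padd x y := pword (prepr x ++ prepr y).
Definition pzero := pword [::].
Definition popp x := pword (wscale (-1) (prepr x)).
Definition pscale c x := pword (wscale c (prepr x)).

Let pE := (weval_cat, weval_scale).

Lemma paddA : associative padd.
Proof.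
by move=> x y z; apply: pwordP => W phi r; rewrite /padd /popp /pscale !(pE, weval_repr) // addrA.
Qed.
Lemma paddC : commutative padd.
Proof. by move=> x y; apply: pwordP => W phi r; rewrite /padd /popp /pscale !pE addrC. Qed.
Lemma padd0 : left_id pzero padd.
Proof.
move=> x; rewrite -[RHS]preprK; apply: pwordP => W phi r.
by rewrite /padd /popp /pscale !(pE, weval_repr) // /weval big_nil add0r.
Qed.
Lemma paddN : left_inverse pzero popp padd.
Proof.
move=> x; apply: pwordP => W phi r.
by rewrite /padd /popp /pscale !(pE, weval_repr) //= ?pE scaleN1r addNr /weval big_nil.
Qed.
HB.instance Definition _ := GRing.isZmodule.Build pres paddA paddC padd0 paddN.

Lemma pscaleA a b x : pscale a (pscale b x) = pscale (a * b) x.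
Proof.
by apply: pwordP => W phi r; rewrite /padd /popp /pscale !(pE, weval_repr) //= ?pE scalerA.
Qed.
Lemma pscale1 : left_id 1 pscale.
Proof.
move=> x; rewrite -[RHS]preprK; apply: pwordP => W phi r.
by rewrite !pE scale1r.
Qed.
Lemma pscaleDr : right_distributive pscale +%R.
Proof.
move=> a x y; apply: pwordP => W phi r.
by rewrite /padd /popp /pscale !(pE, weval_repr) //= ?pE scalerDr.
Qed.
Lemma pscaleDl x : {morph pscale^~ x : a b / a + b}.
Proof.
by move=> a b; apply: pwordP => W phi r;
    rewrite /padd /popp /pscale !(pE, weval_repr) //= ?pE scalerDl.
Qed.
HB.instance Definition _ :=
  GRing.Zmodule_isLmodule.Build k pres pscaleA pscale1 pscaleDr pscaleDl.

Definition pgen (s : S) : pres := pword [:: (1, s)].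

Lemma pword_weval w : pword w = weval pgen w.
Proof.
elim: w => [|[c s] w IH]; first by rewrite /weval big_nil.
rewrite /weval big_cons -/(weval _ _) -IH; apply: pwordP => W phi r.
rewrite -[c *: pgen s]/(pscale c (pgen s)) /pscale !(pE, weval_repr) //.
by rewrite /weval !big_cons big_nil scale1r addr0.
Qed.

Section Lift.
Variables (W : lmodType k) (phi : S -> W) (H : resp phi).
Definition plift_fun (x : pres) : W := weval phi (prepr x).
Lemma plift_linear : linear plift_fun.
Proof.
by move=> c x y; rewrite /plift_fun !(pE, weval_repr) //= ?pE.
Qed.
Lemma plift_ex : {f : {linear pres -> W} | forall s, f (pgen s) = phi s}.
Proof.
exists (mkl plift_linear) => s.
rewrite /= /plift_fun weval_repr // /weval big_cons big_nil /=.
by rewrite scale1r addr0.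
Qed.
Definition plift : {linear pres -> W} := sval plift_ex.
Lemma plift_gen s : plift (pgen s) = phi s.
Proof. exact: (svalP plift_ex). Qed.
End Lift.

Lemma pres_ext (W : lmodType k) (f g : {linear pres -> W}) :
  (forall s, f (pgen s) = g (pgen s)) -> f =1 g.
Proof.
move=> H x; rewrite -(preprK x) pword_weval /weval !linear_sum.
by apply: eq_bigr => a _; rewrite !linearZ /= H.
Qed.

(** Equality of words is by definition equality under all respectful maps, so an identity in the
    presented module is checked after each lift. The relations themselves are verified in this way
    for every presentation below. *)
Lemma pres_sep (x y : pres) :
  (forall (W : lmodType k) (phi : S -> W) (H : resp phi),
     plift H x = plift H y) -> x = y.
Proof.
move=> H; rewrite -(preprK x) -(preprK y); apply: pwordP => W phi r.
have E w : plift r (pword w) = weval phi w.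
  rewrite pword_weval /weval linear_sum; apply: eq_bigr => a _.
  by rewrite linearZ /= plift_gen.
rewrite -!E !preprK; exact: H.
Qed.

Lemma pres_ind (P : pres -> Prop) :
  P 0 -> (forall x y, P x -> P y -> P (x + y)) ->
  (forall c s, P (c *: pgen s)) -> forall x, P x.
Proof.
move=> P0 PD PZ x; rewrite -(preprK x) pword_weval /weval.
by apply: big_ind => // a _; apply: PZ.
Qed.

End PresentedModule.

(* [ring] does not apply to the underlying additive groups of modules. *)
Section AbelianGroupReflection.
Variable M : zmodType.

Inductive zexp := ZVar of nat | ZAdd of zexp & zexp | ZOpp of zexp | ZZero.

Fixpoint zeval (env : seq M) (e : zexp) : M :=
  match e with
  | ZVar i => nth 0 env i
  | ZAdd a b => zeval env a + zeval env b
  | ZOpp a => - zeval env a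
  | ZZero => 0
  end.

Fixpoint zcoef (e : zexp) (i : nat) : int :=
  match e with
  | ZVar j => if i == j then 1 else 0
  | ZAdd a b => zcoef a i + zcoef b i
  | ZOpp a => - zcoef a i
  | ZZero => 0
  end.

Lemma zevalE env e :
  zeval env e = \sum_(i < size env) env`_i *~ zcoef e i.
Proof.
elim: e => [j|a IHa b IHb|a IHa|] /=.
- have [jn|nj] := ltnP j (size env).
    rewrite (bigD1 (Ordinal jn)) //= eqxx mulr1z big1 ?addr0 // => i.
    by rewrite -val_eqE /= => /negPf ->; rewrite mulr0z.
  rewrite nth_default // big1 // => i _.
  case: eqP => [e|]; last by rewrite mulr0z.
  by move: (ltn_ord i); rewrite e ltnNge nj.
- by rewrite IHa IHb -big_split /=; apply: eq_bigr => i _; rewrite mulrzDr.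
- by rewrite IHa -sumrN; apply: eq_bigr => i _; rewrite mulrNz.
- by rewrite big1 // => i _; rewrite mulr0z.
Qed.

Lemma zabelP env e1 e2 :
  all (fun i => zcoef e1 i == zcoef e2 i) (iota 0 (size env)) ->
  zeval env e1 = zeval env e2.
Proof.
move=> /allP H; rewrite !zevalE; apply: eq_bigr => i _.
by rewrite (eqP (H i _)) // mem_iota ltn_ord.
Qed.
End AbelianGroupReflection.

(** Atoms are compared up to unification, since the same element is displayed in different ways as a
    member of a complex, of its shift or of a cone. *)
Ltac zmem x l :=
  lazymatch l with
  | nil => constr:(false)
  | ?y :: ?l' =>
    match constr:(Set) with
    | _ => let _ := match constr:(Set) with _ => first [constr_eq x y | unify x y] end in
        constr:(true)
    | _ => zmem x l'
    end
  end.
Ltac zatoms t l :=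
  lazymatch t with
  | (?a + ?b)%R => let l' := zatoms a l in zatoms b l'
  | (- ?a)%R => zatoms a l
  | 0%R => l
  | _ => let m := zmem t l in
         lazymatch m with true => l | false => constr:(t :: l) end
  end.
Ltac zindex x l :=
  lazymatch l with
  | ?y :: ?l' =>
    match constr:(Set) with
    | _ => let _ := match constr:(Set) with _ => first [constr_eq x y | unify x y] end in constr:(O)
    | _ => let n := zindex x l' in constr:(S n)
    end
  end.
Ltac zreify t l :=
  lazymatch t with
  | (?a + ?b)%R =>
      let a' := zreify a l in let b' := zreify b l in constr:(ZAdd a' b')
  | (- ?a)%R => let a' := zreify a l in constr:(ZOpp a')
  | 0%R => constr:(ZZero)
  | _ => let n := zindex t l in constr:(ZVar n)
  end.
Ltac zabel :=
  lazymatch goal with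
  | |- @eq ?T ?a ?b =>
    let l0 := zatoms a (@nil T) in
    let l := zatoms b l0 in
    let e1 := zreify a l in
    let e2 := zreify b l in
    refine (@zabelP _ l e1 e2 _); vm_compute; reflexivity
  end.

(** * VI-modules and injections *)

(* Differentials go from degree [n] to degree [n - 1]; stating facts in degree
   [n - 1] and moving them to all degrees with these two lemmas avoids casts. *)
Lemma int_pred_ind (P : int -> Prop) : (forall n, P (n - 1)) -> forall m, P m.
Proof. by move=> H m; rewrite -(addrK 1 m); apply: H. Qed.

Lemma reindex_pred (P : int -> Type) (F : forall n, P (n - 1)) :
  {F' : forall m, P m | forall n, F' (n - 1) = F n}.
Proof.
exists (fun m => eq_rect _ P (F (m + 1)) m (addrK 1 m)) => n.
have gen : forall m n' (e : m - 1 = n' - 1), eq_rect _ P (F m) _ e = F n'.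
  move=> m n' e; have em : m = n' by apply: (addIr (-1)).
  by subst m; rewrite (eq_irrelevance e erefl).
exact: gen.
Qed.

Section VIHom.
Import VectorInternalTheory.
Variables (p : nat).
Local Notation VS := (vectType 'F_p).
Implicit Types U V W : VS.

Definition vinj U V := {f : 'Hom(U, V) | lker f == 0%VS}.

Definition vinjOf U V (f : 'Hom(U, V)) (fi : lker f == 0%VS) : vinj U V :=
  exist (fun f : 'Hom(U, V) => is_true (lker f == 0%VS)) f fi.

Lemma vinj_eq U V (f g : vinj U V) : (forall x, sval f x = sval g x) -> f = g.
Proof. by move=> H; apply/val_inj/lfunP. Qed.

Lemma vinjI U V (f : vinj U V) : injective (sval f).
Proof. by apply/lker0P; exact: (valP f). Qed.

Lemma lker_id U : lker (\1%VF : 'End(U)) == 0%VS.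
Proof. by apply/lker0P => x y; rewrite !id_lfunE. Qed.

Lemma lker_comp U V W (g : 'Hom(V, W)) (f : 'Hom(U, V)) :
  lker g == 0%VS -> lker f == 0%VS -> lker (g \o f)%VF == 0%VS.
Proof.
move=> /lker0P gi /lker0P fi; apply/lker0P => x y.
by rewrite !comp_lfunE => /gi/fi.
Qed.

Definition iid U : vinj U U := vinjOf (lker_id U).
Definition icomp U V W (g : vinj V W) (f : vinj U V) : vinj U W :=
  vinjOf (lker_comp (valP g) (valP f)).

Lemma iidE U x : sval (iid U) x = x.
Proof. by rewrite /= id_lfunE. Qed.
Lemma icompE U V W (g : vinj V W) (f : vinj U V) x :
  sval (icomp g f) x = sval g (sval f x).
Proof. by rewrite /= comp_lfunE. Qed.

Lemma icompA U V W T (h : vinj W T) (g : vinj V W) (f : vinj U V) :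
  icomp h (icomp g f) = icomp (icomp h g) f.
Proof. by apply: vinj_eq => x; rewrite !icompE. Qed.
Lemma icomp1f U V (f : vinj U V) : icomp (iid V) f = f.
Proof. by apply: vinj_eq => x; rewrite icompE iidE. Qed.
Lemma icompf1 U V (f : vinj U V) : icomp f (iid U) = f.
Proof. by apply: vinj_eq => x; rewrite icompE iidE. Qed.
Lemma icompI U V W (g : vinj V W) (f f' : vinj U V) :
  icomp g f = icomp g f' -> f = f'.
Proof.
move=> e; apply: vinj_eq => x; apply: (vinjI (f := g)).
by rewrite -!icompE e.
Qed.

Lemma vinj_dim U V (f : vinj U V) : (\dim {:U} <= \dim {:V})%N.
Proof.
rewrite -(@limg_dim_eq _ _ _ (sval f)); last first.
  by apply/eqP; rewrite (eqP (valP f)) capv0.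
exact/dimvS/subvf.
Qed.

Lemma dim_rV n : \dim {:'rV['F_p]_n} = n.
Proof. by rewrite dimvf /dim /= mul1n. Qed.

Definition iinv U (f : vinj U U) : vinj U U.
Proof.
exists (sval f)^-1%VF; apply/lker0P => x y e.
by rewrite -(lker0_lfunVK (valP f) x) e (lker0_lfunVK (valP f)).
Defined.
Lemma icompVf U (f : vinj U U) : icomp (iinv f) f = iid U.
Proof. by apply: vinj_eq => x; rewrite icompE iidE (lker0_lfunK (valP f)). Qed.
Lemma icompfV U (f : vinj U U) : icomp f (iinv f) = iid U.
Proof. by apply: vinj_eq => x; rewrite icompE iidE (lker0_lfunVK (valP f)). Qed.

Lemma linfun_ex U V (f : U -> V) : linear f ->
  exists F : 'Hom(U, V), forall x, F x = f x.
Proof.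
move=> fl; pose L : {linear U -> V} := mkl fl.
by exists (linfun L) => x; rewrite lfunE.
Qed.

Lemma iso_of_dim U V : \dim {:U} = \dim {:V} ->
  exists (f : vinj U V) (g : vinj V U), icomp g f = iid U /\ icomp f g = iid V.
Proof.
rewrite !dimvf => e.
pose f0 (x : U) : V := r2v (castmx (erefl, e) (v2r x)).
pose g0 (x : V) : U := r2v (castmx (erefl, esym e) (v2r x)).
have fl : linear f0.
  move=> a x y; rewrite /f0 linearP /=.
  by rewrite (_ : castmx _ _ = a *: castmx (erefl, e) (v2r x) + castmx (erefl, e) (v2r y))
     ?linearP //; apply/matrixP => i j; rewrite !(castmxE, mxE).
have gl : linear g0.
  move=> a x y; rewrite /g0 linearP /=.
  by rewrite (_ : castmx _ _ = a *: castmx (erefl, esym e) (v2r x) + castmx (erefl, esym e) (v2r y))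
     ?linearP //; apply/matrixP => i j; rewrite !(castmxE, mxE).
have fg : cancel f0 g0.
  move=> x; rewrite /g0 /f0 r2vK.
  have ck m n (E : m = n) (y : 'rV['F_p]_m) :
    castmx (erefl, esym E) (castmx (erefl, E) y) = y by case: n / E.
  by rewrite ck v2rK.
have gf : cancel g0 f0.
  move=> x; rewrite /g0 /f0 r2vK.
  have ck m n (E : m = n) (y : 'rV['F_p]_n) :
    castmx (erefl, E) (castmx (erefl, esym E) y) = y by case: n / E y.
  by rewrite ck v2rK.
have [F FE] := linfun_ex fl; have [G GE] := linfun_ex gl.
have Fi : lker F == 0%VS.
  by apply/lker0P => x y; rewrite !FE => /(can_inj fg).
have Gi : lker G == 0%VS.
  by apply/lker0P => x y; rewrite !GE => /(can_inj gf).
exists (vinjOf Fi), (vinjOf Gi).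
split; apply: vinj_eq => x; rewrite icompE iidE.
  by rewrite -[RHS]fg -FE -GE.
by rewrite -[RHS]gf -GE -FE.
Qed.

Definition homs U V : seq 'Hom(U, V) :=
  [seq Hom A | A <- enum {: 'M['F_p]_(dim U, dim V)}].
Lemma mem_homs U V (f : 'Hom(U, V)) : f \in homs U V.
Proof. by case: f => A; apply: map_f; rewrite mem_enum. Qed.
Lemma homs_uniq U V : uniq (homs U V).
Proof. by rewrite map_inj_uniq ?enum_uniq // => A B []. Qed.

Definition vinjs U V : seq (vinj U V) := pmap insub (homs U V).
Lemma mem_vinjs U V (f : vinj U V) : f \in vinjs U V.
Proof. by rewrite mem_pmap_sub mem_homs. Qed.
Lemma vinjs_uniq U V : uniq (vinjs U V).
Proof. exact/pmap_sub_uniq/homs_uniq. Qed.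

(** Right multiplication by an automorphism permutes the injections. Equivariance of averages and
    compatibility with coinvariants both come from this reindexing. *)
Lemma sum_vinjs_comp (R : nmodType) U V (g : vinj U U) (F : vinj U V -> R) :
  \sum_(f <- vinjs U V) F (icomp f g) = \sum_(f <- vinjs U V) F f.
Proof.
rewrite -(big_map (fun f => icomp f g) xpredT F); apply/perm_big/uniq_perm.
- rewrite map_inj_uniq ?vinjs_uniq // => f f' e.
  by rewrite -(icompf1 f) -(icompfV g) icompA e -icompA icompfV icompf1.
- exact: vinjs_uniq.
move=> f; rewrite mem_vinjs; apply/mapP; exists (icomp f (iinv g)).
  exact: mem_vinjs.
by rewrite -icompA icompVf icompf1.
Qed.

End VIHom.

Section Modules.
Variables (p : nat) (k : fieldType).
Local Notation VS := (vectType 'F_p).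
Implicit Types (U V W : VS) (A B C : vi_mod p k).

Definition act A U V (f : vinj U V) : {linear A U -> A V} := vi_map A (valP f).

Lemma vi_mapE A U V (f : 'Hom(U, V)) (fi : lker f == 0%VS) (x : A U) :
  vi_map A fi x = act A (vinjOf fi) x.
Proof. by rewrite /act /=; congr (vi_map A _ x); apply: bool_irrelevance. Qed.

Lemma act1 A U (x : A U) : act A (iid U) x = x.
Proof. exact: vi_id. Qed.
Lemma actM A U V W (g : vinj V W) (f : vinj U V) (x : A U) :
  act A (icomp g f) x = act A g (act A f x).
Proof. exact: vi_comp. Qed.
Lemma nt_act A B (F : vi_nat A B) U V (f : vinj U V) (x : A U) :
  F V (act A f x) = act B f (F U x).
Proof. exact: nt_natural. Qed.

Definition mkn A B (F : forall V, {linear A V -> B V})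
    (H : forall U V (f : vinj U V) x, F V (act A f x) = act B f (F U x)) :
    vi_nat A B :=
  @ViNat p k A B F (fun U V f fi x =>
    etrans (congr1 (F V) (vi_mapE fi x)) (etrans (H U V (vinjOf fi) x)
      (esym (vi_mapE fi (F U x))))).

(** A functor of generators with, for each V, the class [gr] of maps that respect the relations.
    [gm_resp] makes the class stable under VI and [gen_resp] puts the tautological map into it.
    Direct sums, induced modules, cells and tensor products are all obtained from this one
    presentation. *)
Record gfun := GFun {
  gs :> VS -> Type;
  gm : forall U V, vinj U V -> gs U -> gs V;
  gr : forall V (W : lmodType k), (gs V -> W) -> Prop;
  gm1 : forall U s, gm (iid U) s = s;
  gmM : forall U V W (g : vinj V W) (f : vinj U V) s,
    gm (icomp g f) s = gm g (gm f s);
  gm_resp : forall U V (f : vinj U V) (W : lmodType k) (phi : gs V -> W),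
    gr phi -> gr (phi \o gm f);
  gen_resp : forall V, gr (pgen (@gr V)) }.

Section Pmod.
Variable F : gfun.
Definition pmod_obj V : lmodType k := pres (@gr F V).
Definition pg V (s : F V) : pmod_obj V := pgen (@gr F V) s.
Lemma pmod_map_ex U V (f : vinj U V) :
  {g : {linear pmod_obj U -> pmod_obj V} | forall s, g (pg s) = pg (gm f s)}.
Proof.
by exists (plift (gm_resp f (gen_resp F V))) => s; exact: plift_gen.
Qed.
Definition pmod_map U V (f : vinj U V) := sval (pmod_map_ex f).
Lemma pmod_mapE U V (f : vinj U V) s : pmod_map f (pg s) = pg (gm f s).
Proof. exact: (svalP (pmod_map_ex f)). Qed.

Lemma pmod_obj_ext V (W : lmodType k) (f g : {linear pmod_obj V -> W}) :
  (forall s, f (pg s) = g (pg s)) -> f =1 g.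
Proof. exact: pres_ext. Qed.

Lemma pmod_map1 U (x : pmod_obj U) : pmod_map (iid U) x = x.
Proof.
apply: (pmod_obj_ext (f := pmod_map (iid U)) (g := idfun)) => s /=.
by rewrite pmod_mapE gm1.
Qed.
Lemma pmod_mapM U V W (g : vinj V W) (f : vinj U V) (x : pmod_obj U) :
  pmod_map (icomp g f) x = pmod_map g (pmod_map f x).
Proof.
apply: (pmod_obj_ext (f := pmod_map (icomp g f)) (g := pmod_map g \o pmod_map f)) => s /=.
by rewrite !pmod_mapE gmM.
Qed.

Lemma pmod_map1' U (fi : lker (\1%VF : 'End(U)) == 0%VS) (x : pmod_obj U) :
  pmod_map (vinjOf fi) x = x.
Proof.
rewrite -[RHS]pmod_map1; have -> // : vinjOf fi = iid U.
exact: vinj_eq.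
Qed.
Lemma pmod_mapM' U V W (g : 'Hom(V, W)) (f : 'Hom(U, V))
    (gi : lker g == 0%VS) (fi : lker f == 0%VS)
    (hi : lker (g \o f)%VF == 0%VS) (x : pmod_obj U) :
  pmod_map (vinjOf hi) x = pmod_map (vinjOf gi) (pmod_map (vinjOf fi) x).
Proof.
rewrite -pmod_mapM; have -> // : vinjOf hi = icomp (vinjOf gi) (vinjOf fi).
exact: vinj_eq.
Qed.

Definition pmod : vi_mod p k :=
  @ViMod p k pmod_obj (fun U V f fi => pmod_map (vinjOf fi))
    pmod_map1' pmod_mapM'.

Lemma act_pg U V (f : vinj U V) (s : F U) :
  act pmod f (pg s) = pg (gm f s).
Proof.
rewrite /act /= pmod_mapE; have -> // : vinjOf (valP f) = f.
exact: vinj_eq.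
Qed.

Lemma pmod_lin_ext V (W : lmodType k) (f g : {linear pmod V -> W}) :
  (forall s, f (pg s) = g (pg s)) -> f =1 g.
Proof. exact: pres_ext. Qed.

Section PLift.
Variables (A : vi_mod p k) (phi : forall V, F V -> A V).
Hypothesis (phi_resp : forall V, gr (@phi V)).
Hypothesis (phi_nat : forall U V (f : vinj U V) s,
  phi (gm f s) = act A f (phi s)).
Lemma pmod_lift_nat U V (f : vinj U V) (x : pmod U) :
  plift (phi_resp V) (act pmod f x) = act A f (plift (phi_resp U) x).
Proof.
apply: (pmod_lin_ext (f := plift (phi_resp V) \o act pmod f)
  (g := act A f \o plift (phi_resp U))) => s.
have := act_pg f s; rewrite /comp /= => ->.
by rewrite !plift_gen.
Qed.
Lemma pmod_lift_ex :
  {f : vi_nat pmod A | forall V (s : F V), f V (pg s) = phi s}.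
Proof. by exists (mkn pmod_lift_nat) => V s; exact: plift_gen. Qed.
Definition pmod_lift : vi_nat pmod A := sval pmod_lift_ex.
Lemma pmod_liftE V (s : F V) : pmod_lift V (pg s) = phi s.
Proof. exact: (svalP pmod_lift_ex). Qed.
End PLift.

End Pmod.

End Modules.

(** * Complexes, homotopies and cones *)

Section NatTrans.
Variables (p : nat) (k : fieldType).
Local Notation VS := (vectType 'F_p).
Implicit Types (U V W : VS) (A B C D : vi_mod p k).

Lemma act_sum A B U V (f : vinj U V) (x : vi_sum A B U) :
  act (vi_sum A B) f x = (act A f x.1, act B f x.2).
Proof. by []. Qed.

Lemma copair_linear A B C (f : vi_nat A C) (g : vi_nat B C) V :
  linear (fun x : vi_sum A B V => f V x.1 + g V x.2).
Proof. by move=> a x y; rewrite !linearP scalerDr addrACA. Qed.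
Lemma copair_nat A B C (f : vi_nat A C) (g : vi_nat B C) U V (h : vinj U V)
    (x : vi_sum A B U) :
  mkl (copair_linear f g (V:=V)) (act _ h x) =
  act C h (mkl (copair_linear f g (V:=U)) x).
Proof. by rewrite /= !nt_act linearD. Qed.
Definition nt_copair A B C (f : vi_nat A C) (g : vi_nat B C) :
  vi_nat (vi_sum A B) C := mkn (copair_nat f g).

Lemma pair_linear A B C (f : vi_nat A B) (g : vi_nat A C) V :
  linear (fun x : A V => (f V x, g V x) : vi_sum B C V).
Proof. by move=> a x y; rewrite !linearP. Qed.
Lemma pair_nat A B C (f : vi_nat A B) (g : vi_nat A C) U V (h : vinj U V)
    (x : A U) :
  mkl (pair_linear f g (V:=V)) (act _ h x) =
  act _ h (mkl (pair_linear f g (V:=U)) x).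
Proof. by rewrite /= !nt_act. Qed.
Definition nt_pair A B C (f : vi_nat A B) (g : vi_nat A C) :
  vi_nat A (vi_sum B C) := mkn (pair_nat f g).

Definition nt_inl A B : vi_nat A (vi_sum A B) := nt_pair (nt_id A) (nt_zero A B).
Definition nt_inr A B : vi_nat B (vi_sum A B) := nt_pair (nt_zero B A) (nt_id B).
Definition nt_fst A B : vi_nat (vi_sum A B) A := nt_copair (nt_id A) (nt_zero B A).
Definition nt_snd A B : vi_nat (vi_sum A B) B := nt_copair (nt_zero A B) (nt_id B).

Lemma nt_fstE A B V (x : vi_sum A B V) : nt_fst A B V x = x.1.
Proof. by rewrite /= addr0. Qed.
Lemma nt_sndE A B V (x : vi_sum A B V) : nt_snd A B V x = x.2.
Proof. by rewrite /= add0r. Qed.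

(** Transport between provably equal degrees such as [n + 1 - 1] and [n], which are not
    convertible. *)
Definition tr (X : int -> vi_mod p k) m n (e : m = n) : vi_nat (X m) (X n) :=
  match e in _ = n return vi_nat (X m) (X n) with erefl => nt_id (X m) end.

Lemma tr_id (X : int -> vi_mod p k) m (e : m = m) V x : tr X e V x = x.
Proof. by rewrite (eq_irrelevance e erefl). Qed.
Lemma tr_tr (X : int -> vi_mod p k) m n l (e : m = n) (e' : n = l) (e'' : m = l)
    V x : tr X e' V (tr X e V x) = tr X e'' V x.
Proof. by subst n; subst l; rewrite !tr_id. Qed.
Lemma tr_d (X : cplx p k) m n (e : m = n) (e' : m - 1 = n - 1) V x :
  cx_d X n V (tr X e V x) = tr X e' V (cx_d X m V x).
Proof. by subst n; rewrite !tr_id. Qed.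
Lemma tr_nat (X Y : int -> vi_mod p k) (F : forall n : int, vi_nat (X n) (Y n))
  m n (e : m = n) V x : F n V (tr X e V x) = tr Y e V (F m V x).
Proof. by subst n; rewrite !tr_id. Qed.

End NatTrans.

Arguments nt_fstE {p k A B V}.
Arguments nt_sndE {p k A B V}.

Section Homotopy.
Variables (p : nat) (k : fieldType).
Local Notation VS := (vectType 'F_p).
Implicit Types (V : VS) (X Y Z : cplx p k).

Definition mkc X Y (F : forall n : int, vi_nat (X n) (Y n))
    (H : forall (n : int) V x, F (n - 1) V (cx_d X n V x) = cx_d Y n V (F n V x)) :
  chain_map X Y := ChainMap H.

Definition ceq X Y (f g : chain_map X Y) := forall (n : int) V, f n V =1 g n V.

(** The homotopy [h n] goes from degree n - 1 to degree n, so that the identity is stated in degree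
    n - 1 and involves no transport. *)
Definition nullh X Y (f : chain_map X Y) : Prop :=
  exists h : forall n : int, vi_nat (X (n - 1)) (Y n), forall (n : int) V x,
    f (n - 1) V x = cx_d Y n V (h n V x) + h (n - 1) V (cx_d X (n - 1) V x).

Definition cm_opp X Y (f : chain_map X Y) : chain_map X Y.
Proof.
refine (@mkc X Y (fun n => nt_opp (f n)) _).
by move=> n V x; rewrite /= cm_comm linearN.
Defined.
Definition cm_sub X Y (f g : chain_map X Y) := cm_add f (cm_opp g).

Lemma nullh_ext X Y (f g : chain_map X Y) : ceq f g -> nullh f -> nullh g.
Proof. by move=> e [h H]; exists h => n V x; rewrite -e H. Qed.

Lemma nullh_zero X Y (f : chain_map X Y) : ceq f (cm_zero X Y) -> nullh f.
Proof.
move=> e; exists (fun n => nt_zero _ _) => n V x; rewrite e /=.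
by rewrite linear0 addr0.
Qed.

Lemma nullh_add X Y (f g : chain_map X Y) :
  nullh f -> nullh g -> nullh (cm_add f g).
Proof.
move=> [h H] [h' H']; exists (fun n => nt_add (h n) (h' n)) => n V x.
by rewrite /= H H' linearD addrACA.
Qed.
Lemma nullh_opp X Y (f : chain_map X Y) : nullh f -> nullh (cm_opp f).
Proof.
move=> [h H]; exists (fun n => nt_opp (h n)) => n V x.
by rewrite /= H linearN opprD.
Qed.
Lemma nullh_compl X Y Z (g : chain_map Y Z) (f : chain_map X Y) :
  nullh f -> nullh (cm_comp g f).
Proof.
move=> [h H]; exists (fun n => nt_comp (g n) (h n)) => n V x.
by rewrite /= H linearD cm_comm.
Qed.
Lemma nullh_compr X Y Z (g : chain_map Y Z) (f : chain_map X Y) :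
  nullh g -> nullh (cm_comp g f).
Proof.
move=> [h H]; exists (fun n => nt_comp (h n) (f (n - 1))) => n V x.
by rewrite /= H cm_comm.
Qed.

Definition htp X Y (f g : chain_map X Y) := nullh (cm_sub f g).
Lemma htp_ext X Y (f g : chain_map X Y) : ceq f g -> htp f g.
Proof. by move=> e; apply: nullh_zero => n V x /=; rewrite e subrr. Qed.
Lemma htp_refl X Y (f : chain_map X Y) : htp f f.
Proof. exact: htp_ext. Qed.
Lemma htp_sym X Y (f g : chain_map X Y) : htp f g -> htp g f.
Proof. by move/nullh_opp; apply: nullh_ext => n V x /=; rewrite opprB. Qed.
Lemma htp_trans X Y (g f h : chain_map X Y) : htp f g -> htp g h -> htp f h.
Proof.
move=> a b; apply: nullh_ext (nullh_add a b) => n V x /=.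
by rewrite addrA subrK.
Qed.
Lemma htp_add X Y (f g f' g' : chain_map X Y) :
  htp f f' -> htp g g' -> htp (cm_add f g) (cm_add f' g').
Proof.
move=> a b; apply: nullh_ext (nullh_add a b) => n V x /=.
by rewrite opprD addrACA.
Qed.
Lemma htp_compl X Y Z (g : chain_map Y Z) (f f' : chain_map X Y) :
  htp f f' -> htp (cm_comp g f) (cm_comp g f').
Proof.
move=> a; apply: nullh_ext (nullh_compl g a) => n V x /=.
by rewrite linearB.
Qed.
Lemma htp_null X Y (f g : chain_map X Y) : htp f g -> nullh g -> nullh f.
Proof.
move=> a b; apply: nullh_ext (nullh_add a b) => n V x /=.
by rewrite subrK.
Qed.
Lemma htp_zero X Y (f : chain_map X Y) : nullh f <-> htp f (cm_zero X Y).
Proof.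
by split; apply: nullh_ext => n V x /=; rewrite ?subr0.
Qed.

Section Cone.
Variables (X Y : cplx p k) (f : chain_map X Y).

Definition cone_in : chain_map Y (cone f).
Proof.
refine (@mkc Y (cone f) (fun n => nt_inr (X (n - 1)) (Y n)) _).
by move=> n V x; rewrite /= /cone_d_fun /= !linear0 ?oppr0 add0r.
Defined.

Definition cone_out : chain_map (cone f) (shift X).
Proof.
refine (@mkc (cone f) (shift X) (fun n => nt_fst (X (n - 1)) (Y n)) _).
by move=> n V x; rewrite !nt_fstE.
Defined.

Lemma cone_outE n V x : cone_out n V x = x.1. Proof. exact: nt_fstE. Qed.
Lemma cone_dE n V (x : cone f n V) :
  cx_d (cone f) n V x = (- cx_d X (n - 1) V x.1, f (n - 1) V x.1 + cx_d Y n V x.2).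
Proof. by []. Qed.

Lemma cone_dE2 n V x y :
  cx_d (cone f) n V (x, y) = (- cx_d X (n - 1) V x, f (n - 1) V x + cx_d Y n V y).
Proof. by []. Qed.

(** A null-homotopy of [v] after [f] is precisely the missing component on the summand X of the
    cone. *)
Lemma cone_lift Z (v : chain_map Y Z) : nullh (cm_comp v f) ->
  exists c : chain_map (cone f) Z, ceq (cm_comp c cone_in) v.
Proof.
move=> [h H].
have comm n V (x : cone f n V) :
  nt_copair (h (n - 1)) (v (n - 1)) V (cx_d (cone f) n V x) =
  cx_d Z n V (nt_copair (h n) (v n) V x).
  rewrite cone_dE /= !linearD linearN.
  by have /= -> := H _ _ x.1; rewrite cm_comm; zabel.
exists (mkc comm) => n V y.
by rewrite /= linear0 add0r.
Qed.

(** Subtracting the null-homotopy [h] of the restriction to Y leaves the map [w] on X minus [h]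
    after [f], which is a chain map on the shift; [h] itself provides the homotopy. *)
Lemma cone_colift Z (w : chain_map (cone f) Z) : nullh (cm_comp w cone_in) ->
  exists a : chain_map (shift X) Z, htp (cm_comp a cone_out) w.
Proof.
move=> [h H].
pose an n : vi_nat (shift X n) (Z n) :=
  nt_add (nt_comp (w n) (nt_inl _ _)) (nt_opp (nt_comp (h n) (f (n - 1)))).
have comm n V x : an (n - 1) V (cx_d (shift X) n V x) = cx_d Z n V (an n V x).
  have /= Hf := H _ _ (f (n - 1) V x).
  have /= cw := cm_comm w ((x, 0) : cone f n V).
  move: cw Hf; rewrite /cone_d_fun /= !linear0 addr0 linearN linearB /=.
  rewrite -[w n V (x, 0)]/(w n V (nt_inl _ _ V x)) => <- Hf.
  have -> : (- cx_d X (n - 1) V x, f (n - 1) V x) =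
      (- cx_d X (n - 1) V x, 0) + (0, f (n - 1) V x) :> cone f (n - 1) V.
    by congr (_, _); rewrite /= ?addr0 ?add0r.
  rewrite linearD /= Hf cm_comm.
  have -> : (- cx_d X (n - 1) V x, 0) = - (cx_d X (n - 1) V x, 0) :> cone f (n - 1) V.
    by congr (_, _); rewrite /= oppr0.
  rewrite !linearN /=; zabel.
exists (mkc comm), (fun n => nt_opp (nt_comp (h n) (nt_snd _ _))) => n V [x y].
have /= Hy := H _ _ y.
rewrite /= !(add0r, addr0).
have -> : w (n - 1) V (x, y) = w (n - 1) V (x, 0) + w (n - 1) V (0, y).
  by rewrite -linearD; congr (w _ _ (_, _)); rewrite /= ?addr0 ?add0r.
by rewrite Hy !linearD !linearN /=; zabel.
Qed.

End Cone.

Definition acy X V : Prop := forall (n : int) (z : X (n - 1) V),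
  cycle z -> boundary z.
Definition qia X Y (f : chain_map X Y) V : Prop := forall (n : int),
  (forall z : X (n - 1) V, cycle z -> boundary (f (n - 1) V z) -> boundary z)
  /\ (forall w : Y (n - 1) V, cycle w ->
        exists2 z : X (n - 1) V, cycle z & boundary (f (n - 1) V z - w)).

Lemma qiaP X Y (f : chain_map X Y) : quasi_iso f <-> forall V, qia f V.
Proof. by split=> H => [V n|n V]; apply: H. Qed.

Lemma cycle_map X Y (f : chain_map X Y) (n : int) V (z : X n V) :
  cycle z -> cycle (f n V z).
Proof. by rewrite /cycle => e; rewrite -cm_comm e linear0. Qed.
Lemma boundary_map X Y (f : chain_map X Y) (n : int) V (z : X (n - 1) V) :
  boundary z -> boundary (f (n - 1) V z).
Proof. by move=> [y <-]; exists (f n V y); rewrite cm_comm. Qed.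
Lemma boundary0 X (n : int) V : boundary (0 : X (n - 1) V).
Proof. by exists 0; rewrite linear0. Qed.
Lemma boundaryD X (n : int) V (x y : X (n - 1) V) :
  boundary x -> boundary y -> boundary (x + y).
Proof. by move=> [a <-] [b <-]; exists (a + b); rewrite linearD. Qed.
Lemma boundaryN X (n : int) V (x : X (n - 1) V) :
  boundary x -> boundary (- x).
Proof. by move=> [a <-]; exists (- a); rewrite linearN. Qed.
Lemma boundaryB X (n : int) V (x y : X (n - 1) V) :
  boundary x -> boundary y -> boundary (x - y).
Proof. by move=> a b; apply/boundaryD/boundaryN. Qed.
Lemma boundary_d X (n : int) V (x : X n V) : boundary (cx_d X n V x).
Proof. by exists x. Qed.
Lemma cycle_d X (n : int) V (x : X n V) : cycle (cx_d X n V x).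
Proof. by rewrite /cycle cx_dd. Qed.
Lemma cycleD X (n : int) V (x y : X n V) : cycle x -> cycle y -> cycle (x + y).
Proof. by rewrite /cycle linearD => -> ->; rewrite addr0. Qed.
Lemma cycleN X (n : int) V (x : X n V) : cycle x -> cycle (- x).
Proof. by rewrite /cycle linearN => ->; rewrite oppr0. Qed.
Lemma cycleB X (n : int) V (x y : X n V) : cycle x -> cycle y -> cycle (x - y).
Proof. by move=> a b; apply/cycleD/cycleN. Qed.
Lemma cycle0 X (n : int) V : cycle (0 : X n V).
Proof. by rewrite /cycle linear0. Qed.

Lemma acy_cone X Y (f : chain_map X Y) V : qia f V -> acy (cone f) V.
Proof.
move=> q n [x y]; rewrite /cycle /= /cone_d_fun /= => -[/eqP].
rewrite oppr_eq0 => /eqP dx fxdy.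
have [x' ex'] : boundary x.
  apply: (q (n - 1)).1 => //; exists (- y).
  by rewrite linearN; apply/eqP; rewrite eq_sym -addr_eq0 fxdy.
have cyc : cycle (f (n - 1) V x' + y).
  by rewrite /cycle linearD /= -cm_comm ex'.
have [x'' dx'' [y' ey']] := (q n).2 _ cyc.
exists (x'' - x', - y'); rewrite /= /cone_d_fun /= !(linearB, linearN) /= dx'' ex'.
by congr (_, _); rewrite /= ?ey'; zabel.
Qed.

Lemma qia_cone X Y (f : chain_map X Y) V : acy (cone f) V -> qia f V.
Proof.
move=> a n; split; last first.
  move=> w dw; have [|[u v] /=] := a n ((0, w) : cone f (n - 1) V).
    by rewrite /cycle /= /cone_d_fun /= !linear0 add0r dw.
  rewrite /cone_d_fun /= => -[/eqP]; rewrite oppr_eq0 => /eqP du e.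
  by exists u => //; exists (- v); rewrite -e linearN /=; zabel.
(* Lowering the degree once more makes [z] the first component of an element of the cone in degree n
   - 1, with - y as second component. *)
elim/int_pred_ind: n => n z dz [y ey].
have [|[u v] /=] := a n ((z, - y) : cone f (n - 1) V).
  by rewrite /cycle /= /cone_d_fun /= dz oppr0 linearN -ey subrr.
by rewrite /cone_d_fun /= => -[e _]; exists (- u); rewrite linearN.
Qed.

Lemma acy_qia X Y (f : chain_map X Y) V : acy X V -> acy Y V -> qia f V.
Proof.
move=> aX aY n; split=> [z dz _|w dw]; first exact: aX.
exists 0; first exact: cycle0.
by rewrite linear0 sub0r; apply/boundaryN/aY.
Qed.
Lemma qia_acyl X Y (f : chain_map X Y) V : qia f V -> acy Y V -> acy X V.
Proof.
move=> q aY n z dz; apply: (q n).1 => //.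
exact/aY/cycle_map.
Qed.
Lemma qia_acyr X Y (f : chain_map X Y) V : qia f V -> acy X V -> acy Y V.
Proof.
move=> q aX n w dw; have [z dz b] := (q n).2 w dw.
rewrite -[w](subKr (f (n - 1) V z)); apply: boundaryB => //.
exact/boundary_map/aX.
Qed.
Lemma qia_comp X Y Z (f : chain_map X Y) (g : chain_map Y Z) V :
  qia f V -> qia g V -> qia (cm_comp g f) V.
Proof.
move=> qf qg n; split=> [z dz b|w dw].
  by apply: (qf n).1 => //; apply: (qg n).1 => //; apply: cycle_map.
have [y dy by_] := (qg n).2 w dw; have [x dx bx] := (qf n).2 y dy.
exists x => //=; rewrite -[_ - w](subrKA (g (n - 1) V y)) -linearB.
by apply: boundaryD => //; apply: boundary_map.
Qed.
Lemma qia_id X V : qia (cm_id X) V.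
Proof.
move=> n; split=> [z dz //|w dw]; exists w => //=.
by rewrite subrr; apply: boundary0.
Qed.
(** The inverse is a bare family of functions: its compatibility with the differentials and with 0
    follows from that of [f] by bijectivity. *)
Lemma qia_bij X Y (f : chain_map X Y) V
    (g : forall n : int, Y n V -> X n V) :
  (forall (n : int) x, g n (f n V x) = x) -> (forall (n : int) y, f n V (g n y) = y) ->
  qia f V.
Proof.
move=> gf fg n.
have dg (m : int) (y : Y m V) : cx_d X m V (g m y) = g (m - 1) (cx_d Y m V y).
  by rewrite -[LHS]gf cm_comm fg.
split=> [z dz [y ey]|w dw].
  by exists (g n y); rewrite dg ey gf.
have g0 (m : int) : g m 0 = 0 by rewrite -[0 in LHS](linear0 (f m V)) gf.
exists (g (n - 1) w); first by rewrite /cycle dg dw g0.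
by rewrite fg subrr; apply: boundary0.
Qed.

Lemma cone_cycleP X Y (f : chain_map X Y) (n : int) V x y :
  cycle ((x, y) : cone f n V) <->
  cx_d X (n - 1) V x = 0 /\ f (n - 1) V x + cx_d Y n V y = 0.
Proof.
split=> [e|[e1 e2]].
  split; last exact: (congr1 snd e).
  by apply/eqP; rewrite -oppr_eq0; apply/eqP; exact: (congr1 fst e).
by rewrite /cycle cone_dE2 e1 e2 oppr0.
Qed.

Lemma nullh_cycle X Y (f : chain_map X Y) (n : int) V (z : X (n - 1) V) :
  nullh f -> cycle z -> boundary (f (n - 1) V z).
Proof.
by move=> [h H] dz; rewrite H dz linear0 addr0; apply: boundary_d.
Qed.

(** Five lemma for a map of cones that is only triangular: its component from A' to B is arbitrary.
    This generality covers squares that commute merely up to homotopy. *)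
Lemma qia_cone_map A B A' B' (f : chain_map A B) (f' : chain_map A' B')
    (a : chain_map A' A) (b : chain_map B' B)
    (th : chain_map (cone f') (cone f)) V :
  ceq (cm_comp th (cone_in f')) (cm_comp (cone_in f) b) ->
  (forall (n : int) V x, (th n V x).1 = a (n - 1) V x.1) ->
  qia a V -> qia b V -> qia th V.
Proof.
move=> thin thout qa qb n.
have th0 (m : int) (y : B' m V) : th m V (0, y) = (0, b m V y) by apply: thin.
have thx (m : int) (x : A' (m - 1) V) : exists t,
    th m V (x, 0) = (a (m - 1) V x, t).
  by exists (th m V (x, 0)).2; rewrite -[a _ _ _]/(a (m - 1) V (x, (0 : B' m V)).1)
     -thout -surjective_pairing.
have thd (m : int) (x : A' (m - 1) V) t : cx_d A' (m - 1) V x = 0 ->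
    th m V (x, 0) = (a (m - 1) V x, t) ->
    b (m - 1) V (f' (m - 1) V x) = f (m - 1) V (a (m - 1) V x) + cx_d B m V t.
  move=> dx et; have := cm_comm th ((x, 0) : cone f' m V).
  rewrite et /= /cone_d_fun /= dx oppr0 linear0 addr0 th0.
  by case.
split; last first.
  case=> u v; rewrite /cycle /= /cone_d_fun /= => -[/eqP].
  rewrite oppr_eq0 => /eqP du fudv.
  have [x dx [u' eu']] := (qa _).2 u du.
  have [t et] := thx (n - 1) x.
  have bf := thd _ _ _ dx et.
  have [y ey] : boundary (f' (n - 1 - 1) V x).
    apply: (qb _).1; first exact: cycle_map.
    exists (f (n - 1) V u' - v + t); rewrite bf !(linearD, linearN) /=.
    rewrite -cm_comm eu' linearB /=.
    have -> : f (n - 1 - 1) V u = - cx_d B (n - 1) V v.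
      by apply/eqP; rewrite -addr_eq0 fudv.
    zabel.
  have cy : cycle ((x, - y) : cone f' (n - 1) V).
    by rewrite /cycle /= /cone_d_fun /= dx oppr0 linearN ey subrr.
  have thy : th (n - 1) V (x, - y) = (a (n - 1 - 1) V x, t - b (n - 1) V y).
    have -> : (x, - y) = (x, 0) - (0, y) :> cone f' (n - 1) V.
      by congr (_, _); rewrite /= ?subr0 ?sub0r.
    by rewrite linearB /= et th0; congr (_, _); rewrite /= ?subr0.
  (* Up to a boundary, the image of (x, - y) differs from (u, v) by a cycle [r] of B alone, which is
     then corrected by a cycle of B'. *)
  pose r := t - b (n - 1) V y - v + f (n - 1) V u'.
  have er : th (n - 1) V (x, - y) - (u, v) = (0, r) - cx_d (cone f) n V (u', 0).
    rewrite thy /= /cone_d_fun /= linear0 addr0 eu'.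
    by congr (_, _) => /=; rewrite /r; zabel.
  have cr : cycle r.
    have : cycle (th (n - 1) V (x, - y) - (u, v) + cx_d (cone f) n V (u', 0)).
      apply: cycleD; last exact: cycle_d.
      apply: cycleB; first exact: cycle_map.
      by rewrite /cycle /= /cone_d_fun /= du fudv oppr0.
    rewrite er subrK /cycle /= /cone_d_fun /= => -[_].
    by rewrite linear0 add0r.
  have [y' dy' by'] := (qb _).2 r cr.
  exists (((x, - y) : cone f' (n - 1) V) - ((0, y') : cone f' (n - 1) V)).
    apply: (cycleB (X := cone f')) => //.
    by rewrite /cycle /= /cone_d_fun /= !linear0 dy' add0r.
  rewrite linearB /= th0 addrAC er.
  have -> : (0, r) - cx_d (cone f) n V (u', 0) - (0, b (n - 1) V y') =
      - cx_d (cone f) n V (u', 0) - (0, b (n - 1) V y' - r) :> cone f (n - 1) V.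
    by congr (_, _) => /=; zabel.
  apply: boundaryB; first exact/boundaryN/boundary_d.
  by case: by' => s <-; exists (0, s); rewrite /= /cone_d_fun /= !linear0 ?oppr0 add0r.
case=> x y; rewrite /cycle /= /cone_d_fun /= => -[/eqP].
rewrite oppr_eq0 => /eqP dx fdy [[u v] /= euv].
have [x' ex'] : boundary x.
  apply: (qa _).1 => //; exists (- u).
  have := thout _ _ ((x, y) : cone f' (n - 1) V); rewrite -euv /= => <-.
  by rewrite linearN.
have [t et] := thx n x'.
pose y' := y + f' (n - 1) V x'.
have exy : (x, y) = (0, y') - cx_d (cone f') n V (x', 0).
  rewrite /= /cone_d_fun /= linear0 addr0 ex'.
  by congr (_, _); rewrite /= /y'; zabel.
have cy' : cycle y'.
  by rewrite /cycle linearD /= -cm_comm ex' -[RHS]fdy; zabel.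
rewrite exy; apply: boundaryB; last exact: boundary_d.
pose uv : cone f n V := (u, v).
have euv' : cx_d (cone f) n V uv = th (n - 1) V (x, y) by exact: euv.
have eb : (0, b (n - 1) V y') = cx_d (cone f) n V (uv + th n V (x', 0)).
  rewrite (linearD (cx_d (cone f) n V)) -cm_comm euv' -linearD -th0 exy.
  by rewrite subrK.
case e2: (uv + th n V (x', 0)) => [u' v'].
move: eb; rewrite e2 /= /cone_d_fun /= => -[/esym/eqP].
rewrite oppr_eq0 => /eqP du' bv'.
have [x'' dx'' [u'' eu'']] := (qa n).2 u' du'.
have [t'' et''] := thx n x''.
have bf := thd _ _ _ dx'' et''.
have [y'' ey''] : boundary (y' - f' (n - 1) V x'').
  apply: (qb n).1.
    by apply: cycleB => //; apply: cycle_map.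
  exists (v' - t'' - f n V u''); rewrite !linearB /= bf bv' -cm_comm eu'' linearB /=.
  zabel.
exists (x'', y''); rewrite /= /cone_d_fun /= dx'' ey'' oppr0.
by congr (_, _); rewrite /=; zabel.
Qed.

End Homotopy.

(** * Relative projectivity *)

Section Desuspension.
Variables (p : nat) (k : fieldType).
Local Notation VS := (vectType 'F_p).
Implicit Types (V : VS) (X Y Z G A : cplx p k).

Lemma ush_eq (n : int) : n + 1 - 1 = n - 1 + 1.
Proof. by rewrite addrK subrK. Qed.

(** Desuspension. Since [shift] lowers indices by [n - 1], its inverse needs transports, and inverts
    it only up to the isomorphism [ush_map]. *)
Definition ush X : cplx p k.
Proof.
refine (@Cplx p k (fun n : int => X (n + 1))
  (fun n : int => nt_opp (nt_comp (tr X (ush_eq n)) (cx_d X (n + 1)))) _).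
move=> n V x; rewrite /= linearN (tr_d _ (congr1 (fun m => m - 1) (ush_eq n))).
by rewrite cx_dd !linear0 ?oppr0.
Defined.

Lemma ush_dE X (n : int) V (x : ush X n V) :
  cx_d (ush X) n V x = - tr X (ush_eq n) V (cx_d X (n + 1) V x).
Proof. by []. Qed.

Definition ush_map X : chain_map (shift (ush X)) X.
Proof.
refine (@mkc _ _ (shift (ush X)) X (fun n : int => tr X (subrK 1 n)) _).
move=> n V x; rewrite [cx_d (shift _) n V x]/= opprK.
by rewrite (tr_d _ (congr1 (fun m => m - 1) (subrK 1 n))) (tr_tr _ _ (congr1 (fun m => m - 1)
    (subrK 1 n))).
Defined.

Lemma ush_map_qia X V : qia (ush_map X) V.
Proof.
apply: (@qia_bij _ _ _ _ (ush_map X) V (fun n : int => tr X (esym (subrK 1 n)) V)) => n x /=.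
  by rewrite (tr_tr _ _ erefl).
by rewrite (tr_tr _ _ erefl).
Qed.

Lemma ush_acy X V : acy X V -> acy (ush X) V.
Proof.
move=> a n z; rewrite /cycle ush_dE => /eqP; rewrite oppr_eq0 => /eqP dz.
have dz' : cx_d X (n - 1 + 1) V z = 0.
  have := congr1 (tr X (esym (ush_eq (n - 1))) V) dz.
  by rewrite (tr_tr _ _ erefl) linear0.
have [|y ey] := a _ (tr X (esym (ush_eq n)) V z).
  by rewrite /cycle (tr_d _ (congr1 (fun m => m - 1) (esym (ush_eq n)))) dz' linear0.
exists (- y); rewrite ush_dE linearN linearN opprK ey.
by rewrite (tr_tr _ _ erefl).
Qed.

Definition adj_ush G A (u : chain_map (shift G) A) : chain_map G (ush A).
Proof.
refine (@mkc _ _ G (ush A)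
  (fun n : int => nt_comp (u (n + 1)) (tr G (esym (addrK 1 n)))) _).
move=> n V x; rewrite ush_dE [in RHS]/=. rewrite -(cm_comm u) /= linearN linearN opprK.
rewrite (tr_d _ (congr1 (fun m => m - 1) (esym (addrK 1 n)))).
rewrite -(tr_nat (X := shift G) u (ush_eq n)) /=; congr (u _ _ _).
have E m l (e : m = l) (e' : m - 1 = l - 1) W y : tr (shift G) e W y = tr G e' W y.
  by subst l; rewrite !tr_id.
by rewrite (E _ _ _ (congr1 (fun m => m - 1) (ush_eq n))) !(tr_tr _ _ (esym (addrK 1 (n - 1)))).
Defined.

Lemma adj_ush_null G A (u : chain_map (shift G) A) :
  nullh (adj_ush u) -> nullh u.
Proof.
move=> [h H].
exists (fun n : int => nt_opp (nt_comp (tr A (subrK 1 n)) (h (n - 1)))) => n V y.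
have := congr1 (tr A (subrK 1 (n - 1)) V) (H _ _ y).
rewrite ush_dE linearD linearN (tr_tr _ _ (congr1 (fun m => m - 1) (subrK 1 n))).
have -> : adj_ush u (n - 1 - 1) V y =
   u (n - 1 - 1 + 1) V (tr G (esym (addrK 1 (n - 1 - 1))) V y) by [].
have -> z : tr A (subrK 1 (n - 1)) V (u (n - 1 - 1 + 1) V z) =
   u (n - 1) V (tr (shift G) (subrK 1 (n - 1)) V z) by rewrite tr_nat.
have E m l (e : m = l) (e' : m - 1 = l - 1) W z : tr (shift G) e W z = tr G e' W z.
  by subst l; rewrite !tr_id.
rewrite (E _ _ _ (congr1 (fun m => m - 1) (subrK 1 (n - 1)))) (tr_tr _ _ erefl) tr_id => ->.
by rewrite /= !linearN /= (tr_d _ (congr1 (fun m => m - 1) (subrK 1 n))) opprK.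
Qed.

(* [kp D G]: [G] is projective relative to the complexes acyclic on the class
   [D]; for [D] everything this is K-projectivity. *)
Definition kp (D : VS -> Prop) G : Prop :=
  forall A, (forall V, D V -> acy A V) -> forall u : chain_map G A, nullh u.
Definition kproj := kp (fun=> True).

Lemma kp_sub (D D' : VS -> Prop) G :
  (forall V, D V -> D' V) -> kp D G -> kp D' G.
Proof. by move=> s H A a u; apply: H => V /s; apply: a. Qed.

Lemma kp_shift D G : kp D G -> kp D (shift G).
Proof.
move=> H A a u; apply: adj_ush_null; apply: H => V /a.
exact: ush_acy.
Qed.

Lemma kp_retract D G G' (i : chain_map G G') (r : chain_map G' G) :
  ceq (cm_comp r i) (cm_id G) -> kp D G' -> kp D G.
Proof.
move=> ri H A a u.
apply: nullh_ext (nullh_compr i (H A a (cm_comp u r))) => n V x /=.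
by rewrite [r _ _ _]ri.
Qed.

Lemma kp_contractible D G : nullh (cm_id G) -> kp D G.
Proof. by move=> H A _ u; apply: nullh_ext (nullh_compl u H). Qed.

Lemma kp_cone D G G' (f : chain_map G G') : kp D G -> kp D G' -> kp D (cone f).
Proof.
move=> HG HG' A a u.
have [v Hv] := cone_colift (HG' A a (cm_comp u (cone_in f))).
apply: htp_null (htp_sym Hv) _; apply: nullh_compr.
exact: (kp_shift HG).
Qed.

Lemma cone_id_null X : nullh (cm_id (cone (cm_id X))).
Proof.
exists (fun n : int => nt_comp (nt_inl _ _) (nt_snd (X (n - 1 - 1)) (X (n - 1)))).
move=> n V [x y]; rewrite /= /cone_d_fun /= !linear0 ?addr0 ?add0r.
by congr (_, _) => /=; zabel.
Qed.

Lemma kp_cone_id D X : kp D (cone (cm_id X)).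
Proof. exact/kp_contractible/cone_id_null. Qed.

Lemma null_acy X V : nullh (cm_id X) -> acy X V.
Proof. by move=> H n z dz; apply: (nullh_cycle H dz). Qed.

(** The composite of [a] with X -> cone s is null-homotopic because the cone is acyclic. Of the
    null-homotopy, the first component is the lift and the second is the homotopy. *)
Lemma kproj_lift G X Y (s : chain_map Y X) (a : chain_map G X) :
  kproj G -> quasi_iso s -> exists b : chain_map G Y, htp (cm_comp s b) a.
Proof.
move=> HG /qiaP hs.
have [h H] : nullh (cm_comp (cone_in s) a).
  by apply: HG => V _; apply: acy_cone.
have [b' Hb'] := @reindex_pred (fun m => vi_nat (G m) (Y m))
  (fun n : int => nt_comp (nt_fst (Y (n - 1)) (X n)) (h n)).
have E (n : int) V x : b' (n - 1) V x = (h n V x).1.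
  by rewrite Hb' /= addr0.
have comm (m : int) V x : b' (m - 1) V (cx_d G m V x) = cx_d Y m V (b' m V x).
  elim/int_pred_ind: m x => n x; rewrite !E.
  have /= := congr1 fst (H _ _ x).
  by rewrite /cone_d_fun /= => /esym/eqP; rewrite addr_eq0 => /eqP/oppr_inj ->.
exists (mkc comm); exists (fun n : int => nt_opp (nt_comp (nt_snd _ _) (h n))).
move=> n V x /=.
have /= := congr1 snd (H _ _ x); rewrite /cone_d_fun /= !add0r E !linearN /= => ->.
by zabel.
Qed.

(** The pair of [b] and the opposite of the null-homotopy of its image is a chain map from the shift
    of G to the acyclic cone of [s]; contracting it yields a null-homotopy of [b] in the first
    component. *)
Lemma kproj_inj G X Y (s : chain_map Y X) (b : chain_map G Y) :
  kproj G -> quasi_iso s -> nullh (cm_comp s b) -> nullh b.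
Proof.
move=> HG /qiaP hs [h H].
pose c (n : int) : vi_nat (shift G n) (cone s n) :=
  nt_pair (b (n - 1)) (nt_opp (h n)).
have cc (n : int) V x : c (n - 1) V (cx_d (shift G) n V x) = cx_d (cone s) n V (c n V x).
  rewrite /= /cone_d_fun /= linearN cm_comm; congr (_, _).
  by have /= -> := H _ _ x; rewrite !linearN /=; zabel.
have [g Hg] : nullh (mkc cc).
  by apply: (kp_shift HG) => V _; apply: acy_cone.
have [g' Hg'] := @reindex_pred (fun m => vi_nat (G (m - 1)) (Y m))
  (fun n : int => nt_comp (nt_fst (Y (n - 1)) (X n)) (g n)).
exists (fun n => nt_opp (g' n)).
elim/int_pred_ind => n V x; have /= := congr1 fst (Hg _ _ x).
rewrite /cone_d_fun /= => ->; by rewrite !Hg' !linearN /= !addr0.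

Qed.

Lemma kproj_inj_htp G X Y (s : chain_map Y X) (b b' : chain_map G Y) :
  kproj G -> quasi_iso s -> htp (cm_comp s b) (cm_comp s b') -> htp b b'.
Proof.
move=> HG hs H; apply: (kproj_inj HG hs); apply: nullh_ext H => n V x /=.
by rewrite linearB.
Qed.

End Desuspension.

(** * Morphisms in the derived category *)

#[global] Instance dhom_eq_equiv p k (X Y : cplx p k) :
  Equivalence (@dhom_eq p k X Y).
Proof.
split.
- exact: dhom_eq_refl.
- exact: dhom_eq_sym.
- exact: dhom_eq_trans.
Qed.
#[global] Instance dcomp_proper p k (X Y Z : cplx p k) :
  Proper (@dhom_eq p k Y Z ==> @dhom_eq p k X Y ==> @dhom_eq p k X Z) (@dcomp p k X Y Z).
Proof. by move=> v v' vv u u' uu; apply: dhom_eq_dcomp. Qed.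
#[global] Instance dadd_proper p k (X Y : cplx p k) :
  Proper (@dhom_eq p k X Y ==> @dhom_eq p k X Y ==> @dhom_eq p k X Y) (@dadd p k X Y).
Proof. by move=> v v' vv u u' uu; apply: dhom_eq_dadd. Qed.

#[global] Hint Resolve dhom_eq_refl : core.

Section DerivedHom.
Variables (p : nat) (k : fieldType).
Local Notation VS := (vectType 'F_p).
Implicit Types (V : VS) (X Y Z G A : cplx p k).
Local Notation "u ~~ v" := (dhom_eq u v) (at level 70).
Local Notation "v ** u" := (dcomp v u) (at level 40, left associativity).
Local Notation "u ++ v" := (dadd u v).

(** This is not one of the generating relations and is derived by induction on the word [u]; an
    inverse of [s] is absorbed by writing the zero morphism as zero after [s]. *)
Lemma dcomp0l X Y Z (u : dhom X Y) : dzero Y Z ** u ~~ dzero X Z.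
Proof.
elim: u Z => {X Y} [X Y f|X Y s hs|X Y T v IHv u IHu|X Y u IHu v IHv] Z.
- by rewrite /dzero -dmap_comp; apply: dmap_ext.
- have e : dzero Y Z ~~ dzero X Z ** dmap s.
    by rewrite /dzero -dmap_comp; apply: dmap_ext.
  by rewrite e -dcompA dinvK dcomp1r.
- by rewrite dcompA IHv IHu.
- by rewrite dcompDr IHu IHv dadd0l.
Qed.

Lemma dcomp0r X Y Z (v : dhom Y Z) : v ** dzero X Y ~~ dzero X Z.
Proof.
elim: v X => {Y Z} [Y Z f|Y Z s hs|Y T Z v IHv u IHu|Y Z u IHu v IHv] X.
- by rewrite /dzero -dmap_comp; apply: dmap_ext => n V x /=; rewrite linear0.
- have e : dzero X Y ~~ dmap s ** dzero X Z.
    by rewrite /dzero -dmap_comp; apply: dmap_ext => n V x /=; rewrite linear0.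
  by rewrite e dcompA dmapK dcomp1l.
- by rewrite -dcompA IHu IHv.
- by rewrite dcompDl IHu IHv dadd0l.
Qed.

Definition dopp X Y (u : dhom X Y) := dmap (cm_opp (cm_id Y)) ** u.

Lemma daddNr X Y (u : dhom X Y) : u ++ dopp u ~~ dzero X Y.
Proof.
have e : did Y ++ dmap (cm_opp (cm_id Y)) ~~ dzero Y Y.
  by rewrite /did -dmap_add; apply: dmap_ext => n V x /=; rewrite subrr.
by rewrite -{1}[u]dcomp1l /dopp -dcompDl e dcomp0l.
Qed.

Lemma daddIr X Y (u v w : dhom X Y) : u ++ w ~~ v ++ w -> u ~~ v.
Proof.
move=> e; have : (u ++ w) ++ dopp w ~~ (v ++ w) ++ dopp w by rewrite e.
by rewrite -!daddA !daddNr ![_ ++ dzero _ _]daddC !dadd0l.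
Qed.

Lemma dsub0 X Y (u v : dhom X Y) : u ++ dopp v ~~ dzero X Y -> u ~~ v.
Proof. by move=> e; apply: (daddIr (w := dopp v)); rewrite e daddNr. Qed.

(** On an acyclic complex the zero endomorphism is a quasi-isomorphism, and inverting it forces the
    identity to vanish. *)
Lemma acy_dzero X : (forall V, acy X V) -> did X ~~ dzero X X.
Proof.
move=> a; have q : quasi_iso (cm_zero X X).
  by apply/qiaP => V; apply: acy_qia.
by rewrite -(dmapK q) -/(dzero X X) dcomp0r.
Qed.

(** A null-homotopic map extends over the cone of the identity, which is contractible and hence a
    zero object. So homotopic maps are identified although homotopies do not occur in the definition
    of [dhom_eq]. *)
Lemma dmap_null X Y (f : chain_map X Y) : nullh f -> dmap f ~~ dzero X Y.
Proof.
move=> nf.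
have [c Hc] : exists c : chain_map (cone (cm_id X)) Y, ceq (cm_comp c (cone_in _)) f.
  by apply: cone_lift; apply: nullh_ext nf.
have ac V : acy (cone (cm_id X)) V by apply/null_acy/cone_id_null.
rewrite -(dmap_ext Hc) dmap_comp -[dmap c]dcomp1r.
by rewrite (acy_dzero ac) dcomp0r dcomp0l.
Qed.

Lemma dmap_opp X Y (f : chain_map X Y) : dmap (cm_opp f) ~~ dopp (dmap f).
Proof. by rewrite /dopp -dmap_comp; apply: dmap_ext. Qed.

Lemma dmap_htp X Y (f g : chain_map X Y) : htp f g -> dmap f ~~ dmap g.
Proof.
by move=> h; apply: dsub0; rewrite -dmap_opp -dmap_add; apply: dmap_null.
Qed.

Section Rel.
Variable G : cplx p k.

(* [rel u a b]: composition with [u] sends the homotopy class of [a] to that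
   of [b].  For K-projective [G] this computes Hom(G, -) of the formal
   expression [u]. *)
Fixpoint rel X Y (u : dhom X Y) : chain_map G X -> chain_map G Y -> Prop :=
  match u with
  | dmap X Y f => fun a b => htp (cm_comp f a) b
  | dinv X Y s hs => fun a b => htp (cm_comp s b) a
  | dcomp X Y Z v u => fun a c => exists2 b, rel u a b & rel v b c
  | dadd X Y u v => fun a c =>
      exists b b', [/\ rel u a b, rel v a b' & htp (cm_add b b') c]
  end.

Hypothesis HG : kproj G.

Lemma rel_total X Y (u : dhom X Y) a : exists b, rel u a b.
Proof.
elim: u a => {X Y} [X Y f|X Y s hs|X Y T v IHv u IHu|X Y u IHu v IHv] a /=.
- by exists (cm_comp f a); apply: htp_refl.
- exact: kproj_lift.
- by have [b Hb] := IHu a; have [c Hc] := IHv b; exists c, b.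
- have [b Hb] := IHu a; have [b' Hb'] := IHv a.
  by exists (cm_add b b'), b, b'; split => //; apply: htp_refl.
Qed.

Lemma rel_htp X Y (u : dhom X Y) a a' b b' :
  rel u a b -> htp a a' -> htp b b' -> rel u a' b'.
Proof.
elim: u a a' b b' => {X Y} [X Y f|X Y s hs|X Y T v IHv u IHu|X Y u IHu v IHv] a a' b b' /=.
- move=> h ha hb; apply: htp_trans hb; apply: htp_trans h.
  exact/htp_compl/htp_sym.
- move=> h ha hb; apply: htp_trans ha; apply: htp_trans h.
  exact/htp_compl/htp_sym.
- move=> [c uc vc] ha hb; exists c.
    by apply: IHu uc ha _; apply: htp_refl.
  by apply: IHv vc _ hb; apply: htp_refl.
- move=> [c [c' [h1 h2 h3]]] ha hb; exists c, c'; split.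
  + by apply: IHu h1 ha _; apply: htp_refl.
  + by apply: IHv h2 ha _; apply: htp_refl.
  + exact: htp_trans hb.
Qed.

Lemma rel_fun X Y (u : dhom X Y) a b b' : rel u a b -> rel u a b' -> htp b b'.
Proof.
elim: u a b b' => {X Y} [X Y f|X Y s hs|X Y T v IHv u IHu|X Y u IHu v IHv] a b b' /=.
- by move=> h h'; apply: htp_trans h'; apply: htp_sym.
- move=> h h'; apply: (kproj_inj_htp HG hs); apply: htp_trans h _.
  exact: htp_sym.
- move=> [c uc vc] [c' uc' vc']; apply: IHv vc _.
  apply: rel_htp vc' _ (htp_refl _); exact: IHu uc' uc.
- move=> [c [c' [h1 h2 h3]]] [d [d' [g1 g2 g3]]].
  apply: htp_trans g3; apply: htp_trans (htp_sym h3) _.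
  by apply: htp_add; [apply: IHu h1 g1|apply: IHv h2 g2].
Qed.

(** Since [rel u] is total and [rel v] is single-valued up to homotopy, an inclusion is an equality.
    Each generating relation of [dhom_eq] therefore needs checking in one direction only. *)
Lemma rel_sub X Y (u v : dhom X Y) :
  (forall a b, rel u a b -> rel v a b) -> forall a b, rel v a b -> rel u a b.
Proof.
move=> H a b vb; have [b' ub'] := rel_total u a.
apply: (rel_htp ub'); first exact: htp_refl.
exact: (rel_fun (H _ _ ub') vb).
Qed.

Lemma rel_eq X Y (u v : dhom X Y) : u ~~ v -> forall a b, rel u a b <-> rel v a b.
Proof.
suff: u ~~ v -> forall a b, rel u a b -> rel v a b.
  by move=> H e a b; split; [exact: H|apply: rel_sub; exact: H].
have rr := @htp_refl p k.
elim => {X Y u v}.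
- by [].
- by move=> X Y u v _ IH; apply: rel_sub.
- by move=> X Y u v w _ IH1 _ IH2 a b /IH1/IH2.
- by move=> X Y Z v v' u u' _ IH1 _ IH2 a c [b /IH2 ? /IH1 ?]; exists b.
- by move=> X Y u u' v v' _ IH1 _ IH2 a c [b [b' [/IH1 ? /IH2 ? ?]]]; exists b, b'.
- by move=> X Y Z T w v u a d /= [c [b ub vc] wd]; exists b => //; exists c.
- move=> X Y u a b /= [c uc cb]; apply: rel_htp uc (rr _ _ _) _.
  by apply: htp_trans cb; apply: htp_ext.
- move=> X Y u a b /= [c ac uc]; apply: rel_htp uc _ (rr _ _ _).
  by apply: htp_sym; apply: htp_trans ac; apply: htp_ext.
- move=> X Y u v w a b /= [c [d [uc [e [e' [ve we h]]] h']]].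
  exists (cm_add c e), e'; split=> //; first by exists c, e; split.
  apply: htp_trans h'; apply: htp_trans (htp_add (rr _ _ c) h).
  by apply: htp_ext => n V x /=; rewrite addrA.
- move=> X Y u v a b /= [c [d [uc vd h]]]; exists d, c; split=> //.
  by apply: htp_trans h; apply: htp_ext => n V x /=; zabel.
- move=> X Y u a b /= [c [d [c0 ud h]]]; apply: rel_htp ud (rr _ _ _) _.
  apply: htp_trans h; apply: htp_trans (htp_add c0 (rr _ _ d)).
  by apply: htp_ext => n V x /=; rewrite add0r.
- move=> X Y Z v w u a c /= [b ub [d [e [vd we h]]]].
  by exists d, e; split=> //; exists b.
(* Distributivity on this side needs additivity of [rel w], which takes a separate induction on the
   word [w]. *)
- move=> X Y Z w u v a c /= [b [d [e [ud ve h]]] wb].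
  have [d' wd'] := rel_total w d; have [e' we'] := rel_total w e.
  exists d', e'; split; [by exists d|by exists e|].
  elim: w c b d e wb h d' wd' e' we' {ud ve} => {Y Z u v}
    [Y Z f|Y Z s hs|Y T Z v IHv u IHu|Y Z u IHu v IHv] c b d e /= wb h d' wd' e' we'.
  + apply: htp_trans (htp_add (htp_sym wd') (htp_sym we')) _.
    apply: htp_trans wb; apply: htp_trans (htp_compl f h).
    by apply: htp_ext => n V x /=; rewrite linearD.
  + apply: (kproj_inj_htp HG hs).
    apply: htp_trans (htp_sym wb); apply: htp_trans h.
    apply: htp_trans (htp_add wd' we').
    by apply: htp_ext => n V x /=; rewrite linearD.
  + case: wb => b1 ub1 vb1; case: wd' => d1 ud1 vd1; case: we' => e1 ue1 ve1.
    by apply: (IHv _ _ _ _ vb1 _ _ vd1 _ ve1); apply: (IHu _ _ _ _ ub1 h _ ud1 _ ue1).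
  + case: wb => [b1 [b2 [ub vb hb]]]; case: wd' => [d1 [d2 [ud vd hd]]].
    case: we' => [e1 [e2 [ue ve he]]].
    apply: htp_trans hb.
    apply: htp_trans (htp_add (IHu _ _ _ _ ub h _ ud _ ue) (IHv _ _ _ _ vb h _ vd _ ve)).
    apply: htp_trans (htp_add (htp_sym hd) (htp_sym he)) _.
    by apply: htp_ext => n V x /=; zabel.
- move=> X Y f g e a b /= h; apply: htp_trans h.
  by apply: htp_ext => n V x /=; rewrite e.
- move=> X Y Z g f a b /= h; exists (cm_comp f a); first exact: rr.
  by apply: htp_trans h; apply: htp_ext.
- move=> X Y f g a b /= h; exists (cm_comp f a), (cm_comp g a).
  by split; [exact: rr|exact: rr|]; apply: htp_trans h; apply: htp_ext.
- move=> X Y s hs a b /= [c h h']; apply: htp_trans h'.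
  by apply: htp_trans (htp_sym h); apply: htp_ext.
- move=> X Y s hs a b /= [c h h'].
  apply: (kproj_inj_htp HG hs); apply: htp_trans (htp_trans h (htp_sym h')).
  by apply: htp_compl; apply: htp_ext.
Qed.

Lemma rel_dhom X Y (u : dhom X Y) a b : rel u a b -> u ** dmap a ~~ dmap b.
Proof.
elim: u a b => {X Y} [X Y f|X Y s hs|X Y T v IHv u IHu|X Y u IHu v IHv] a b /=.
- by move=> h; rewrite -dmap_comp; apply: dmap_htp.
- move=> h; rewrite -(dmap_htp h) dmap_comp dcompA dmapK.
  exact: dcomp1l.
- by move=> [c /IHu h1 /IHv h2]; rewrite -dcompA h1 h2.
- move=> [c [c' [/IHu h1 /IHv h2 h]]].
  by rewrite dcompDl h1 h2 -dmap_add; apply: dmap_htp.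
Qed.

(** Letting the word act on the identity of G yields the chain map. Together with [d_faith] this
    identifies derived morphisms out of a K-projective complex with homotopy classes. *)
Lemma d_lift Y (u : dhom G Y) : exists f : chain_map G Y, u ~~ dmap f.
Proof.
have [b /rel_dhom h] := rel_total u (cm_id G).
exists b; apply: (dhom_eq_trans _ h); apply: dhom_eq_sym; exact: dcomp1r.
Qed.

Lemma d_faith Y (f g : chain_map G Y) : dmap f ~~ dmap g -> htp f g.
Proof.
move=> /rel_eq /(_ (cm_id G) g) [_ /= H].
have /H h : htp (cm_comp g (cm_id G)) g by apply: htp_ext.
by apply: htp_trans h; apply: htp_ext.
Qed.

Lemma d_faith0 Y (f : chain_map G Y) : dmap f ~~ dzero G Y -> nullh f.
Proof. by move=> e; apply/htp_zero; apply: d_faith. Qed.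

End Rel.

End DerivedHom.

(** * Direct sums and telescopes *)

Section DirectSumModule.
Variables (p : nat) (k : fieldType) (I : eqType).
Variable N : I -> vi_mod p k.

Definition ds_resp V (W : lmodType k) (phi : {i : I & N i V} -> W) : Prop :=
  forall i, linear (fun x => phi (existT (fun i => N i V : Type) i x)).

Definition ds_gfun : gfun p k.
Proof.
refine (@GFun p k (fun V => {i : I & N i V})
  (fun U V f s => existT (fun i => N i V : Type) (tag s) (act (N (tag s)) f (tagged s)))
  ds_resp _ _ _ _).
- by move=> U [i x] /=; rewrite act1.
- by move=> U V W g f [i x] /=; rewrite actM.
- by move=> U V f W phi H i a x y; rewrite /= linearP H.
- move=> V i a x y; apply: pres_sep => W phi H.
  by rewrite !linearP /= !plift_gen H.
Defined.

Definition dsm : vi_mod p k := pmod ds_gfun.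

Lemma ds_in_linear i V : linear (fun x : N i V => @pg p k ds_gfun V (existT _ i x) : dsm V).
Proof. exact: (gen_resp ds_gfun V). Qed.
Lemma ds_in_ex i : {f : vi_nat (N i) dsm |
  forall V x, f V x = @pg p k ds_gfun V (existT (fun i => N i V : Type) i x)}.
Proof.
unshelve eexists.
  refine (@mkn p k (N i) dsm (fun V => mkl (ds_in_linear (i:=i) (V:=V))) _).
  by move=> U V f x; rewrite /= (act_pg (F := ds_gfun)).
by [].
Qed.
Definition ds_in i := sval (ds_in_ex i).
Lemma ds_inE i V x : ds_in i V x = @pg p k ds_gfun V (existT (fun i => N i V : Type) i x).
Proof. exact: (svalP (ds_in_ex i)). Qed.

Lemma ds_ext V (W : lmodType k) (f g : {linear dsm V -> W}) :
  (forall i (x : N i V), f (ds_in i V x) = g (ds_in i V x)) -> f =1 g.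
Proof. by move=> H; apply: (@pmod_lin_ext p k ds_gfun) => -[i x]; rewrite -ds_inE; apply: H. Qed.

Lemma ds_ind V (P : dsm V -> Prop) :
  (forall i x, P (ds_in i V x)) -> (forall x y, P x -> P y -> P (x + y)) ->
  P 0 -> forall x, P x.
Proof.
move=> Pin PD P0; apply: pres_ind => // c [i x].
by have := Pin i (c *: x); rewrite linearZ /= ds_inE.
Qed.

Section Lift.
Variables (A : vi_mod p k) (f : forall i, vi_nat (N i) A).
Lemma ds_lift_ex : {F : vi_nat dsm A | forall i V x, F V (ds_in i V x) = f i V x}.
Proof.
pose phi V (s : ds_gfun V) : A V := f (tag s) V (tagged s).
have r V : gr (@phi V) by move=> i a x y; rewrite /phi /= linearP.
have n U V (g : vinj U V) s : phi V (gm g s) = act A g (phi U s).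
  by rewrite /phi /= nt_act.
by exists (pmod_lift r n) => i V x; rewrite ds_inE pmod_liftE.
Qed.
Definition ds_lift := sval ds_lift_ex.
Lemma ds_liftE i V x : ds_lift V (ds_in i V x) = f i V x.
Proof. exact: (svalP ds_lift_ex). Qed.
End Lift.

End DirectSumModule.

Section DirectSum.
Variables (p : nat) (k : fieldType) (I : eqType).
Variable N : I -> cplx p k.

Definition dsc : cplx p k.
Proof.
refine (@Cplx p k (fun n : int => dsm (fun i => N i n))
  (fun n : int => ds_lift (fun i => nt_comp (ds_in (fun i => N i (n - 1)) i) (cx_d (N i) n))) _).
move=> n V x.
pose F : {linear _ -> _} := ds_lift (fun i => nt_comp (ds_in (fun i => N i (n - 1 - 1)) i) (cx_d
    (N i) (n - 1))) V \o
  ds_lift (fun i => nt_comp (ds_in (fun i => N i (n - 1)) i) (cx_d (N i) n)) V.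
rewrite -[LHS]/(F x); have -> : F x = (\0 : {linear _ -> _}) x; last by [].
apply: (ds_ext (f := F) (g := \0)) => i y.
by rewrite /F [LHS]/= ds_liftE /= ds_liftE /= cx_dd linear0.
Defined.

Definition dsc_in i : chain_map (N i) dsc.
Proof.
refine (@mkc _ _ (N i) dsc (fun n : int => ds_in (fun i => N i n) i) _).
by move=> n V x; rewrite [in RHS]/= ds_liftE.
Defined.

Lemma dsc_dE i (n : int) V x :
  cx_d dsc n V (dsc_in i n V x) = dsc_in i (n - 1) V (cx_d (N i) n V x).
Proof. by rewrite cm_comm. Qed.

Lemma dsc_ext (n : int) V (W : lmodType k) (f g : {linear dsc n V -> W}) :
  (forall i (x : N i n V), f (dsc_in i n V x) = g (dsc_in i n V x)) -> f =1 g.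
Proof. exact: ds_ext. Qed.

Lemma dsc_ind (n : int) V (P : dsc n V -> Prop) :
  (forall i x, P (dsc_in i n V x)) -> (forall x y, P x -> P y -> P (x + y)) ->
  P 0 -> forall x, P x.
Proof. exact: ds_ind. Qed.

Lemma dsc_nt_lift (n : int) (A : vi_mod p k) (f : forall i, vi_nat (N i n) A) :
  exists F : vi_nat (dsc n) A, forall i V x, F V (dsc_in i n V x) = f i V x.
Proof. by exists (ds_lift f) => i V x; exact: (ds_liftE f). Qed.

Section Lift.
Variables (Y : cplx p k) (f : forall i, chain_map (N i) Y).
Lemma dsc_lift_ex :
  {F : chain_map dsc Y | forall i, ceq (cm_comp F (dsc_in i)) (f i)}.
Proof.
pose F (n : int) : vi_nat (dsc n) (Y n) := ds_lift (fun i => f i n).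
have E (n : int) i V x : F n V (dsc_in i n V x) = f i n V x by exact: ds_liftE.
have C (n : int) V x : F (n - 1) V (cx_d dsc n V x) = cx_d Y n V (F n V x).
  apply: (dsc_ext (f := F (n - 1) V \o cx_d dsc n V) (g := cx_d Y n V \o F n V)) => i y.
  by rewrite [LHS]/= [RHS]/= dsc_dE !E cm_comm.
by exists (mkc C) => i n V x; exact: E.
Qed.
Definition dsc_lift := sval dsc_lift_ex.
Lemma dsc_liftE i (n : int) V x : dsc_lift n V (dsc_in i n V x) = f i n V x.
Proof. exact: (svalP dsc_lift_ex). Qed.
End Lift.

Lemma dsc_null Y (u : chain_map dsc Y) :
  (forall i, nullh (cm_comp u (dsc_in i))) -> nullh u.
Proof.
move=> /dchoice[h H].
have /dchoice[g Hg] : forall n : int, exists g : vi_nat (dsc (n - 1)) (Y n),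
   forall i V x, g V (dsc_in i (n - 1) V x) = h i n V x.
  by move=> n; apply: (dsc_nt_lift (n := n - 1) (fun i => h i n)).
exists g => n V x.
apply: (dsc_ext (f := u (n - 1) V)
  (g := (cx_d Y n V \o g n V) \+ (g (n - 1) V \o cx_d dsc (n - 1) V))) => i y.
by rewrite [RHS]/= dsc_dE !Hg -H.
Qed.

Lemma kp_dsc D : (forall i, kp D (N i)) -> kp D dsc.
Proof. by move=> H A a u; apply: dsc_null => i; apply: H. Qed.

Definition dsc_delta i j : chain_map (N i) (N j) :=
  match i =P j with
  | ReflectT e => eq_rect i (fun j => chain_map (N i) (N j)) (cm_id (N i)) j e
  | _ => cm_zero (N i) (N j)
  end.
Lemma dsc_delta_id i : dsc_delta i i = cm_id (N i).
Proof. by rewrite /dsc_delta; case: eqP => // e; rewrite eq_axiomK. Qed.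
Lemma dsc_delta_ne i j : i != j -> dsc_delta i j = cm_zero (N i) (N j).
Proof. by rewrite /dsc_delta; case: eqP. Qed.

Definition dsc_proj j : chain_map dsc (N j) := dsc_lift (fun i => dsc_delta i j).
Lemma dsc_proj_in i (n : int) V x : dsc_proj i n V (dsc_in i n V x) = x.
Proof. by rewrite /dsc_proj dsc_liftE dsc_delta_id. Qed.
Lemma dsc_proj_ne i j (n : int) V x : i != j -> dsc_proj j n V (dsc_in i n V x) = 0.
Proof. by move=> ij; rewrite /dsc_proj dsc_liftE dsc_delta_ne. Qed.

(** The finite support is stated for every larger duplicate-free list, so that several elements can
    be expanded along a common one. *)
Lemma dsc_supp (n : int) V (x : dsc n V) : exists s : seq I, forall s',
  uniq s' -> {subset s <= s'} -> x = \sum_(i <- s') dsc_in i n V (dsc_proj i n V x).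
Proof.
elim/dsc_ind: x => [i x|x y [s Hs] [s1 Hs1]|].
- exists [:: i] => s' us' sub; rewrite (bigD1_seq i) ?sub ?mem_head //=.
  rewrite dsc_proj_in big1 ?addr0 // => j ji.
  by rewrite dsc_proj_ne 1?eq_sym // linear0.
- exists (s ++ s1) => s' us' sub.
  have t1 : {subset s <= s'} by move=> i si; apply: sub; rewrite mem_cat si.
  have t2 : {subset s1 <= s'} by move=> i si; apply: sub; rewrite mem_cat si orbT.
  rewrite [LHS](congr2 +%R (Hs s' us' t1) (Hs1 s' us' t2)) -big_split /=.
  by apply: eq_bigr => i _; rewrite !linearD.
- exists [::] => s' _ _; rewrite big1 // => i _.
  by rewrite !linear0.
Qed.

End DirectSum.

Section CsumD.
Variables (p : nat) (k : fieldType).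
Implicit Types (X Y : cplx p k).
Definition csum (I : eqType) X Y (s : seq I) (h : I -> chain_map X Y) :=
  foldr (fun i u => cm_add (h i) u) (cm_zero X Y) s.
Lemma csumE (I : eqType) X Y (s : seq I) (h : I -> chain_map X Y) (n : int) V x :
  csum s h n V x = \sum_(i <- s) h i n V x.
Proof. by elim: s => [|i s IH] /=; rewrite ?big_nil // big_cons IH. Qed.
Lemma dmap_csum (I : eqType) X Y (s : seq I) (h : I -> chain_map X Y) :
  dhom_eq (dmap (csum s h)) (dsum s (fun i => dmap (h i))).
Proof. by elim: s => [|i s IH] //=; rewrite dmap_add IH. Qed.
End CsumD.

Section Telescope.
Variables (p : nat) (k : fieldType).
Variables (B : nat -> cplx p k) (sg : forall e, chain_map (B e) (B e.+1)).

Definition tsh : chain_map (dsc B) (dsc B) :=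
  dsc_lift (fun e => cm_comp (dsc_in B e.+1) (sg e)).
Definition tone : chain_map (dsc B) (dsc B) := cm_sub (cm_id _) tsh.

Lemma tshE e (n : int) V x :
  tsh n V (dsc_in B e n V x) = dsc_in B e.+1 n V (sg e n V x).
Proof. by rewrite /tsh dsc_liftE. Qed.
Lemma toneE (n : int) V x : tone n V x = x - tsh n V x.
Proof. by []. Qed.

Fixpoint tpow c : chain_map (dsc B) (dsc B) :=
  if c is c'.+1 then cm_comp (tpow c') tsh else cm_id _.
Fixpoint tgeo c : chain_map (dsc B) (dsc B) :=
  if c is c'.+1 then cm_add (cm_id _) (cm_comp (tgeo c') tsh) else cm_zero _ _.

Lemma tgeoE c (n : int) V x : tone n V (tgeo c n V x) = x - tpow c n V x.
Proof.
elim: c x => [|c IH] x; first by rewrite /= linear0 !subrr.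
rewrite [tgeo _ _ _ _]/= linearD IH toneE [tpow _ _ _ _]/=.
by zabel.
Qed.

Lemma tpow_in c e (n : int) V x : exists y, tpow c n V (dsc_in B e n V x) =
  dsc_in B (e + c)%N n V y.
Proof.
elim: c e x => [|c IH] e x; first by rewrite addn0; exists x.
rewrite [tpow _]/= [cm_comp _ _ _ _ _]/= tshE.
by have := IH _ (sg e n V x); rewrite addSnnS.
Qed.

(** On the summand e this is the geometric sum 1 + t + ... + t^(M-e-1) in the shift operator t. It
    pushes an element into the summand M modulo the image of 1 - t, and it inverts 1 - t on elements
    supported below M. *)
Definition ttrunc M : chain_map (dsc B) (dsc B) :=
  dsc_lift (fun e => cm_comp (tgeo (M - e)) (dsc_in B e)).

Lemma ttruncP (n : int) V (x : dsc B n V) : exists M0, forall M, (M0 <= M)%N ->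
  (exists y, x - tone n V (ttrunc M n V x) = dsc_in B M n V y) /\
  ttrunc M n V (tone n V x) = x.
Proof.
elim/dsc_ind: x => [e x|x y [M1 H1] [M2 H2]|].
- exists e.+1 => M eM.
  have E f z : ttrunc M n V (dsc_in B f n V z) = tgeo (M - f) n V (dsc_in B f n V z).
    by rewrite /ttrunc dsc_liftE.
  split.
    rewrite E tgeoE opprB addrC subrK.
    by have := tpow_in (M - e) x; rewrite subnKC // ltnW.
  rewrite toneE linearB tshE !E -tshE.
  have -> : (M - e = (M - e.+1).+1)%N by rewrite -subSn.
  by rewrite /= addrK.
- exists (maxn M1 M2) => M; rewrite geq_max => /andP[/H1[[x1 e1] E1] /H2[[x2 e2] E2]].
  split; last by rewrite (linearD (tone n V)) (linearD (ttrunc M n V)) E1 E2.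
  exists (x1 + x2); rewrite (linearD (ttrunc M n V)) (linearD (tone n V)).
  by rewrite (linearD (dsc_in B M n V)) -e1 -e2; zabel.
- exists 0%N => M _; split; last by rewrite !linear0.
  by exists 0; rewrite !linear0 ?subrr ?addr0.
Qed.

Variables (Y : cplx p k) (de : forall e, chain_map (B e) Y).
Hypothesis deS : forall e, ceq (cm_comp (de e.+1) (sg e)) (de e).

Lemma tel_sum_one (n : int) V x : dsc_lift de n V (tone n V x) = 0.
Proof.
have -> : dsc_lift de n V (tone n V x) = (\0 : {linear _ -> _}) x; last by [].
apply: (dsc_ext (f := dsc_lift de n V \o tone n V) (g := \0)) => e y.
rewrite [LHS]/= -[_ - _]/(tone n V _) toneE linearB tshE !dsc_liftE.
by rewrite -[X in _ - X]/(cm_comp _ _ n V y) deS subrr.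
Qed.

Lemma tel_map_comm (n : int) V (x : cone tone n V) :
  nt_comp (dsc_lift de (n - 1)) (nt_snd _ _) V (cx_d (cone tone) n V x) =
  cx_d Y n V (nt_comp (dsc_lift de n) (nt_snd _ _) V x).
Proof.
change (dsc_lift de (n - 1) V (nt_snd _ _ V (cx_d (cone tone) n V x)) =
  cx_d Y n V (dsc_lift de n V (nt_snd _ _ V x))).
rewrite !nt_sndE cone_dE -[X in dsc_lift _ _ _ X]/(tone _ V x.1 + cx_d (dsc B) n V x.2).
by rewrite linearD tel_sum_one add0r cm_comm.
Qed.
Definition tel_map : chain_map (cone tone) Y := mkc tel_map_comm.
Lemma tel_mapE (n : int) V x : tel_map n V x = dsc_lift de n V x.2.
Proof. by rewrite /= add0r. Qed.

(** The telescope computes the colimit of the B e: by [ttruncP] every cycle is homologous to one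
    concentrated in a single summand M beyond E, where [de M] is a quasi-isomorphism at V. *)
Lemma tel_qia V E : (forall e, (E <= e)%N -> qia (de e) V) -> qia tel_map V.
Proof.
move=> q n; split; last first.
  move=> w dw; have [z dz bz] := (q E (leqnn E) n).2 w dw.
  exists (0, dsc_in B E (n - 1) V z).
    by rewrite /cycle cone_dE2 !linear0 ?oppr0 add0r dsc_dE dz linear0.
  by rewrite tel_mapE dsc_liftE.
case=> a b /cone_cycleP[da ab].
rewrite tel_mapE [X in dsc_lift _ _ _ X]/= => bb.
have [M1 H1] := ttruncP a; have [M2 H2] := ttruncP b.
pose M := maxn E (maxn M1 M2).
have [_ Ta] := H1 M (leq_trans (leq_maxl _ _) (leq_maxr _ _)).
have [[c ec] _] := H2 M (leq_trans (leq_maxr _ _) (leq_maxr _ _)).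
have eab : (a, b) = (0, dsc_in B M (n - 1) V c) + cx_d (cone tone) n V (ttrunc M (n - 1) V b, 0).
  rewrite cone_dE2 -ec linear0 addr0 -cm_comm.
  have -> : cx_d (dsc B) (n - 1) V b = - tone (n - 1 - 1) V a.
    by apply: (addrI (tone (n - 1 - 1) V a)); rewrite ab subrr.
  rewrite linearN Ta opprK.
  by congr (_, _); rewrite [RHS]/= ?add0r ?subrK.
have dc : cycle c.
  have : cycle ((0, dsc_in B M (n - 1) V c) : cone tone (n - 1) V).
    rewrite -[X in cycle X](addrK (cx_d (cone tone) n V (ttrunc M (n - 1) V b, 0))) -eab.
    apply: cycleB; last exact: cycle_d.
    by rewrite /cycle cone_dE2 da ab oppr0.
  move=> /cone_cycleP[_]; rewrite !linear0 add0r dsc_dE => e.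
  have := congr1 (dsc_proj B M (n - 1 - 1) V) e; rewrite dsc_proj_in linear0.
  exact: id.
have [c' ec'] : boundary c.
  apply: (q M (leq_maxl _ _) n).1 => //.
  by rewrite -(dsc_liftE de) -ec linearB tel_sum_one subr0.
rewrite eab; apply: boundaryD; last exact: boundary_d.
exists (0, dsc_in B M n V c'); rewrite cone_dE2 dsc_dE ec'.
by rewrite !linear0 ?oppr0 add0r.
Qed.

End Telescope.

(** Zero maps to a contractible complex are compatible with every system and are eventually
    quasi-isomorphisms at V, so the telescope is acyclic at V. *)
Lemma tel_acy p k (B : nat -> cplx p k) (sg : forall e, chain_map (B e) (B e.+1)) V E :
  (forall e, (E <= e)%N -> acy (B e) V) -> qia (tone sg) V.
Proof.
move=> a; apply: qia_cone.
pose Z := cone (cm_id (B 0%N)).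
have aZ : acy Z V by apply/null_acy/cone_id_null.
apply: (qia_acyl (f := tel_map (de := fun e => cm_zero (B e) Z) (fun e n V x => erefl)) _ aZ).
by apply: (@tel_qia _ _ _ _ _ _ _ V E) => e Ee; exact: (acy_qia _ (a e Ee) aZ).
Qed.

(** * Induction from a single level *)

Section ConeLevel.
Variables (p : nat) (k : fieldType).
Local Notation VS := (vectType 'F_p).
Implicit Types (V : VS) (X Y Z : cplx p k).

Lemma qia_cone_in X Y (f : chain_map X Y) V : acy X V -> qia (cone_in f) V.
Proof.
move=> a n; split=> [z dz [[u v]]|[x y] /cone_cycleP[dx e]].
  rewrite cone_dE2 => e; have /= e1 := congr1 fst e; have /= <- := congr1 snd e.
  have du : cycle u by apply/eqP; rewrite -oppr_eq0; apply/eqP.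
  have [u' <-] := a n u du.
  by exists (f n V u' + v); rewrite linearD cm_comm.
have [x' ex'] := a _ x dx.
exists (y + f (n - 1) V x').
  by rewrite /cycle linearD -cm_comm ex' -[RHS]e; zabel.
exists (x', 0); rewrite cone_dE2 linear0 addr0 ex'.
rewrite -[LHS](subr0 _); congr (_, _); rewrite [RHS]/= ?sub0r ?subr0 //.
by rewrite /=; zabel.
Qed.

Lemma qia_cone_out X Y (f : chain_map X Y) V : acy Y V -> qia (cone_out f) V.
Proof.
move=> a n; split=> [[x y] /cone_cycleP[dx e] [x' ex']|w dw].
  have [|v ev] := a n (y + f (n - 1) V (- x')).
    rewrite /cycle linearD -cm_comm linearN /= -[RHS]e; rewrite /= addr0 in ex'.
    by rewrite ex'; zabel.
  exists (x', v); rewrite cone_dE2 ev; rewrite /= addr0 in ex'.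
  by congr (_, _) => //; rewrite linearN /=; zabel.
have dw' : cx_d X (n - 1 - 1) V w = 0.
  by apply/eqP; rewrite -oppr_eq0; apply/eqP.
have [v ev] := a _ _ (cycle_map f dw').
exists (w, - v).
  by apply/cone_cycleP; rewrite linearN ev subrr.
by rewrite cone_outE subrr; apply: boundary0.
Qed.

Lemma acy_cone_of X Y (f : chain_map X Y) V : acy X V -> acy Y V -> acy (cone f) V.
Proof. by move=> aX aY; apply/acy_cone/acy_qia. Qed.

Lemma acy_iso X U V : \dim {:U} = \dim {:V} -> acy X U -> acy X V.
Proof.
move=> /iso_of_dim[f [g [gf fg]]] a n z dz.
have [|y ey] := a n (act (X (n - 1)) g z).
  by rewrite /cycle nt_act dz linear0.
by exists (act (X n) f y); rewrite nt_act ey -actM fg act1.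
Qed.

(* [cone (X -> cone c)] and [cone (G -> cone f)] have the same underlying
   graded object. *)
Definition cone_swap X G B (f : chain_map X B) (c : chain_map G B) :
  chain_map (cone (cm_comp (cone_in c) f)) (cone (cm_comp (cone_in f) c)).
Proof.
refine (@mkc p k (cone (cm_comp (cone_in c) f)) (cone (cm_comp (cone_in f) c))
  (fun n : int => nt_pair
    (nt_comp (nt_fst (G (n - 1)) (B n)) (nt_snd (X (n - 1)) (cone c n)))
    (nt_pair (nt_fst (X (n - 1)) (cone c n))
      (nt_comp (nt_snd (G (n - 1)) (B n)) (nt_snd (X (n - 1)) (cone c n))))) _).
move=> n V [x [g b]].
rewrite /= /cone_d_fun /= !(add0r, addr0).
by congr (_, (_, _)); rewrite /=; zabel.
Defined.
Lemma cone_swapE X G B (f : chain_map X B) (c : chain_map G B) n V x g b :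
  cone_swap f c n V (x, (g, b)) = (g, (x, b)).
Proof. by rewrite /= !(addr0, add0r). Qed.

Definition cone_map2 X Y X' Y' (f : chain_map X Y) (f' : chain_map X' Y')
  (a : chain_map X X') (b : chain_map Y Y')
  (e : ceq (cm_comp b f) (cm_comp f' a)) : chain_map (cone f) (cone f').
Proof.
refine (@mkc p k (cone f) (cone f') (fun n : int =>
  nt_pair (nt_comp (a (n - 1)) (nt_fst _ _)) (nt_comp (b n) (nt_snd _ _))) _).
move=> n V [x y]; rewrite !cone_dE2 /= !(add0r, addr0) /cone_d_fun /=.
rewrite linearN linearD !cm_comm; congr (_, _ + _).
exact: e.
Defined.
Lemma cone_map2E X Y X' Y' (f : chain_map X Y) (f' : chain_map X' Y')
  (a : chain_map X X') (b : chain_map Y Y')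
  (e : ceq (cm_comp b f) (cm_comp f' a)) n V x y :
  cone_map2 e n V (x, y) = (a (n - 1) V x, b n V y).
Proof. by rewrite /= !(addr0, add0r). Qed.

End ConeLevel.

(** * Averaging over the general linear group *)

Section Averaging.
Variables (p : nat) (k : fieldType).
Local Notation VS := (vectType 'F_p).
Hypothesis char0 : [pchar k]%R =i pred0.
Implicit Types (V : VS) (X : cplx p k).

Lemma iinvM (U : VS) (f g : vinj U U) :
  iinv (icomp f g) = icomp (iinv g) (iinv f) :> vinj U U.
Proof.
apply: (icompI (g := icomp f g)); rewrite icompfV icompA -(icompA f) icompfV.
by rewrite icompf1 icompfV.
Qed.

Lemma order_neq0 V : (size (vinjs V V))%:R != 0 :> k.
Proof.
have /pcharf0P -> := char0.
by have := mem_vinjs (iid V); case: (vinjs V V).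
Qed.

(* Maschke's averaging trick. *)
Definition average V (A B : vi_mod p k) (s : {linear A V -> B V}) (x : A V) : B V :=
  (size (vinjs V V))%:R^-1 *: \sum_(g <- vinjs V V) act B (iinv g) (s (act A g x)).
Lemma average_linear V (A B : vi_mod p k) (s : {linear A V -> B V}) : linear (average s).
Proof.
move=> a x y; rewrite /average scalerA [a * _]mulrC -scalerA -scalerDr.
congr (_ *: _); rewrite scaler_sumr -big_split; apply: eq_bigr => g _.
by rewrite /= !linearP.
Qed.
Lemma average_equiv V (A B : vi_mod p k) (s : {linear A V -> B V}) (g : vinj V V) x :
  average s (act A g x) = act B g (average s x).
Proof.
rewrite /average linearZ /=; congr (_ *: _); rewrite linear_sum.
rewrite -[RHS](sum_vinjs_comp g); apply: eq_bigr => f _.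
by rewrite iinvM -!actM icompA icompfV icomp1f.
Qed.
Lemma average_fix V (A B : vi_mod p k) (s : {linear A V -> B V}) x y :
  (forall g : vinj V V, act B (iinv g) (s (act A g x)) = y) -> average s x = y.
Proof.
move=> e; rewrite /average (eq_bigr (fun=> y)) // big_const_seq count_predT.
by rewrite iter_addr_0 -scaler_nat scalerA mulVf ?order_neq0 // scale1r.
Qed.

Lemma equivariant_ginv V (A B : vi_mod p k) (d : {linear A V -> B V}) :
  (forall (g : vinj V V) x, d (act A g x) = act B g (d x)) ->
  exists s : {linear B V -> A V}, (forall x, d (s (d x)) = d x) /\
    (forall (g : vinj V V) x, s (act B g x) = act A g (s x)).
Proof.
move=> dg; have [s Hs] := generalized_inverse d.
exists (mkl (average_linear s)); split=> [x|g x]; last exact: average_equiv.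
rewrite -[X in d X]/(average s (d x)) /average linearZ /= linear_sum.
rewrite (eq_bigr (fun=> d x)).
  rewrite big_const_seq count_predT iter_addr_0 -scaler_nat scalerA.
  by rewrite mulVf ?order_neq0 // scale1r.
by move=> g _; rewrite dg -[act B g _]dg Hs dg -actM icompVf act1.
Qed.

(** With equivariant generalized inverses s of the differentials, the contraction is h = s (1 - s
    d): the element x - s d x is a cycle, hence a boundary, and s is a section of d over the
    boundaries. *)
Lemma equivariant_contraction X V : acy X V ->
  exists h : forall n : int, {linear X (n - 1) V -> X n V},
    (forall (n : int) x, cx_d X n V (h n x) + h (n - 1) (cx_d X (n - 1) V x) = x) /\
    (forall (n : int) (g : vinj V V) x, h n (act _ g x) = act _ g (h n x)).
Proof.
move=> a.
have /dchoice[s Hs] : forall n : int, exists s : {linear X (n - 1) V -> X n V},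
    (forall x, cx_d X n V (s (cx_d X n V x)) = cx_d X n V x) /\
    (forall (g : vinj V V) x, s (act _ g x) = act _ g (s x)).
  by move=> n; apply: equivariant_ginv => g x; rewrite nt_act.
have hl n : linear (fun x : X (n - 1) V => s n (x - s (n - 1) (cx_d X (n - 1) V x))).
  move=> c x y; rewrite -linearP; congr (s n _); rewrite scalerBr !linearP /= ?scalerN.
  by zabel.
exists (fun n => mkl (hl n)); split=> [n x|n g x] /=; last first.
  by rewrite nt_act (Hs _).2 -linearB (Hs _).2.
rewrite cx_dd linear0 subr0.
have [|y ey] := a n (x - s (n - 1) (cx_d X (n - 1) V x)).
  by rewrite /cycle linearB /= (Hs (n - 1)).1 subrr.
by rewrite -{1}ey (Hs n).1 ey subrK.
Qed.

End Averaging.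

Section Induction.
Variables (p : nat) (k : fieldType) (b : bool) (j : nat).
Local Notation VS := (vectType 'F_p).
Local Notation Vj := 'rV['F_p]_j.

Section InductionModule.
Variable M : vi_mod p k.

(* For [b = true] this is the functor [V |-> k[Inj(F_p^j, V)] (x)_GL_j M(F_p^j)],
   and the plain tensor product over [k] for [b = false]. *)
Definition im_resp V (W : lmodType k) (phi : vinj Vj V * M Vj -> W) : Prop :=
  (forall f, linear (fun z => phi (f, z))) /\
  (b -> forall f g z, phi (icomp f g, z) = phi (f, act M g z)).

Definition im_gfun : gfun p k.
Proof.
refine (@GFun p k (fun V => (vinj Vj V * M Vj)%type)
  (fun U V f s => (icomp f s.1, s.2)) im_resp _ _ _ _).
- by move=> U [f z] /=; rewrite icomp1f.
- by move=> U V W g f [h z] /=; rewrite icompA.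
- move=> U V f W phi [H1 H2]; split=> [g|bt g h z] /=; first exact: H1.
  by rewrite icompA; apply: H2.
- move=> V; split=> [f a x y|bt f g z]; apply: pres_sep => W phi H.
    by rewrite !linearP /= !plift_gen H.1.
  by rewrite !plift_gen H.2.
Defined.

Definition im : vi_mod p k := pmod im_gfun.

Lemma ii_linear V (f : vinj Vj V) :
  linear (fun z : M Vj => @pg p k im_gfun V (f, z) : im V).
Proof. exact: (gen_resp im_gfun V).1. Qed.
Lemma ii_ex V (f : vinj Vj V) : {F : {linear M Vj -> im V} |
  forall z, F z = @pg p k im_gfun V (f, z)}.
Proof. by exists (mkl (ii_linear f)). Qed.
Definition ii V (f : vinj Vj V) := sval (ii_ex f).
Lemma iiE V (f : vinj Vj V) z : ii f z = @pg p k im_gfun V (f, z).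
Proof. exact: (svalP (ii_ex f)). Qed.

Lemma act_ii U V (g : vinj U V) (f : vinj Vj U) z :
  act im g (ii f z) = ii (icomp g f) z.
Proof. by rewrite !iiE (act_pg (F := im_gfun)). Qed.
Lemma ii_act V (f : vinj Vj V) (g : vinj Vj Vj) z : b ->
  ii (icomp f g) z = ii f (act M g z).
Proof. by move=> bt; rewrite !iiE; apply: (gen_resp im_gfun V).2. Qed.

Lemma im_ext V (W : lmodType k) (f g : {linear im V -> W}) :
  (forall h z, f (ii h z) = g (ii h z)) -> f =1 g.
Proof. by move=> H; apply: (@pmod_lin_ext p k im_gfun) => -[i x]; rewrite -iiE. Qed.

Lemma im_ind V (P : im V -> Prop) :
  (forall f z, P (ii f z)) -> (forall x y, P x -> P y -> P (x + y)) ->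
  P 0 -> forall x, P x.
Proof.
move=> Pin PD P0; apply: pres_ind => // c [f z].
by have := Pin f (c *: z); rewrite linearZ /= iiE.
Qed.

Lemma im_lin_ex V (W : lmodType k) (phi : vinj Vj V -> M Vj -> W) :
  (forall f, linear (phi f)) ->
  (b -> forall f g z, phi (icomp f g) z = phi f (act M g z)) ->
  exists F : {linear im V -> W}, forall f z, F (ii f z) = phi f z.
Proof.
move=> H1 H2.
have r : @gr p k im_gfun V W (fun s => phi s.1 s.2) by split.
by exists (plift r) => f z; rewrite iiE plift_gen.
Qed.

Section Lift.
Variables (A : vi_mod p k) (phi : {linear M Vj -> A Vj}).
Hypothesis phi_eq : b -> forall (g : vinj Vj Vj) z, phi (act M g z) = act A g (phi z).
Lemma im_lift_ex : {F : vi_nat im A | forall V f z, F V (ii f z) = act A f (phi z)}.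
Proof.
pose ph V (s : im_gfun V) : A V := act A s.1 (phi s.2).
have r V : gr (@ph V).
  split=> [f a x y|bt f g z]; first by rewrite /ph /= !linearP.
  by rewrite /ph /= phi_eq // actM.
have n U V (g : vinj U V) s : ph V (gm g s) = act A g (ph U s).
  by rewrite /ph /= actM.
by exists (pmod_lift r n) => V f z; rewrite iiE pmod_liftE.
Qed.
Definition im_lift := sval im_lift_ex.
Lemma im_liftE V (f : vinj Vj V) z : im_lift V (ii f z) = act A f (phi z).
Proof. exact: (svalP im_lift_ex). Qed.
End Lift.

Lemma im_nt_ext (A : vi_mod p k) (F G : vi_nat im A) :
  (forall z, F Vj (ii (iid Vj) z) = G Vj (ii (iid Vj) z)) -> forall V, F V =1 G V.
Proof.
move=> H V; apply: im_ext => f z.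
by rewrite -(icompf1 f) -!act_ii !nt_act H.
Qed.

End InductionModule.

Section InductionComplex.
Variable Z : cplx p k.

Lemma ind_d_eq (n : int) : b -> forall (g : vinj Vj Vj) z,
  (ii (Z (n - 1)) (iid Vj) \o cx_d Z n Vj) (act (Z n) g z) =
  act _ g ((ii (Z (n - 1)) (iid Vj) \o cx_d Z n Vj) z).
Proof.
by move=> bt g z; rewrite /= nt_act act_ii -ii_act // icompf1 icomp1f.
Qed.
Definition ind : cplx p k.
Proof.
refine (@Cplx p k (fun n : int => im (Z n)) (fun n : int => im_lift (@ind_d_eq n)) _).
move=> n V x.
pose F := nt_comp (im_lift (@ind_d_eq (n - 1))) (im_lift (@ind_d_eq n)).
rewrite -[LHS]/(F V x) (im_nt_ext (F := F) (G := nt_zero _ _)) // => z.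
change (im_lift (@ind_d_eq (n - 1)) Vj (im_lift (@ind_d_eq n) Vj (ii (Z n) (iid Vj) z)) = 0).
by rewrite im_liftE act1 [X in im_lift _ _ X]/= im_liftE act1 /= cx_dd linear0.
Defined.

Definition igen (n : int) V (f : vinj Vj V) : {linear Z n Vj -> ind n V} :=
  ii (Z n) f.
Lemma ind_dE (n : int) V f z : cx_d ind n V (igen n f z) = igen (n - 1) f (cx_d Z n Vj z).
Proof. by rewrite [LHS]im_liftE /= act_ii icompf1. Qed.
Lemma act_igen (n : int) U V (g : vinj U V) f z :
  act (ind n) g (igen n f z) = igen n (icomp g f) z.
Proof. exact: act_ii. Qed.
Lemma igen_act (n : int) V f (g : vinj Vj Vj) z : b ->
  igen n (V := V) (icomp f g) z = igen n f (act (Z n) g z).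
Proof. exact: ii_act. Qed.
Lemma ind_ext (n : int) V (W : lmodType k) (f g : {linear ind n V -> W}) :
  (forall h z, f (igen n h z) = g (igen n h z)) -> f =1 g.
Proof. exact: im_ext. Qed.
Lemma ind_ind (n : int) V (P : ind n V -> Prop) :
  (forall f z, P (igen n f z)) -> (forall x y, P x -> P y -> P (x + y)) ->
  P 0 -> forall x, P x.
Proof. exact: im_ind. Qed.

Lemma ind_small V : (\dim {:V} < j)%N -> forall (n : int) (x : ind n V), x = 0.
Proof.
move=> lt n; apply: ind_ind => [f z|x y -> ->|//]; last by rewrite addr0.
by have := vinj_dim f; rewrite dim_rV leqNgt lt.
Qed.
Lemma ind_small_acy V : (\dim {:V} < j)%N -> acy ind V.
Proof.
by move=> lt n z _; rewrite (ind_small lt z); apply: boundary0.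
Qed.

Lemma ind_nt_lift (n : int) (A : vi_mod p k) (phi : {linear Z n Vj -> A Vj}) :
  (b -> forall (g : vinj Vj Vj) z, phi (act _ g z) = act A g (phi z)) ->
  exists F : vi_nat (ind n) A, forall V f z, F V (igen n f z) = act A f (phi z).
Proof. by move=> H; exists (im_lift H) => V f z; exact: im_liftE. Qed.

Lemma ind_lin (n : int) V (W : lmodType k) (phi : vinj Vj V -> Z n Vj -> W) :
  (forall f, linear (phi f)) ->
  (b -> forall f g z, phi (icomp f g) z = phi f (act (Z n) g z)) ->
  exists F : {linear ind n V -> W}, forall f z, F (igen n f z) = phi f z.
Proof. exact: im_lin_ex. Qed.

Lemma ind_lift (A : cplx p k) (phi : forall n : int, {linear Z n Vj -> A n Vj}) :
  (b -> forall (n : int) (g : vinj Vj Vj) z, phi n (act _ g z) = act _ g (phi n z)) ->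
  (forall (n : int) z, phi (n - 1) (cx_d Z n Vj z) = cx_d A n Vj (phi n z)) ->
  exists F : chain_map ind A, forall (n : int) V f z,
    F n V (igen n f z) = act (A n) f (phi n z).
Proof.
move=> H1 H2.
have /dchoice[F HF] : forall n : int, exists F : vi_nat (ind n) (A n),
    forall V f z, F V (igen n f z) = act (A n) f (phi n z).
  by move=> n; apply: ind_nt_lift => bt; exact: H1.
have C (n : int) V x : F (n - 1) V (cx_d ind n V x) = cx_d A n V (F n V x).
  apply: (ind_ext (f := F (n - 1) V \o cx_d ind n V) (g := cx_d A n V \o F n V)) => f z.
  by rewrite [LHS]/= [RHS]/= ind_dE !HF H2 nt_act.
by exists (mkc C).
Qed.

Lemma counit_ex : {F : chain_map ind Z | forall (n : int) V f z,
    F n V (igen n f z) = act (Z n) f z}.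
Proof. by apply: cid; apply: (ind_lift (phi := fun n => idfun)). Qed.
Definition counit := sval counit_ex.
Lemma counitE (n : int) V f z : counit n V (igen n f z) = act (Z n) f z.
Proof. exact: (svalP counit_ex). Qed.

Hypothesis char0 : [pchar k]%R =i pred0.

(** A map out of [ind] is determined by its values on the generators with identity injection, so an
    equivariant contraction of A at level j alone induces a null-homotopy at all levels. *)
Lemma ind_kp (D : VS -> Prop) : D Vj -> kp D ind.
Proof.
move=> DV A aA u.
have [h [hd hg]] := equivariant_contraction char0 (aA _ DV).
have /dchoice[H HH] : forall n : int, exists H : vi_nat (ind (n - 1)) (A n),
    forall V f z, H V (igen (n - 1) f z) =
      act (A n) f (h n (u (n - 1) Vj (igen (n - 1) (iid Vj) z))).
  move=> n; apply: (ind_nt_lift (phi := h n \o u (n - 1) Vj \o igen (n - 1) (iid Vj))).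
  move=> bt g z /=; rewrite -igen_act // icomp1f -hg.
  by rewrite -(nt_act (u (n - 1))) act_igen icompf1.
exists H => n V x.
apply: (ind_ext (f := u (n - 1) V)
  (g := (cx_d A n V \o H n V) \+ (H (n - 1) V \o cx_d ind (n - 1) V))) => f z.
rewrite [RHS]/= ind_dE !HH nt_act -linearD -ind_dE cm_comm hd -nt_act act_igen.
by rewrite icompf1.
Qed.

Lemma ind_acy : acy Z Vj -> forall V, acy ind V.
Proof.
move=> aZ V; apply: null_acy.
have [h [hd hg]] := equivariant_contraction char0 aZ.
have /dchoice[H HH] : forall n : int, exists H : vi_nat (ind (n - 1)) (ind n),
    forall V f z, H V (igen (n - 1) f z) = act (ind n) f (igen n (iid Vj) (h n z)).
  move=> n; apply: (ind_nt_lift (phi := igen n (iid Vj) \o h n)).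
  by move=> bt g z /=; rewrite hg -igen_act // act_igen icompf1 icomp1f.
exists H => n W x.
apply: (ind_ext (f := idfun)
  (g := (cx_d ind n W \o H n W) \+ (H (n - 1) W \o cx_d ind (n - 1) W))) => f z.
rewrite [RHS]/= ind_dE !HH !act_igen ind_dE -linearD icompf1 hd.
by [].
Qed.

(** At level j every injection f is an automorphism, and in the coinvariants the generator (f, z)
    equals (id, f z). *)
Lemma counit_qia : b -> qia counit Vj.
Proof.
move=> bt; apply: (@qia_bij p k _ _ counit Vj (fun n => igen n (iid Vj))) => n x.
  rewrite -[LHS]/((igen n (iid Vj) \o counit n Vj) x).
  apply: (ind_ext (f := igen n (iid Vj) \o counit n Vj) (g := idfun)) => f z.
  by rewrite /= counitE -igen_act // icomp1f.
by rewrite counitE act1.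
Qed.

End InductionComplex.

End Induction.

(** * The killing tower and K-projective resolutions *)

Section Tower.
Variables (p : nat) (k : fieldType).
Hypothesis char0 : [pchar k]%R =i pred0.
Local Notation VS := (vectType 'F_p).
Implicit Types (V : VS) (X Y Z G : cplx p k).

(* Coning off [ind true j Z -> Z] makes [Z] acyclic at level [j] and does not
   change the levels below [j]. *)
Definition Lam j Z := cone (counit true j Z).
Definition lam_in j Z : chain_map Z (Lam j Z) := cone_in (counit true j Z).

Lemma Lam_acy_eq j Z V : \dim {:V} = j -> acy (Lam j Z) V.
Proof.
move=> e; apply: (acy_iso (U := 'rV['F_p]_j)); first by rewrite dim_rV.
by apply/acy_cone/counit_qia.
Qed.
Lemma lam_in_qia j Z V : (\dim {:V} < j)%N -> qia (lam_in j Z) V.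
Proof. by move=> lt; apply/qia_cone_in/ind_small_acy. Qed.
Lemma Lam_acy_lt j Z V : (\dim {:V} < j)%N -> acy Z V -> acy (Lam j Z) V.
Proof. by move=> lt; apply: qia_acyr (lam_in_qia Z lt). Qed.

Fixpoint Lt X e := if e is e'.+1 then Lam e' (Lt X e') else X.
Fixpoint lt_in X e : chain_map X (Lt X e) :=
  match e with
  | 0 => cm_id X
  | e'.+1 => cm_comp (lam_in e' (Lt X e')) (lt_in X e')
  end.

Lemma Lt_acy X e V : (\dim {:V} < e)%N -> acy (Lt X e) V.
Proof.
elim: e => // e IH; rewrite ltnS leq_eqVlt => /orP[/eqP|lt].
  exact: Lam_acy_eq.
by apply: Lam_acy_lt => //; apply: IH.
Qed.

(* [Rt X e] is built from the [ind true j] with [j < e]; the telescope of the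
   [Rt X e] is a K-projective resolution of [shift X]. *)
Definition Rt X e := cone (lt_in X e).

(** Exchanging the two cone constructions turns [Rt X e.+1] into the cone of a map from a complex
    induced from level e to [Rt X e]. Hence it is built from complexes projective relative to levels
    at most e, starting from the contractible [Rt X 0]. *)
Lemma Rt_kp X e : kp (fun V => (\dim {:V} < e)%N) (Rt X e).
Proof.
elim: e => [|e IH]; first exact: kp_cone_id.
apply: (kp_retract (i := cone_swap (lt_in X e) (counit true e (Lt X e)))
  (r := cone_swap (counit true e (Lt X e)) (lt_in X e))).
  move=> n V [x [g b]].
  rewrite -[LHS]/(cone_swap _ _ n V (cone_swap (lt_in X e) (counit true e (Lt X e)) n V (x, (g,
      b)))).
  by rewrite !cone_swapE.
apply: kp_cone.
  by apply: ind_kp => //; rewrite dim_rV.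
by apply: kp_sub IH => V /ltnW.
Qed.

Lemma Rt_kproj X e : kproj (Rt X e).
Proof. by apply: kp_sub (Rt_kp (X:=X) (e:=e)). Qed.

Definition rt_map X e : chain_map (Rt X e) (Rt X e.+1).
Proof.
refine (@cone_map2 p k _ _ _ _ (lt_in X e) (lt_in X e.+1) (cm_id X) (lam_in e (Lt X e)) _).
by [].
Defined.

Lemma resolution X : exists G (r : chain_map G X), kproj G /\ quasi_iso r.
Proof.
(* The telescope resolves the shift of the complex it starts from, so X is desuspended
   beforehand. *)
pose Y := ush X.
have deS e : ceq (cm_comp (cone_out (lt_in Y e.+1)) (rt_map Y e)) (cone_out (lt_in Y e)).
  by move=> n V [x y]; rewrite /= !(addr0, add0r).
pose r := tel_map deS.
exists (cone (tone (rt_map Y))), (cm_comp (ush_map X) r); split.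
  by apply: kp_cone; apply: kp_dsc => e; apply: Rt_kproj.
apply/qiaP => V; apply: qia_comp; last exact: ush_map_qia.
(* At V the projection from [Rt Y e] to the shift of Y is a quasi-isomorphism as soon as e exceeds
   the dimension of V. *)
apply: (@tel_qia _ _ _ _ _ _ _ V (\dim {:V}).+1) => e le.
by apply: qia_cone_out; apply: Lt_acy.
Qed.

End Tower.

(** * Free functors on injections and on all linear maps *)

Section Cells.
Variables (p : nat) (k : fieldType) (b : bool) (n : nat) (i : int).
Local Notation VS := (vectType 'F_p).
Local Notation Vn := 'rV['F_p]_n.
Implicit Types (V : VS) (X : cplx p k).

Definition chom V := {f : 'Hom(Vn, V) | b ==> (lker f == 0%VS)}.

Lemma chom_comp_proof U V (g : vinj U V) (f : chom U) :
  b ==> (lker (sval g \o sval f)%VF == 0%VS).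
Proof.
apply/implyP => bt; apply: lker_comp; first exact: (valP g).
exact: (implyP (valP f) bt).
Qed.
Definition chom_comp U V (g : vinj U V) (f : chom U) : chom V :=
  exist (fun f : 'Hom(Vn, V) => is_true (b ==> (lker f == 0%VS))) _
    (chom_comp_proof g f).
Lemma chom_compE U V (g : vinj U V) (f : chom U) x :
  sval (chom_comp g f) x = sval g (sval f x).
Proof. by rewrite /= comp_lfunE. Qed.
Lemma chom_eq V (f g : chom V) : (forall x, sval f x = sval g x) -> f = g.
Proof. by move=> H; apply/val_inj/lfunP. Qed.

(* [k[Inj(F_p^n, -)]] for [b = true] and [k[Hom(F_p^n, -)]] for [b = false],
   placed in degree [i]. *)
Definition cell_gfun (m : int) : gfun p k.
Proof.
refine (@GFun p k (fun V => ((m = i) * chom V)%type)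
  (fun U V f s => (s.1, chom_comp f s.2)) (fun _ _ _ => True) _ _ _ _) => //.
- by move=> U [e f]; congr (_, _); apply: chom_eq => x; rewrite chom_compE iidE.
- move=> U V W g f [e h]; congr (_, _); apply: chom_eq => x /=.
  by rewrite !comp_lfunE.
Defined.

(** Each generator carries a proof that its degree is i, so there are none in other degrees and no
    case distinction on degrees is made. *)
Definition cell : cplx p k.
Proof.
by refine (@Cplx p k (fun m => pmod (cell_gfun m)) (fun m => nt_zero _ _) _).
Defined.

Definition cg (m : int) V (e : m = i) (f : chom V) : cell m V :=
  @pg p k (cell_gfun m) V (e, f).
Lemma act_cg (m : int) U V (g : vinj U V) e f :
  act (cell m) g (cg (m := m) e f) = cg e (chom_comp g f).
Proof. exact: (act_pg (F := cell_gfun m)). Qed.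
Lemma cell_d (m : int) V x : cx_d cell m V x = 0.
Proof. by []. Qed.
Lemma cell_ext (m : int) V (W : lmodType k) (f g : {linear cell m V -> W}) :
  (forall e h, f (cg e h) = g (cg e h)) -> f =1 g.
Proof. by move=> H; apply: (@pmod_lin_ext p k (cell_gfun m)) => -[e h]; apply: H. Qed.
Lemma cell_lin (m : int) V (W : lmodType k) (phi : m = i -> chom V -> W) :
  exists F : {linear cell m V -> W}, forall e f, F (cg e f) = phi e f.
Proof.
exists (plift (resp := fun W _ => True) (phi := fun s => phi s.1 s.2) Logic.I) => e f.
exact: plift_gen.
Qed.
Lemma cell_nt_lift (m : int) (A : vi_mod p k) (phi : forall V, m = i -> chom V -> A V) :
  (forall U V (g : vinj U V) e f, phi V e (chom_comp g f) = act A g (phi U e f)) ->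
  exists F : vi_nat (cell m) A, forall V e f, F V (cg e f) = phi V e f.
Proof.
move=> H.
pose ph V (s : cell_gfun m V) := phi V s.1 s.2.
have r V : gr (@ph V) by [].
have nn U V (g : vinj U V) s : ph V (gm g s) = act A g (ph U s) by apply: H.
by exists (pmod_lift r nn) => V e f; exact: pmod_liftE.
Qed.
Lemma cell_map (X : cplx p k) (phi : forall V, chom V -> X i V) :
  (forall U V (g : vinj U V) f, phi V (chom_comp g f) = act _ g (phi U f)) ->
  (forall V f, cx_d X i V (phi V f) = 0) ->
  exists F : chain_map cell X, forall (m : int) V (e : m = i) f,
    F m V (cg e f) = tr X (esym e) V (phi V f).
Proof.
move=> H d0.
have /dchoice[F HF] : forall m : int, exists F : vi_nat (cell m) (X m),
    forall V e f, F V (cg e f) = tr X (esym e) V (phi V f).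
  move=> m; apply: (cell_nt_lift (phi := fun V e f => tr X (esym e) V (phi V f))).
  by move=> U V g e f; rewrite H nt_act.
have C (m : int) V x : F (m - 1) V (cx_d cell m V x) = cx_d X m V (F m V x).
  apply: (cell_ext (f := F (m - 1) V \o cx_d cell m V) (g := cx_d X m V \o F m V)) => e f.
  rewrite [LHS]/= [RHS]/= linear0 HF (tr_d _ (congr1 (fun l => l - 1) (esym e))).
  by rewrite d0 linear0.
by exists (mkc C).
Qed.
Lemma cell_comap (X : cplx p k) (F : forall m : int, vi_nat (X m) (cell m)) :
  (forall (m : int) V x, F (m - 1) V (cx_d X m V x) = 0) ->
  exists G : chain_map X cell, forall (m : int) V x, G m V x = F m V x.
Proof.
move=> H.
have C (m : int) V x : F (m - 1) V (cx_d X m V x) = cx_d cell m V (F m V x) by rewrite H.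
by exists (mkc C).
Qed.

(* Each [f : F_p^n -> V] factors uniquely through a fixed complement of its
   kernel. *)
Definition ck (K : {vspace Vn}) : VS := subvs_of (K^C)%VS.
Lemma ck_proj_ex K : exists q : 'Hom(Vn, ck K), forall V (f : 'Hom(Vn, V)),
  lker f = K -> forall x, f (vsval (q x)) = f x.
Proof.
have ql : linear (fun x : Vn => vsproj (K^C)%VS (x - projv K x)).
  move=> a x y; rewrite -linearP; congr (vsproj _ _).
  by rewrite scalerBr linearP; zabel.
have [q Hq] := linfun_ex ql.
exists q => V f ek x; rewrite Hq vsprojK ?memv_projC // linearB /=.
have : projv K x \in lker f by rewrite ek memv_proj.
by rewrite memv_ker => /eqP ->; rewrite subr0.
Qed.
Definition ck_proj K : 'Hom(Vn, ck K) := sval (cid (ck_proj_ex K)).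
Lemma ck_projE K V (f : 'Hom(Vn, V)) x : lker f = K -> f (vsval (ck_proj K x)) = f x.
Proof. by rewrite /ck_proj; case: cid => q H /= e; apply: H. Qed.

Lemma ck_hom_ex V (f : 'Hom(Vn, V)) :
  exists h : vinj (ck (lker f)) V, forall x, sval h x = f (vsval x).
Proof.
have hl : linear (fun x : ck (lker f) => f (vsval x)).
  by move=> a x y; rewrite !linearP.
have [h Hh] := linfun_ex hl.
have hi : lker h == 0%VS.
  apply/lker0P => x y; rewrite !Hh => e; apply/val_inj/eqP; rewrite -subr_eq0.
  rewrite -memv0 -(capv_compl (lker f)) memv_cap memv_ker linearB /= e subrr eqxx.
  by rewrite rpredB ?subvsP.
by exists (vinjOf hi).
Qed.
Definition ck_hom V (f : 'Hom(Vn, V)) := sval (cid (ck_hom_ex f)).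
Lemma ck_homE V (f : 'Hom(Vn, V)) x : sval (ck_hom f) x = f (vsval x).
Proof. by rewrite /ck_hom; case: cid => h H /=; apply: H. Qed.
Lemma ck_fact V (f : 'Hom(Vn, V)) x : sval (ck_hom f) (ck_proj (lker f) x) = f x.
Proof. by rewrite ck_homE ck_projE. Qed.

End Cells.

Section CellProps.
Variables (p : nat) (k : fieldType).
Local Notation VS := (vectType 'F_p).
Implicit Types (V : VS) (X Y Z G A : cplx p k).
Local Notation Q := (cell p k false).
Local Notation P := (cell p k true).
Local Notation Vn n := 'rV['F_p]_n.
Local Notation cg := (cg k).

Lemma ck_act_eq (A : vi_mod p k) n V (y : forall K : {vspace Vn n}, A (ck K))
    (K K' : {vspace Vn n}) (eK : K = K') (h : vinj (ck K) V) (h' : vinj (ck K') V)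
    (F : 'Hom(Vn n, V)) :
  (forall x, sval h x = F (vsval x)) -> (forall x, sval h' x = F (vsval x)) ->
  act A h (y K) = act A h' (y K').
Proof.
subst K' => H H'; suff -> : h = h' by [].
by apply: vinj_eq => x; rewrite H H'.
Qed.

Definition ck_chom n (K : {vspace Vn n}) : chom (p:=p) false n (ck K) :=
  exist (fun f : 'Hom(Vn n, ck K) => is_true (false ==> (lker f == 0%VS)))
    (ck_proj K) isT.

Lemma ck_chomE n V (f : chom (p:=p) false n V) :
  chom_comp (ck_hom (sval f)) (ck_chom (lker (sval f))) = f.
Proof. by apply: chom_eq => x; rewrite chom_compE ck_fact. Qed.

Lemma lker_chom_comp b n U V (g : vinj U V) (f : chom (p:=p) b n U) :
  lker (sval (chom_comp g f)) = lker (sval f).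
Proof.
apply/vspaceP => x; apply: (etrans (memv_ker _ _)).
apply: (etrans _ (esym (memv_ker _ _))); rewrite (chom_compE g f x).
by rewrite -{1}(linear0 (sval g)) (inj_eq (vinjI (f := g))).
Qed.

(** Linear maps out of F_p^n split according to their kernel K: each is a fixed projection
    [ck_chom K] followed by a unique injection. A null-homotopy may thus be chosen freely on one
    generator per subspace K and extended by naturality. *)
Lemma cellQ_kproj n i : kproj (Q n i).
Proof.
move=> A /(_ _ Logic.I) aA u.
have ex (m : int) (e : m - 1 = i) (K : {vspace Vn n}) : exists y : A m (ck K),
    cx_d A m _ y = u (m - 1) _ (cg e (ck_chom K)).
  apply: aA; rewrite /cycle -cm_comm cell_d.
  exact: linear0.
pose y m e K := sval (cid (ex m e K)).
have Hy m e K : cx_d A m _ (y m e K) = u (m - 1) _ (cg e (ck_chom K)).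
  exact: (svalP (cid (ex m e K))).
have /dchoice[H HH] : forall m : int, exists H : vi_nat (Q n i (m - 1)) (A m),
   forall V e f, H V (cg e f) = act (A m) (ck_hom (sval f)) (y m e (lker (sval f))).
  move=> m; apply: (cell_nt_lift (phi := fun V e f =>
     act (A m) (ck_hom (sval f)) (y m e (lker (sval f))))) => U V g e f.
  rewrite -actM; apply: (@ck_act_eq (A m) n V (y m e) _ _ _ _ _ (sval (chom_comp g f))).
  - exact: lker_chom_comp.
  - by move=> x; rewrite ck_homE.
  - by move=> x; rewrite icompE ck_homE chom_compE.
exists H => m V x; rewrite cell_d linear0 addr0.
apply: (cell_ext (f := u (m - 1) V) (g := cx_d A m V \o H m V)) => e f.
by rewrite [RHS]/= HH nt_act Hy -nt_act act_cg ck_chomE.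
Qed.

(** Every subspace is the kernel of 1 minus a projection onto it, so the subspaces lie in an
    explicit finite list. This gives the finite generation used for compactness. *)
Lemma lker_ex n (K : {vspace Vn n}) : K \in [seq lker f | f <- homs (Vn n) (Vn n)].
Proof.
apply/mapP; exists (\1 - projv K)%VF; first exact: mem_homs.
apply/vspaceP => x; rewrite memv_ker add_lfunE opp_lfunE id_lfunE subr_eq0.
apply/idP/eqP => [xK|->]; [by rewrite projv_id|exact: memv_proj].
Qed.

(** The cell is generated over VI by one element per subspace, and each image has finite support in
    the direct sum. *)
Lemma cellQ_fin n i (I : eqType) (N : I -> cplx p k) (g : chain_map (Q n i) (dsc N)) :
  exists s : seq I, uniq s /\ forall (m : int) V x,
    g m V x = \sum_(j <- s) dsc_in N j m V (dsc_proj N j m V (g m V x)).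
Proof.
pose z K := g i (ck K) (cg erefl (ck_chom K)).
have /dchoice[s Hs] := fun K => dsc_supp (z K).
pose S := undup (flatten [seq s K | K <- [seq lker f | f <- homs (Vn n) (Vn n)]]).
exists S; split=> [|m V x]; first exact: undup_uniq.
have E (W : VS) (w : Q n i m W) : (csum S (fun j => cm_comp (dsc_in N j) (cm_comp (dsc_proj N j)
    g))) m W w =
   \sum_(j <- S) dsc_in N j m W (dsc_proj N j m W (g m W w)) by rewrite csumE.
rewrite -E.
apply: (cell_ext (f := g m V) (g := csum S (fun j => cm_comp (dsc_in N j) (cm_comp (dsc_proj N j)
    g)) m V)) => e f.
subst i; rewrite -(ck_chomE f) -act_cg !nt_act; congr (act _ _ _).
rewrite E; apply: (Hs (lker (sval f)) S); first exact: undup_uniq.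
move=> j js; rewrite mem_undup; apply/flatten_mapP; exists (lker (sval f)) => //.
exact: lker_ex.
Qed.

(** The retraction sends noninjective maps to 0. It is natural because composing with an injection
    does not change the kernel. *)
Lemma cellP_retract n i : exists (a : chain_map (P n i) (Q n i)) (r : chain_map (Q n i) (P n i)),
  ceq (cm_comp r a) (cm_id (P n i)).
Proof.
pose w V (f : chom (p:=p) true n V) : chom (p:=p) false n V :=
  exist (fun f : 'Hom(Vn n, V) => is_true (false ==> (lker f == 0%VS))) (sval f) isT.
have /dchoice[A HA] : forall m : int, exists F : vi_nat (P n i m) (Q n i m),
    forall V e f, F V (cg e f) = cg e (w V f).
  move=> m; apply: (cell_nt_lift (A := Q n i m) (phi := fun V e f => cg e (w V f))) => U V g e f.
  rewrite act_cg; congr (cg _ _); apply: chom_eq => x.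
  by rewrite /= !comp_lfunE.
pose q V (f : chom (p:=p) false n V) (fi : lker (sval f) == 0%VS) : chom (p:=p) true n V :=
  exist (fun f : 'Hom(Vn n, V) => is_true (true ==> (lker f == 0%VS))) (sval f) fi.
pose phi (m : int) V (e : m = i) (f : chom (p:=p) false n V) : P n i m V :=
  match pselect (lker (sval f) == 0%VS) with left fi => cg e (q V f fi) | right _ => 0 end.
have phiT (m : int) V (e : m = i) f (fi : lker (sval f) == 0%VS) : phi m V e f = cg e (q V f fi).
  rewrite /phi; case: pselect => // fi'; congr (cg _ _); exact: chom_eq.
have phiF (m : int) V (e : m = i) f : ~ (lker (sval f) == 0%VS) -> phi m V e f = 0.
  by rewrite /phi; case: pselect.
have /dchoice[R HR] : forall m : int, exists F : vi_nat (Q n i m) (P n i m),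
    forall V e f, F V (cg e f) = phi m V e f.
  move=> m; apply: (cell_nt_lift (A := P n i m) (phi := phi m)) => U V g e f.
  have [fi|fi] := pselect (lker (sval f) == 0%VS); last first.
    by rewrite !phiF ?lker_chom_comp // linear0.
  have gfi : lker (sval (chom_comp g f)) == 0%VS by rewrite lker_chom_comp.
  rewrite (phiT _ _ _ _ fi) (phiT _ _ _ _ gfi) act_cg; congr (cg _ _).
  by apply: chom_eq => x; rewrite /= !comp_lfunE.
have [a Ha] : exists G : chain_map (P n i) (Q n i), forall (m : int) V x, G m V x = A m V x.
  by apply: cell_comap => m V x; rewrite cell_d linear0.
have [r Hr] : exists G : chain_map (Q n i) (P n i), forall (m : int) V x, G m V x = R m V x.
  by apply: cell_comap => m V x; rewrite cell_d linear0.
exists a, r => m V x.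
apply: (cell_ext (f := r m V \o a m V) (g := idfun)) => e f.
rewrite [LHS]/= Ha Hr HA HR phiT; first exact: (valP f).
by move=> fi; congr (cg _ _); apply: chom_eq.
Qed.

Lemma cellP_kproj n i : kproj (P n i).
Proof.
have [a [r ra]] := cellP_retract n i.
by apply: (kp_retract ra); exact: cellQ_kproj.
Qed.

Lemma yoneda n i X (x : X i (Vn n)) : cx_d X i _ x = 0 ->
  exists f : chain_map (P n i) X, forall (m : int) V (e : m = i) h,
    f m V (cg e h) = tr X (esym e) V (act (X i) (h : vinj (Vn n) V) x).
Proof.
move=> dx; apply: (cell_map (phi := fun V (h : chom true n V) => act (X i) (h : vinj (Vn n) V) x)).
  move=> U V g f; rewrite -actM; congr (act _ _ _).
  exact: vinj_eq.
by move=> V f; rewrite nt_act dx linear0.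
Qed.

Definition cgid n i : P n i i (Vn n) :=
  cg erefl (iid (Vn n) : chom (p:=p) true n (Vn n)).

Lemma yoneda_null n (i : int) X (f : chain_map (P n (i - 1)) X) :
  nullh f -> boundary (f (i - 1) _ (cgid n (i - 1))).
Proof. by move=> nf; apply: nullh_cycle nf (cell_d _). Qed.

End CellProps.

(** * Triangles, coproducts and compact objects *)

Section Derived.
Variables (p : nat) (k : fieldType).
Hypothesis char0 : [pchar k]%R =i pred0.
Local Notation VS := (vectType 'F_p).
Implicit Types (V : VS) (X Y Z G A B M : cplx p k).
Local Notation "u ~~ v" := (dhom_eq u v) (at level 70).
Local Notation "v ** u" := (dcomp v u) (at level 40, left associativity).
Local Notation P := (cell p k true).
Local Notation Vn n := 'rV['F_p]_n.

Lemma d_epi X Y Z (s : chain_map X Y) (u v : dhom Y Z) : quasi_iso s ->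
  u ** dmap s ~~ v ** dmap s -> u ~~ v.
Proof.
move=> hs e; rewrite -[u]dcomp1r -[v]dcomp1r -(dinvK hs) !dcompA.
exact: dhom_eq_dcomp e (dhom_eq_refl _).
Qed.

Lemma dmap_zero X Y (f : chain_map X Y) : ceq f (cm_zero X Y) -> dmap f ~~ dzero X Y.
Proof. exact: dmap_ext. Qed.

Lemma yoneda_null_conv n (m : int) Y (b : chain_map (P n (m - 1)) Y) :
  boundary (b (m - 1) _ (cgid p k n (m - 1))) -> nullh b.
Proof.
move=> [x Hx].
have /dchoice[h Hh] : forall m' : int, exists h : vi_nat (P n (m - 1) (m' - 1)) (Y m'),
   forall V e f, h V (cg k e f) =
     tr Y (addIr (-1) (esym e)) V (act (Y m) (f : vinj (Vn n) V) x).
  move=> m'; apply: (cell_nt_lift (A := Y m') (phi := fun V (e : m' - 1 = m - 1) (f : chom true n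
      V) =>
     tr Y (addIr (-1) (esym e)) V (act (Y m) (f : vinj (Vn n) V) x))).
  move=> U V g e f; rewrite -nt_act -actM; congr (tr _ _ _ (act _ _ _)).
  exact: vinj_eq.
exists h => m' V w; rewrite cell_d linear0 addr0.
apply: (cell_ext (f := b (m' - 1) V) (g := cx_d Y m' V \o h m' V)) => e f.
have em : m' = m by apply: (addIr (-1)).
subst m'; rewrite [RHS]/= Hh tr_id nt_act Hx -nt_act act_cg.
rewrite (eq_irrelevance e erefl); congr (b _ _ (cg _ _ _)).
by apply: chom_eq => v; rewrite chom_compE /= id_lfunE.
Qed.

Lemma dnull_cycle X Y (f : chain_map X Y) n (m : int) (z : X (m - 1) (Vn n)) :
  dmap f ~~ dzero X Y -> cycle z -> boundary (f (m - 1) _ z).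
Proof.
move=> e dz; have [y Hy] := yoneda dz.
have nf : nullh (cm_comp f y).
  by apply: (d_faith0 (@cellP_kproj p k n _)); rewrite dmap_comp e dcomp0l.
have := yoneda_null nf; rewrite /= Hy /= -[X in act _ X]/(iid (Vn n)).
by rewrite act1.
Qed.

Lemma acy_of_rV X V : acy X 'rV['F_p]_(\dim {:V}) -> acy X V.
Proof. by apply: acy_iso; rewrite dim_rV. Qed.

Lemma zero_acy X V : did X ~~ dzero X X -> acy X V.
Proof.
by move=> e; apply: acy_of_rV => m z dz; apply: (dnull_cycle (f := cm_id X)).
Qed.

Lemma d_liftP (G Y : cplx p k) (u : dhom G Y) : kproj G ->
  exists f : chain_map G Y, u ~~ dmap f.
Proof. by move=> HG; apply: d_lift. Qed.

(** The maps of a derived retract are only formal words, so they do not act on cycles directly.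
    Cycles at level n are instead represented by maps out of P(n), which is K-projective, and those
    can be composed with words. *)
Lemma acy_retract X Y n : dretract X Y -> acy Y (Vn n) -> acy X (Vn n).
Proof.
move=> [i [r ri]] aY m z dz; have [y Hy] := yoneda dz.
have [b Hb] := d_liftP (i ** dmap y) (@cellP_kproj p k n (m - 1)).
have nb : nullh b.
  apply: yoneda_null_conv; apply: aY; rewrite /cycle -cm_comm cell_d.
  exact: linear0.
have ny : nullh y.
  apply: (d_faith0 (@cellP_kproj p k n _)).
  by rewrite -[dmap y]dcomp1l -ri -dcompA Hb (dmap_null nb) dcomp0r.
have := yoneda_null ny; rewrite Hy /= -[X in act _ X]/(iid (Vn n)).
by rewrite act1.
Qed.

Lemma diso_sym X Y : diso X Y -> diso Y X.
Proof. by move=> [u [v [vu uv]]]; exists v, u. Qed.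
Lemma diso_retract X Y : diso X Y -> dretract X Y.
Proof. by move=> [u [v [vu uv]]]; exists u, v. Qed.
Lemma diso_refl X : diso X X.
Proof. by exists (did X), (did X); rewrite !dcomp1l. Qed.
Lemma diso_qi X Y (f : chain_map X Y) : quasi_iso f -> diso X Y.
Proof. by move=> h; exists (dmap f), (dinv h); split; [exact: dmapK|exact: dinvK]. Qed.
Lemma dretract_trans Y X Z : dretract X Y -> dretract Y Z -> dretract X Z.
Proof.
move=> [u [v vu]] [u' [v' vu']]; exists (u' ** u), (v ** v').
by rewrite -dcompA (dcompA v') vu' dcomp1l.
Qed.
Lemma dretract_strict X Y (a : chain_map X Y) (r : chain_map Y X) :
  htp (cm_comp r a) (cm_id X) -> dretract X Y.
Proof. by move=> h; exists (dmap a), (dmap r); rewrite -dmap_comp; apply: dmap_htp. Qed.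

Definition shift_map X Y (f : chain_map X Y) : chain_map (shift X) (shift Y).
Proof.
refine (@mkc p k (shift X) (shift Y) (fun n : int => f (n - 1)) _).
by move=> n V x; rewrite /= linearN cm_comm.
Defined.

Lemma cycle_shift X (n : int) V (z : X (n - 1) V) :
  cycle (z : shift X n V) <-> cycle z.
Proof.
split=> [e|e]; last by rewrite /cycle /= e oppr0.
by apply/eqP; rewrite -oppr_eq0; apply/eqP.
Qed.
Lemma boundary_shift X (n : int) V (z : X (n - 1 - 1) V) :
  boundary (z : shift X (n - 1) V) <-> boundary z.
Proof. by split=> -[y <-]; [exists (- y)|exists (- y)]; rewrite /= linearN ?opprK. Qed.
Lemma qia_shift X Y (f : chain_map X Y) V : qia f V -> qia (shift_map f) V.
Proof.
move=> q n; split=> [z /cycle_shift dz /boundary_shift b|w /cycle_shift dw].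
  by apply/boundary_shift/(q _).1.
have [z dz bz] := (q _).2 w dw; exists z; first exact/cycle_shift.
exact/boundary_shift.
Qed.
Lemma acy_shift X V : acy (shift X) V <-> acy X V.
Proof.
split=> a; last by move=> n z /cycle_shift/a; rewrite boundary_shift.
elim/int_pred_ind => n z dz; apply/boundary_shift/a; exact/cycle_shift.
Qed.

Lemma nullh_unshift X Y (f : chain_map X Y) : nullh (shift_map f) -> nullh f.
Proof.
move=> [h H].
have [h' Hh'] := @reindex_pred (fun m => vi_nat (X (m - 1)) (Y m)) h.
exists (fun n => nt_opp (h' n)); elim/int_pred_ind => n V x.
have /= -> := H n V x; rewrite !Hh' !linearN /=; by [].
Qed.

Lemma unshift_map X Y (c : chain_map (shift X) (shift Y)) :
  exists f : chain_map X Y, ceq (shift_map f) c.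
Proof.
have [F HF] := @reindex_pred (fun m => vi_nat (X m) (Y m)) c.
have C (n : int) V x : F (n - 1) V (cx_d X n V x) = cx_d Y n V (F n V x).
  elim/int_pred_ind: n x => n x; rewrite !HF.
  have /= := cm_comm c x; rewrite linearN => /oppr_inj; exact: id.
by exists (mkc C) => n V x /=; rewrite HF.
Qed.

(** Replaces a cone by one of K-projective complexes, so that derived morphisms out of it become
    chain maps. The new map f' matches f only up to homotopy, which enters [th] as its off-diagonal
    component. *)
Lemma cone_resolve A B (f : chain_map A B) : exists A' B' (a : chain_map A' A)
    (b : chain_map B' B) (f' : chain_map A' B') (th : chain_map (cone f') (cone f)),
  [/\ kproj A', kproj B', quasi_iso a, quasi_iso b & quasi_iso th] /\
  [/\ htp (cm_comp b f') (cm_comp f a),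
      ceq (cm_comp th (cone_in f')) (cm_comp (cone_in f) b) &
      ceq (cm_comp (cone_out f) th) (cm_comp (shift_map a) (cone_out f'))].
Proof.
have [A' [a [kA qa]]] := resolution char0 A; have [B' [b [kB qb]]] := resolution char0 B.
have [f' Hf'] := kproj_lift (cm_comp f a) kA qb.
have [h H] := Hf'.
pose T (n : int) : vi_nat (cone f' n) (cone f n) :=
  nt_pair (nt_comp (a (n - 1)) (nt_fst _ _)) (nt_copair (h n) (b n)).
have TE (n : int) V x y : T n V (x, y) = (a (n - 1) V x, h n V x + b n V y).
  by rewrite /= addr0.
have C (n : int) V x : T (n - 1) V (cx_d (cone f') n V x) = cx_d (cone f) n V (T n V x).
  case: x => x y; rewrite cone_dE2 !TE cone_dE2 linearN cm_comm; congr (_, _).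
  have e : b (n - 1) V (f' (n - 1) V x) = cx_d B n V (h n V x) +
      h (n - 1) V (cx_d A' (n - 1) V x) + f (n - 1) V (a (n - 1) V x).
    by rewrite -(H n V x) /= subrK.
  by rewrite linearN !linearD e cm_comm; zabel.
exists A', B', a, b, f', (mkc C); split; last first.
  split=> // n V x; first by rewrite -[LHS]/(T n V (0, x)) TE !linear0 add0r.
  by case: x => x y; rewrite -[LHS]/(cone_out f n V (T n V (x, y))) TE /= !addr0.
split=> //; apply/qiaP => V; move/qiaP: qa => qa; move/qiaP: qb => qb.
apply: (qia_cone_map (a := a) (b := b)) => //.
  by move=> n x y; rewrite -[LHS]/(T n x (0, y)) TE !linear0 add0r.
by move=> m W [x y]; rewrite -[mkc C m W _]/(T m W (x, y)) TE.
Qed.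

(** Exactness of Hom(-, X) at the middle vertex of the triangle of [f]; [triangle_right] is
    exactness at the cone. After [cone_resolve] they reduce to [cone_lift] and [cone_colift]. *)
Lemma triangle_left A B X (f : chain_map A B) (u : dhom B X) :
  u ** dmap f ~~ dzero A X -> exists c : dhom (cone f) X, c ** dmap (cone_in f) ~~ u.
Proof.
move=> e; have [A' [B' [a [b [f' [th [[kA kB qa qb qt] [h1 h2 h3]]]]]]]] := cone_resolve f.
have [v Hv] := d_liftP (u ** dmap b) kB.
have [c Hc] : exists c : chain_map (cone f') X, ceq (cm_comp c (cone_in f')) v.
  apply: cone_lift; apply: (d_faith0 kA).
  rewrite dmap_comp -Hv -dcompA -dmap_comp (dmap_htp h1) dmap_comp dcompA e.
  exact: dcomp0l.
exists (dmap c ** dinv qt); apply: (d_epi qb).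
rewrite -!dcompA -dmap_comp -(dmap_ext h2) dmap_comp (dcompA (dinv qt)) dmapK dcomp1l.
by rewrite -dmap_comp Hv; apply: dmap_ext.
Qed.

Lemma triangle_right A B X (f : chain_map A B) (g : dhom (cone f) X) :
  g ** dmap (cone_in f) ~~ dzero B X ->
  exists a : dhom (shift A) X, a ** dmap (cone_out f) ~~ g.
Proof.
move=> e; have [A' [B' [a [b [f' [th [[kA kB qa qb qt] [h1 h2 h3]]]]]]]] := cone_resolve f.
have [w Hw] := d_liftP (g ** dmap th) (kp_cone (f := f') kA kB).
have [v Hv] : exists v : chain_map (shift A') X, htp (cm_comp v (cone_out f')) w.
  apply: cone_colift; apply: (d_faith0 kB).
  by rewrite dmap_comp -Hw -dcompA -dmap_comp (dmap_ext h2) dmap_comp dcompA e dcomp0l.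
have qs : quasi_iso (shift_map a).
  by apply/qiaP => V; apply: qia_shift; move/qiaP: qa; apply.
exists (dmap v ** dinv qs); apply: (d_epi qt).
rewrite -!dcompA -dmap_comp (dmap_ext h3) dmap_comp (dcompA (dinv qs)) dmapK dcomp1l.
by rewrite -dmap_comp Hw; apply: dmap_htp.
Qed.

Section Dsum.
Variable I : eqType.
Lemma dsum_compl X Y Z (w : dhom Y Z) (s : seq I) (h : I -> dhom X Y) :
  w ** dsum s h ~~ dsum s (fun i => w ** h i).
Proof. by elim: s => [|i s IH] /=; [exact: dcomp0r|rewrite dcompDr IH]. Qed.
Lemma dsum_compr X Y Z (w : dhom X Y) (s : seq I) (h : I -> dhom Y Z) :
  dsum s h ** w ~~ dsum s (fun i => h i ** w).
Proof. by elim: s => [|i s IH] /=; [exact: dcomp0l|rewrite dcompDl IH]. Qed.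
Lemma dsum_ext X Y (s : seq I) (h h' : I -> dhom X Y) :
  (forall i, i \in s -> h i ~~ h' i) -> dsum s h ~~ dsum s h'.
Proof.
elim: s => [|i s IH] H //=; rewrite (H i) ?mem_head // IH // => j js.
by apply: H; rewrite in_cons js orbT.
Qed.
Lemma dsum_add X Y (s : seq I) (h h' : I -> dhom X Y) :
  dsum s (fun i => dadd (h i) (h' i)) ~~ dadd (dsum s h) (dsum s h').
Proof.
elim: s => [|i s IH] /=; first by rewrite dadd0l.
rewrite IH -!daddA; apply: dhom_eq_dadd => //.
by rewrite !daddA; apply: dhom_eq_dadd => //; rewrite daddC.
Qed.
Lemma dsum_zero X Y (s : seq I) (h : I -> dhom X Y) :
  (forall i, i \in s -> h i ~~ dzero X Y) -> dsum s h ~~ dzero X Y.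
Proof.
elim: s => [|i s IH] H //=; rewrite (H i) ?mem_head // IH ?dadd0l // => j js.
by apply: H; rewrite in_cons js orbT.
Qed.
Lemma dsum_single X Y (s : seq I) (h : I -> dhom X Y) j : uniq s -> j \in s ->
  (forall i, i != j -> h i ~~ dzero X Y) -> dsum s h ~~ h j.
Proof.
elim: s => // i s IH /= /andP[nis us]; rewrite in_cons => /orP[/eqP ->|js] H.
  rewrite dsum_zero; first by rewrite daddC dadd0l.
  by move=> l ls; apply: H; apply: contraNneq nis => <-.
by rewrite H ?dadd0l ?IH //; apply: contraNneq nis => ->.
Qed.
Lemma dsum_widen X Y (S T : seq I) (h : I -> dhom X Y) : uniq S -> uniq T ->
  {subset T <= S} ->
  dsum S (fun i => if i \in T then h i else dzero X Y) ~~ dsum T h.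
Proof.
elim: S T => [|i S IH] T uS uT sub /=.
  by case: T uT sub => // t T _ /(_ t (mem_head _ _)).
case/andP: uS => iS uS.
have [iT|iT] := boolP (i \in T); last first.
  rewrite dadd0l IH // => j jT; have := sub j jT; rewrite in_cons.
  by case/orP => // /eqP ji; rewrite -ji jT in iT.
have uT' : uniq (rem i T) by apply: rem_uniq.
have -> : dsum S (fun j => if j \in T then h j else dzero X Y) ~~
   dsum S (fun j => if j \in rem i T then h j else dzero X Y).
  apply: dsum_ext => j jS; rewrite mem_rem_uniq // inE.
  by have -> : j != i by apply: contraNneq iS => <-.
rewrite IH //; last first.
  move=> j; rewrite mem_rem_uniq // inE => /andP[ji /sub].
  by rewrite in_cons (negPf ji).
elim: T uT iT {sub uT' IH} => // t T IHT /= /andP[tT uT].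
rewrite in_cons eq_sym; case: eqVneq => [->//|it /= iT].
by rewrite /= -IHT // !daddA; apply: dhom_eq_dadd => //; exact: daddC.
Qed.
End Dsum.

Lemma qia_dsc (I : eqType) (N N' : I -> cplx p k) (r : forall i, chain_map (N' i) (N i)) V :
  (forall i, qia (r i) V) -> qia (dsc_lift (fun i => cm_comp (dsc_in N i) (r i))) V.
Proof.
set R := dsc_lift _ => q.
have RE i (n : int) x : R n V (dsc_in N' i n V x) = dsc_in N i n V (r i n V x).
  by rewrite /R dsc_liftE.
have PR i (n : int) z : dsc_proj N i n V (R n V z) = r i n V (dsc_proj N' i n V z).
  apply: (dsc_ext (f := dsc_proj N i n V \o R n V) (g := r i n V \o dsc_proj N' i n V)) => j x.
  rewrite [LHS]/= [RHS]/= RE; have [<-|ne] := eqVneq j i; first by rewrite !dsc_proj_in.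
  by rewrite !dsc_proj_ne // linear0.
have bs (M : I -> cplx p k) (n : int) (s : seq I) (F : forall i, M i (n - 1) V) :
    (forall i, boundary (F i)) -> boundary (\sum_(i <- s) dsc_in M i (n - 1) V (F i)).
  move=> b; elim/big_ind: _ => [|x y|i _]; [exact: boundary0|exact: boundaryD|].
  exact: boundary_map.
move=> n; split=> [z dz b|w dw].
  have [s Hs] := dsc_supp z; rewrite (Hs (undup s) (undup_uniq s)); last first.
    by move=> i; rewrite mem_undup.
  apply: bs => i; apply: (q i n).1; first exact: cycle_map.
  by rewrite -PR; apply: boundary_map.
have /dchoice[z Hz] : forall i, exists z : N' i (n - 1) V, cycle z /\
    boundary (r i (n - 1) V z - dsc_proj N i (n - 1) V w).
  by move=> i; have [z] := (q i n).2 _ (cycle_map (dsc_proj N i) dw); exists z.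
have [s Hs] := dsc_supp w.
have sub : {subset s <= undup s} by move=> i; rewrite mem_undup.
have ew := Hs _ (undup_uniq s) sub.
exists (\sum_(i <- undup s) dsc_in N' i (n - 1) V (z i)).
  rewrite /cycle linear_sum big1 // => i _.
  by rewrite -cm_comm (Hz i).1 linear0.
rewrite [X in _ - X]ew linear_sum -sumrB.
under eq_bigr => i _ do rewrite RE -linearB.
by apply: bs => i; exact: (Hz i).2.
Qed.

(** The sum of K-projective resolutions of the N i is K-projective and quasi-isomorphic to the sum
    of the N i. Out of it, derived morphisms are chain maps, determined up to homotopy by their
    components. *)
Lemma dsc_coproduct (I : eqType) (N : I -> cplx p k) :
  is_dcoproduct (fun i => dmap (dsc_in N i)).
Proof.
move=> Y g.
have /dchoice[G HG] := fun i => resolution char0 (N i).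
have /dchoice[r Hr] := HG.
have qR : quasi_iso (dsc_lift (fun i => cm_comp (dsc_in N i) (r i))).
  apply/qiaP => V; apply: qia_dsc => i; have [_ /qiaP H] := Hr i; exact: H.
set R := dsc_lift _ in qR.
have RE i : ceq (cm_comp R (dsc_in G i)) (cm_comp (dsc_in N i) (r i)).
  by move=> n V x; rewrite [LHS]/= /R dsc_liftE.
have kG : kproj (dsc G) by apply: kp_dsc => i; have [] := Hr i.
have /dchoice[a Ha] : forall i, exists a : chain_map (G i) Y, g i ** dmap (r i) ~~ dmap a.
  by move=> i; apply: d_liftP; have [] := Hr i.
exists (dmap (dsc_lift a) ** dinv qR); split=> [i|h' Hh'].
  apply: (d_epi (proj2 (Hr i))); rewrite Ha -!dcompA -dmap_comp -(dmap_ext (RE i)) dmap_comp.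
  rewrite (dcompA (dinv qR)) dmapK dcomp1l -dmap_comp; apply: dmap_ext => n V x.
  by rewrite [LHS]/= dsc_liftE.
apply: (d_epi qR); rewrite -dcompA dmapK dcomp1r.
have [f Hf] := d_liftP (h' ** dmap R) kG; rewrite Hf; apply: dmap_htp.
apply: dsc_null => i; apply: (d_faith0 (proj1 (Hr i))).
have -> : dmap (cm_comp (cm_sub f (dsc_lift a)) (dsc_in G i)) ~~
   dadd (dmap (cm_comp f (dsc_in G i))) (dopp (dmap (a i))).
  rewrite -dmap_opp -dmap_add; apply: dmap_ext => n V x.
  by rewrite [LHS]/= dsc_liftE.
rewrite dmap_comp -Hf -dcompA -dmap_comp (dmap_ext (RE i)) dmap_comp dcompA Hh' Ha.
exact: daddNr.
Qed.

(** The injectivity half of compactness holds for every M: the universal property supplies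
    projections from X to the N j, which isolate the terms of the sum. *)
Lemma compact_indep M (I : eqType) (N : I -> cplx p k) X
    (inj : forall i : I, dhom (N i) X) : is_dcoproduct inj ->
  forall (s : seq I) (h : forall i : I, dhom M (N i)), uniq s ->
    dsum s (fun i => inj i ** h i) ~~ dzero M X ->
    forall i, i \in s -> h i ~~ dzero M (N i).
Proof.
move=> cp s h us e j js.
have [pj [Hpj _]] := cp (N j) (fun i => dmap (dsc_delta N i j)).
have : pj ** dsum s (fun i => inj i ** h i) ~~ dzero M (N j) by rewrite e dcomp0r.
rewrite dsum_compl (dsum_single (j := j)) //.
  by rewrite dcompA Hpj dsc_delta_id dcomp1l.
by move=> i ij; rewrite dcompA Hpj dsc_delta_ne // dcomp0l.
Qed.

(** Comparing an arbitrary coproduct with the strict sum [dsc N] reduces compactness to chain maps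
    from a K-projective resolution into strict sums. [compact_fin] is the converse. *)
Lemma compactI M G (r : chain_map G M) : kproj G -> quasi_iso r ->
  (forall (I : eqType) (N : I -> cplx p k) (g : chain_map G (dsc N)),
     exists (s : seq I) (c : forall i, chain_map G (N i)),
       uniq s /\ htp g (csum s (fun j => cm_comp (dsc_in N j) (c j)))) ->
  compact M.
Proof.
move=> kG qr H I N X inj cp; split; last exact: compact_indep cp.
move=> g.
have [ph [Hph _]] := cp (dsc N) (fun i => dmap (dsc_in N i)).
have [ps [Hps _]] := dsc_coproduct inj.
have [x [_ Hx]] := cp X inj.
have psph : ps ** ph ~~ did X.
  transitivity x; [|symmetry]; apply: Hx => i; last exact: dcomp1l.
  by rewrite -dcompA Hph Hps.
have [g' Hg'] := d_liftP (ph ** g ** dmap r) kG.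
have [s [c [us Hc]]] := H I N g'.
exists s, (fun i => dmap (c i) ** dinv qr); split=> //.
apply: (d_epi qr); rewrite dsum_compr.
have -> : g ** dmap r ~~ ps ** dmap g'.
  by rewrite -Hg' !dcompA psph dcomp1l.
rewrite (dmap_htp Hc) dmap_csum dsum_compl; apply: dsum_ext => i _.
by rewrite dmap_comp (dcompA ps) Hps -!dcompA dmapK dcomp1r.
Qed.

Lemma compact_fin M G (r : chain_map G M) : compact M -> kproj G -> quasi_iso r ->
  forall (I : eqType) (N : I -> cplx p k) (g : chain_map G (dsc N)),
     exists (s : seq I) (c : forall i, chain_map G (N i)),
       uniq s /\ htp g (csum s (fun j => cm_comp (dsc_in N j) (c j))).
Proof.
move=> cM kG qr I N g.
have [H _] := cM I N _ _ (dsc_coproduct (N := N)).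
have [s [h [us Hs]]] := H (dmap g ** dinv qr).
have /dchoice[c Hc] : forall i, exists c : chain_map G (N i), h i ** dmap r ~~ dmap c.
  by move=> i; apply: d_liftP.
exists s, c; split=> //; apply: (d_faith kG).
rewrite dmap_csum -[dmap g]dcomp1r -(dmapK qr) dcompA -Hs dsum_compr.
by apply: dsum_ext => i _; rewrite dmap_comp -dcompA Hc.
Qed.

Lemma compact_retract X Y : dretract X Y -> compact Y -> compact X.
Proof.
move=> [i [r ri]] cY I N Z inj cp; split; last exact: compact_indep cp.
move=> g; have [H _] := cY I N Z inj cp; have [s [h [us Hs]]] := H (g ** r).
exists s, (fun j => h j ** i); split=> //.
rewrite -[g]dcomp1r -ri dcompA -Hs dsum_compr; apply: dsum_ext => j _.
by rewrite dcompA.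
Qed.

Lemma compact_zero X : did X ~~ dzero X X -> compact X.
Proof.
move=> e I N Z inj cp; split; last exact: compact_indep cp.
move=> g; exists [::], (fun j => dzero X (N j)); split=> //=.
by rewrite -[g]dcomp1r e dcomp0r.
Qed.

Lemma compact_acy X : (forall V, acy X V) -> compact X.
Proof. by move=> a; apply/compact_zero/acy_dzero. Qed.

(** The restriction of g to B is a finite sum through the N i; its terms extend over the cone, and
    what remains of g factors through the next vertex of the triangle, the shift of A, where
    compactness is applied again. *)
Lemma compact_cone_shift A B (f : chain_map A B) :
  compact (shift A) -> compact B -> compact (cone f).
Proof.
move=> cA cB I N X inj cp; split; last exact: compact_indep cp.
move=> g; have [HA _] := cA I N X inj cp; have [HB _] := cB I N X inj cp.
have [s [b [us Hs]]] := HB (g ** dmap (cone_in f)).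
(* Outside s the components are set to zero, so that every [b' i] kills [f]. For i in s this is
   [compact_indep], because the sum of the composites with [f] vanishes. *)
pose b' i := if i \in s then b i else dzero B (N i).
have b'f i : b' i ** dmap f ~~ dzero A (N i).
  rewrite /b'; case: ifP => [js|_]; last exact: dcomp0l.
  apply: (compact_indep cp (s := s) (h := fun i => b i ** dmap f)) => //.
  transitivity (dsum s (fun i => inj i ** b i) ** dmap f).
    by rewrite dsum_compr; apply: dsum_ext => j _; rewrite dcompA.
  rewrite Hs -dcompA -dmap_comp.
  have [h0 [_ h0E]] : exists h : chain_map (cone f) (cone f), True /\ True by exists (cm_id _).
  have nf : nullh (cm_comp (cone_in f) f).
    exists (fun n : int => nt_inl (A (n - 1)) (B n)) => n V x.
    by rewrite /= /cone_d_fun /= linear0 addr0; congr (_, _); rewrite /= ?addNr ?addr0.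
  by rewrite (dmap_null nf) dcomp0r.
have /dchoice[c Hc] := fun i => triangle_left (b'f i).
have [a Ha] : exists a : dhom (shift A) X,
    a ** dmap (cone_out f) ~~ dadd g (dopp (dsum s (fun i => inj i ** c i))).
  apply: triangle_right; rewrite dcompDl -Hs /dopp -dcompA dsum_compr.
  rewrite -(daddNr (dsum s (fun i => inj i ** b i))); apply: dhom_eq_dadd => //.
  apply: dhom_eq_dcomp => //; apply: dsum_ext => i si.
  by rewrite -dcompA Hc /b' si.
have [s' [a' [us' Hs']]] := HA a.
pose S := undup (s ++ s').
pose c1 i := if i \in s then c i else dzero _ _.
pose a1 i := if i \in s' then a' i else dzero _ _.
exists S, (fun i => dadd (c1 i) (a1 i ** dmap (cone_out f))); split.
  exact: undup_uniq.
have ex1 (T : seq I) (Z : cplx p k) (h : forall i, dhom Z (N i)) i :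
    inj i ** (if i \in T then h i else dzero Z (N i)) ~~
    (if i \in T then inj i ** h i else dzero Z X).
  by case: ifP => _ //; exact: dcomp0r.
have -> : dsum S (fun i => inj i ** dadd (c1 i) (a1 i ** dmap (cone_out f))) ~~
   dadd (dsum S (fun i => inj i ** c1 i)) (dsum S (fun i => inj i ** a1 i) ** dmap (cone_out f)).
  rewrite dsum_compr -dsum_add; apply: dsum_ext => i _.
  by rewrite dcompDr dcompA.
rewrite (dsum_ext (fun i _ => ex1 s _ c i)) (dsum_ext (fun i _ => ex1 s' _ a' i)).
have uS : uniq S by exact: undup_uniq.
rewrite !dsum_widen //.
- by rewrite Hs' Ha [dadd g _]daddC daddA daddNr dadd0l.
- by move=> i si; rewrite mem_undup mem_cat si orbT.
- by move=> i si; rewrite mem_undup mem_cat si.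
Qed.

Lemma compact_diso X Y : diso X Y -> compact Y -> compact X.
Proof. by move=> /diso_retract; apply: compact_retract. Qed.

End Derived.

(** * Thick subcategories *)

Section Compactness.
Variables (p : nat) (k : fieldType).
Hypothesis char0 : [pchar k]%R =i pred0.
Local Notation VS := (vectType 'F_p).
Implicit Types (V : VS) (X Y Z G A B M : cplx p k).
Local Notation P := (cell p k true).
Local Notation Q := (cell p k false).

Lemma qi_id X : quasi_iso (cm_id X).
Proof. by apply/qiaP => V; apply: qia_id. Qed.

Lemma compact_Q n i : compact (Q n i).
Proof.
apply: (compactI char0 (@cellQ_kproj p k n i) (qi_id _)) => I N g.
have [s [us Hs]] := cellQ_fin g.
exists s, (fun j => cm_comp (dsc_proj N j) g); split=> //.
by apply: htp_ext => m V x; rewrite csumE -Hs.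
Qed.

Lemma compact_P n i : compact (P n i).
Proof.
have [a [r ra]] := cellP_retract p k n i.
by apply: (compact_retract (dretract_strict (htp_ext ra))); apply: compact_Q.
Qed.

Lemma nullh_shift X Y (f : chain_map X Y) : nullh f -> nullh (shift_map f).
Proof.
move=> [h H]; exists (fun n => nt_opp (h (n - 1))) => n V x.
by rewrite /= H !linearN /= !opprK.
Qed.

Section ShiftSum.
Variables (I : eqType) (N : I -> cplx p k).

Definition shift_dsc : chain_map (shift (dsc N)) (dsc (fun i => shift (N i))).
Proof.
refine (@mkc p k (shift (dsc N)) (dsc (fun i => shift (N i)))
  (fun n : int => nt_id (dsc N (n - 1))) _).
move=> n V x.
pose d1 : {linear dsc N (n - 1) V -> dsc N (n - 1 - 1) V} := cx_d (shift (dsc N)) n V.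
pose d2 : {linear dsc N (n - 1) V -> dsc N (n - 1 - 1) V} := cx_d (dsc (fun i => shift (N i))) n V.
rewrite -[LHS]/(d1 x) -[RHS]/(d2 x).
apply: (dsc_ext (f := d1) (g := d2)) => i y.
rewrite [RHS](dsc_dE (N := fun i => shift (N i))).
rewrite -[LHS]/(- cx_d (dsc N) (n - 1) V (dsc_in N i (n - 1) V y)) dsc_dE.
by rewrite -linearN.
Defined.

Lemma shift_dsc_d (n : int) V (x : dsc N (n - 1) V) :
  cx_d (shift (dsc N)) n V x = cx_d (dsc (fun i => shift (N i))) n V x.
Proof. exact: (cm_comm shift_dsc x). Qed.
End ShiftSum.

Lemma csum_comp (I : eqType) X Y Z (f : chain_map Y Z) (s : seq I) (h : I -> chain_map X Y) :
  ceq (cm_comp f (csum s h)) (csum s (fun i => cm_comp f (h i))).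
Proof.
move=> n V x; rewrite csumE [LHS]/= csumE linear_sum.
by apply: eq_bigr.
Qed.

Lemma compact_unshift A : compact (shift A) -> compact A.
Proof.
move=> cA; have [G [r [kG qr]]] := resolution char0 A.
have qs : quasi_iso (shift_map r).
  by apply/qiaP => V; apply: qia_shift; move/qiaP: qr; apply.
apply: (compactI char0 kG qr) => I N g.
have [s [c [us Hc]]] := compact_fin char0 cA (kp_shift kG) qs (cm_comp (shift_dsc N) (shift_map g)).
have /dchoice[c' Hc'] := fun i => unshift_map (c i).
exists s, c'; split=> //; apply: nullh_unshift.
move: Hc => [h H]; exists h => n V x.
apply: (etrans _ (etrans (H n V x) _)); last first.
  by congr (_ + _); rewrite -(shift_dsc_d (N := N) (h n V x)).
have E1 := csumE s (fun j => cm_comp (dsc_in (fun i => shift (N i)) j) (c j)) x.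
apply: (etrans _ (congr1 (fun z => g (n - 1 - 1) V x - z) (esym E1))).
rewrite -[LHS]/(g (n - 1 - 1) V x - csum s (fun j => cm_comp (dsc_in N j) (c' j)) (n - 1 - 1) V
    x) csumE.
congr (_ - _); apply: eq_bigr => i _ /=.
by rewrite -Hc'.
Qed.

(** A map from the shift of G lifts, up to homotopy, to the sum of the shifts of the [ush (N i)],
    and there it is the shift of a map out of G. *)
Lemma compact_shift A : compact A -> compact (shift A).
Proof.
move=> cA; have [G [r [kG qr]]] := resolution char0 A.
have qs : quasi_iso (shift_map r).
  by apply/qiaP => V; apply: qia_shift; move/qiaP: qr; apply.
apply: (compactI char0 (kp_shift kG) qs) => I N g.
pose N' i := shift (ush (N i)).
have qS : quasi_iso (dsc_lift (fun i => cm_comp (dsc_in N i) (ush_map (N i)))).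
  by apply/qiaP => V; apply: qia_dsc => i; apply: ush_map_qia.
set S := dsc_lift _ in qS.
have SE i : ceq (cm_comp S (dsc_in N' i)) (cm_comp (dsc_in N i) (ush_map (N i))).
  by move=> n V x; rewrite [LHS]/= /S dsc_liftE.
have [g1 Hg1] := kproj_lift g (kp_shift kG) qS.
have [f Hf] : exists f : chain_map G (dsc (fun i => ush (N i))), forall (n : int) V x,
     f (n - 1) V x = g1 n V x.
  have [f Hf] := @reindex_pred (fun m => vi_nat (G m) (dsc (fun i => ush (N i)) m)) g1.
  have C (n : int) V x : f (n - 1) V (cx_d G n V x) = cx_d (dsc (fun i => ush (N i))) n V (f n V x).
    elim/int_pred_ind: n x => n x; rewrite !Hf.
    have := etrans (cm_comm g1 x) (esym (shift_dsc_d (N := fun i => ush (N i)) (g1 n V x))).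
    by rewrite /= linearN => /oppr_inj.
  by exists (mkc C) => n V x; rewrite /= Hf.
have [s [c [us Hc]]] := compact_fin char0 cA kG qr f.
exists s, (fun i => cm_comp (ush_map (N i)) (shift_map (c i))); split=> //.
apply: htp_trans (htp_sym Hg1) _.
have H1 : htp g1 (csum s (fun i => cm_comp (dsc_in N' i) (shift_map (c i)))).
  have [h H] := nullh_shift Hc.
  have {}H : nullh (cm_comp (shift_dsc (fun i => ush (N i))) (shift_map
     (cm_sub f (csum s (fun j => cm_comp (dsc_in (fun i => ush (N i)) j) (c j)))))).
    by apply: nullh_compl; exists h.
  apply: nullh_ext H => n V x.
  have E1 := csumE s (fun i => cm_comp (dsc_in N' i) (shift_map (c i))) x.
  apply: (etrans _ (congr1 (fun z => g1 n V x - z) (esym E1))).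
  rewrite -[LHS]/(f (n - 1) V x - csum s (fun j =>
    cm_comp (dsc_in (fun i => ush (N i)) j) (c j)) (n - 1) V x) csumE Hf.
  by [].
apply: htp_trans (htp_compl S H1) _; apply: htp_ext => n V x.
rewrite csum_comp !csumE; apply: eq_bigr => i _.
by rewrite -[LHS]/(cm_comp S (dsc_in N' i) n V _) SE.
Qed.

Lemma compact_cone A B (f : chain_map A B) : compact A -> compact B -> compact (cone f).
Proof. by move=> /compact_shift cA; apply: compact_cone_shift. Qed.

(** Closure under shifts and the remaining two-out-of-three properties are not fields: they follow
    as [th_shift], [th_fib] and [th_mid], using closure under retracts. *)
Record thick (T : cplx p k -> Prop) : Prop := Thick {
  th_compact : forall X, T X -> compact X;
  th_acy : forall X, (forall V, acy X V) -> T X;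
  th_cone : forall X Y (f : chain_map X Y), T X -> T Y -> T (cone f);
  th_unshift : forall X, T (shift X) -> T X;
  th_retract : forall X Y, dretract X Y -> T Y -> T X }.

Lemma compact_thick : thick (@compact p k).
Proof.
split=> //.
- exact: compact_acy.
- by move=> X Y f; apply: compact_cone.
- exact: compact_unshift.
- by move=> X Y; apply: compact_retract.
Qed.

Section Thick.
Variable T : cplx p k -> Prop.
Hypothesis HT : thick T.

Lemma th_diso X Y : diso X Y -> T Y -> T X.
Proof. by move=> /diso_retract; apply: (th_retract HT). Qed.

(** The shift of X is a strict retract of the cone of the zero map from X to a contractible
    complex. *)
Lemma th_shift X : T X -> T (shift X).
Proof.
move=> TX; pose Z := cone (cm_id X).
have TZ : T Z by apply: (th_acy HT) => V; apply/null_acy/cone_id_null.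
have TC := th_cone HT (cm_zero X Z) TX TZ.
have C (n : int) V x : nt_inl (X (n - 1 - 1)) (Z (n - 1)) V (cx_d (shift X) n V x) =
    cx_d (cone (cm_zero X Z)) n V (nt_inl (X (n - 1)) (Z n) V x).
  by rewrite /= /cone_d_fun /= !linear0 !addr0.
pose s : chain_map (shift X) (cone (cm_zero X Z)) := @mkc p k (shift X) (cone (cm_zero X Z)) (fun
    n : int => nt_inl (X (n - 1)) (Z n)) C.
apply: (th_retract HT) TC; apply: (dretract_strict (a := s) (r := cone_out _)).
by apply: htp_ext => n V x; rewrite [LHS]/= addr0.
Qed.

(* [shift X] is a retract of the cone of [cone_in f]; in [th_mid], [shift Y] is
   one of the cone of [cone_out f]. *)
Lemma th_fib X Y (f : chain_map X Y) : T Y -> T (cone f) -> T X.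
Proof.
move=> TY TC; have TD := th_cone HT (cone_in f) TY TC.
apply: (th_unshift HT); apply: (th_retract HT) TD.
pose s (n : int) : vi_nat (shift X n) (cone (cone_in f) n) :=
  nt_pair (nt_opp (f (n - 1))) (nt_inl (X (n - 1)) (Y n)).
have sE (n : int) V x : s n V x = (- f (n - 1) V x, (x, 0)) by [].
have sC (n : int) V x : s (n - 1) V (cx_d (shift X) n V x) = cx_d (cone (cone_in f)) n V (s n V x).
  rewrite !sE cone_dE2 cone_dE2 /= !linear0 !linearN /= cm_comm.
  by congr (_, (_, _)); rewrite /= ?sub0r ?add0r ?addr0 ?addNr.
pose r (n : int) : vi_nat (cone (cone_in f) n) (shift X n) :=
  nt_comp (nt_fst (X (n - 1)) (Y n)) (nt_snd (Y (n - 1)) (cone f n)).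
have rE (n : int) V y x y' : r n V (y, (x, y')) = x by rewrite /= addr0 add0r.
have rC (n : int) V x : r (n - 1) V (cx_d (cone (cone_in f)) n V x) = cx_d (shift X) n V (r n V x).
  case: x => [y [x y']].
  have E : cx_d (cone (cone_in f)) n V (y, (x, y')) = (- cx_d Y (n - 1) V y,
    (0 - cx_d X (n - 1) V x, y + (f (n - 1) V x + cx_d Y n V y'))) by rewrite cone_dE2 cone_dE2.
  apply: (etrans (congr1 (r (n - 1) V) E)); rewrite rE sub0r.
  exact: (congr1 (fun t => - cx_d X (n - 1) V t) (esym (rE n V y x y'))).
apply: (dretract_strict (a := mkc sC) (r := mkc rC)); apply: htp_ext => n V x.
by rewrite -[LHS]/(r n V (s n V x)) sE rE.
Qed.

Lemma th_mid X Y (f : chain_map X Y) : T X -> T (cone f) -> T Y.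
Proof.
move=> /th_shift TX TC; have TD := th_cone HT (cone_out f) TC TX.
apply: (th_unshift HT); apply: (th_retract HT) TD.
pose s (n : int) : vi_nat (shift Y n) (cone (cone_out f) n) :=
  nt_comp (nt_inl _ (shift X n)) (nt_inr (X (n - 1 - 1)) (Y (n - 1))).
have sE (n : int) V y : s n V y = ((0, y), 0) by [].
have sC (n : int) V x : s (n - 1) V (cx_d (shift Y) n V x) = cx_d (cone (cone_out f)) n V (s n V x).
  rewrite !sE cone_dE2 cone_dE2 cone_outE.
  rewrite !linear0; congr (_, _); last by rewrite addr0.
  by rewrite /=; congr (_, _); rewrite /= ?oppr0 ?add0r.
pose r (n : int) : vi_nat (cone (cone_out f) n) (shift Y n) :=
  nt_copair (nt_snd (X (n - 1 - 1)) (Y (n - 1))) (f (n - 1)).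
have rE (n : int) V x y x' : r n V ((x, y), x') = y + f (n - 1) V x' by rewrite /= add0r.
have rC (n : int) V x : r (n - 1) V (cx_d (cone (cone_out f)) n V x) = cx_d (shift Y) n V (r n V x).
  case: x => [[x y] x'].
  have E : cx_d (cone (cone_out f)) n V ((x, y), x') =
    ((- - cx_d X (n - 1 - 1) V x, - (f (n - 1 - 1) V x + cx_d Y (n - 1) V y)),
     x + cx_d (shift X) n V x') by rewrite cone_dE2 cone_dE2 cone_outE.
  apply: (etrans (congr1 (r (n - 1) V) E)); rewrite !rE.
  rewrite [RHS]/= -[cx_d (shift X) n V x']/(- cx_d X (n - 1) V x') !linearD linearN /= cm_comm.
  zabel.
apply: (dretract_strict (a := mkc sC) (r := mkc rC)); apply: htp_ext => n V x.
by rewrite -[LHS]/(r n V (s n V x)) sE rE linear0 addr0.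
Qed.

(** Sums are built as iterated cones of zero maps, which introduce a shift of each Y i. The
    factorization of the identity is therefore realized on the shift of X and shifted back at the
    end. *)
Lemma th_sum (I : eqType) X (Y : I -> cplx p k) (a : forall i, chain_map X (Y i))
    (b : forall i, chain_map (Y i) X) (s : seq I) :
  (forall i, T (Y i)) -> htp (csum s (fun i => cm_comp (b i) (a i))) (cm_id X) -> T X.
Proof.
move=> TY H.
have [S [TS [u [v Huv]]]] : exists S, T S /\ exists (u : chain_map (shift X) S)
   (v : chain_map S (shift X)), ceq (cm_comp v u)
     (shift_map (csum s (fun i => cm_comp (b i) (a i)))).
  elim: s {H} => [|i s [S [TS [u [v Huv]]]]].
    exists (cone (cm_id X)); split.
      by apply: (th_acy HT) => V; apply/null_acy/cone_id_null.
    by exists (cm_zero _ _), (cm_zero _ _) => n V x /=.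
  exists (cone (cm_zero (Y i) S)); split; first exact: (th_cone HT).
  pose u' (n : int) : vi_nat (shift X n) (cone (cm_zero (Y i) S) n) :=
    nt_pair (a i (n - 1)) (u n).
  have uC (n : int) V x : u' (n - 1) V (cx_d (shift X) n V x) = cx_d (cone (cm_zero (Y i) S)) n V
      (u' n V x).
    rewrite -[RHS]/(- cx_d (Y i) (n - 1) V (a i (n - 1) V x), 0 + cx_d S n V (u n V x)).
    by rewrite add0r -!cm_comm -linearN.
  pose v' (n : int) : vi_nat (cone (cm_zero (Y i) S) n) (shift X n) :=
    nt_copair (b i (n - 1)) (v n).
  have vC (n : int) V x : v' (n - 1) V (cx_d (cone (cm_zero (Y i) S)) n V x) = cx_d (shift X) n V
      (v' n V x).
    case: x => y t; rewrite cone_dE2 -[LHS]/(b i (n - 1 - 1) V (- cx_d (Y i) (n - 1) V y) +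
      v (n - 1) V (0 + cx_d S n V t)) add0r cm_comm linearN cm_comm.
    by rewrite -[RHS]/(- cx_d X (n - 1) V (b i (n - 1) V y + v n V t)) linearD opprD.
  exists (mkc uC), (mkc vC) => n V x.
  rewrite -[LHS]/(b i (n - 1) V (a i (n - 1) V x) + cm_comp v u n V x) Huv.
  by [].
apply: (th_unshift HT); apply: (th_retract HT) TS.
apply: (dretract_strict (a := u) (r := v)).
apply: htp_trans (htp_ext Huv) _.
by apply: nullh_ext (nullh_shift H) => n V x.
Qed.

End Thick.

End Compactness.

(** * Coinduction *)

Section Coinduction.
Variables (p : nat) (k : fieldType).
Local Notation VS := (vectType 'F_p).
Implicit Types (V : VS) (X Y Z G A B M : cplx p k).

Lemma dsc_lin (I : eqType) (N : I -> cplx p k) (n : int) V (W : lmodType k)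
    (f : forall i, {linear N i n V -> W}) :
  exists F : {linear dsc N n V -> W}, forall i x, F (dsc_in N i n V x) = f i x.
Proof.
pose phi (s : ds_gfun (fun i => N i n) V) : W := f (tag s) (tagged s).
have r : gr phi by move=> i a x y; rewrite /phi /= linearP.
exists (plift r) => i x.
by rewrite -[dsc_in N i n V x]/(ds_in (fun i => N i n) i V x) ds_inE plift_gen.
Qed.

Variable j : nat.
Local Notation Vj := 'rV['F_p]_j.

Section Comod.
Variable A : lmodType k.
Definition comod_obj V : lmodType k := vinj V Vj -> A.
Definition comod_map U V (f : vinj U V) (phi : comod_obj U) : comod_obj V :=
  fun h => phi (icomp h f).
Lemma comod_map_linear U V (f : vinj U V) : linear (comod_map f).
Proof. by []. Qed.
Definition comod : vi_mod p k.
Proof.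
refine (@ViMod p k comod_obj (fun U V f fi => mkl (comod_map_linear (vinjOf fi))) _ _).
- move=> U fi x; apply/funext => h; rewrite /= /comod_map; congr (x _).
  by apply: vinj_eq => y; rewrite icompE /= id_lfunE.
- move=> U V W g f gi fi hi x; apply/funext => h; rewrite /= /comod_map; congr (x _).
  by apply: vinj_eq => y; rewrite !icompE /= comp_lfunE.
Defined.
Lemma act_comod U V (f : vinj U V) (x : comod U) (h : vinj V Vj) :
  (act comod f x : comod_obj V) h = x (icomp h f).
Proof.
by rewrite /act /= /comod_map; congr (x _); apply: vinj_eq => y; rewrite !icompE.
Qed.
End Comod.

Definition conat_map (A B : lmodType k) (f : {linear A -> B}) V (x : comod A V) : comod B V :=
  fun h => f (x h).
Lemma conat_linear (A B : lmodType k) (f : {linear A -> B}) V : linear (@conat_map A B f V).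
Proof. by move=> c x y; apply/funext => h; rewrite /conat_map /= linearP. Qed.
Definition conat (A B : lmodType k) (f : {linear A -> B}) : vi_nat (comod A) (comod B).
Proof.
refine (@mkn p k (comod A) (comod B) (fun V => mkl (@conat_linear A B f V)) _).
move=> U V g x; apply/funext => h.
exact: etrans (congr1 f (act_comod g x h)) (esym (act_comod g (conat_map f x : comod B U) h)).
Defined.

(* Maps [ind false j Z -> N] correspond to maps [Z -> coind N].  As there are
   only finitely many injections from [V] to [Vj], the functor [coind] commutes
   with direct sums, and so [ind false j] preserves compactness. *)
Definition coind (N : cplx p k) : cplx p k.
Proof.
refine (@Cplx p k (fun n : int => comod (N n Vj)) (fun n : int => conat (cx_d N n Vj)) _).
by move=> n V x; apply/funext => h; rewrite /= /conat_map cx_dd.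
Defined.

Lemma coind_dE N (n : int) V (x : coind N n V) h :
  (cx_d (coind N) n V x : comod_obj (N (n - 1) Vj) V) h =
  cx_d N n Vj ((x : comod_obj (N n Vj) V) h).
Proof. by []. Qed.

Definition dirac (A : lmodType k) V (h : vinj V Vj) (y : A) : comod_obj A V :=
  fun l => if l == h then y else 0.
Lemma dirac_linear (A : lmodType k) V (h : vinj V Vj) : linear (@dirac A V h).
Proof.
move=> c x y; apply/funext => l; rewrite /dirac /=.
by rewrite -[RHS]/(c *: (if l == h then x else 0) + (if l == h then y else 0));
    case: eqP => // _; rewrite scaler0 addr0.
Qed.

Section Tau.
Variables (I : eqType) (N : I -> cplx p k).
Local Notation CN := (fun i => coind (N i)).

(** [tau n h y] is the function on injections with value y at h and 0 elsewhere, with y an element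
    of the direct sum. Finite sums of these realize the exchange of direct sums with coinduction. *)
Lemma tau_ex (n : int) V (h : vinj V Vj) :
  {F : {linear dsc N n Vj -> dsc CN n V} |
   forall i y, F (dsc_in N i n Vj y) = dsc_in CN i n V (dirac h y)}.
Proof.
apply: cid.
by have [F HF] := dsc_lin (fun i => dsc_in CN i n V \o mkl (@dirac_linear (N i n Vj) V h) :
    {linear _ -> _}); exists F => i y; rewrite HF.
Qed.
Definition tau (n : int) V (h : vinj V Vj) := sval (tau_ex n h).
Lemma tauE (n : int) V (h : vinj V Vj) i y :
  tau n h (dsc_in N i n Vj y) = dsc_in CN i n V (dirac h y).
Proof. exact: (svalP (tau_ex n h)). Qed.

Lemma tau_d (n : int) V (h : vinj V Vj) y :
  cx_d (dsc CN) n V (tau n h y) = tau (n - 1) h (cx_d (dsc N) n Vj y).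
Proof.
apply: (dsc_ext (f := cx_d (dsc CN) n V \o tau n h)
  (g := tau (n - 1) h \o cx_d (dsc N) n Vj)) => i x.
rewrite -[LHS]/(cx_d (dsc CN) n V (tau n h (dsc_in N i n Vj x))).
rewrite -[RHS]/(tau (n - 1) h (cx_d (dsc N) n Vj (dsc_in N i n Vj x))).
rewrite tauE !dsc_dE tauE; congr (dsc_in _ _ _ _ _).
apply/funext => l; rewrite coind_dE /dirac; case: eqP => // _.
exact: linear0.
Qed.

(** Acting by u precomposes functions with l |-> l u, so a function supported at h becomes one
    supported on all extensions l of h along u. *)
Lemma tau_act (n : int) U V (u : vinj U V) (h : vinj U Vj) y :
  act (dsc CN n) u (tau n h y) =
  \sum_(l <- vinjs V Vj) if icomp l u == h then tau n l y else 0.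
Proof.
pose F (l : vinj V Vj) : {linear dsc N n Vj -> dsc CN n V} :=
  if icomp l u == h then tau n l else \0.
have FE l z : (if icomp l u == h then tau n l z else 0) = F l z by rewrite /F; case: eqP.
rewrite (eq_bigr _ (fun l _ => FE l y)).
have SL : linear (fun z => \sum_(l <- vinjs V Vj) F l z).
  move=> c a b; rewrite scaler_sumr -big_split; apply: eq_bigr => l _.
  by rewrite linearP.
apply: (dsc_ext (f := act (dsc CN n) u \o tau n h) (g := mkl SL)) => i x.
rewrite -[LHS]/(act (dsc CN n) u (tau n h (dsc_in N i n Vj x))) [RHS]/= tauE -nt_act.
rewrite (eq_bigr (fun l => dsc_in CN i n V (if icomp l u == h then dirac l x else 0))); last first.
  by move=> l _; rewrite -FE tauE; case: eqP => // _; rewrite linear0.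
rewrite -linear_sum; congr (dsc_in _ _ _ _ _); apply/funext => l.
rewrite (act_comod u _ l) fct_sumE /dirac.
rewrite (bigD1_seq l) ?mem_vinjs ?vinjs_uniq //= big1 ?addr0 => [|l' ne].
  by case: eqP => // _; rewrite eqxx.
by case: eqP => // _; rewrite eq_sym (negbTE ne).
Qed.

Lemma coeval_ex (n : int) : {F : {linear dsc CN n Vj -> dsc N n Vj} |
   forall i y, F (dsc_in CN i n Vj y) = dsc_in N i n Vj ((y : comod_obj _ Vj) (iid Vj))}.
Proof.
have L i : linear (fun y : coind (N i) n Vj => (y : comod_obj (N i n Vj) Vj) (iid Vj)) by [].
apply: cid; have [F HF] := dsc_lin (fun i => dsc_in N i n Vj \o mkl (L i) : {linear _ -> _}).
by exists F => i y; rewrite HF.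
Qed.
Definition coeval (n : int) := sval (coeval_ex n).
Lemma coevalE (n : int) i y :
  coeval n (dsc_in CN i n Vj y) = dsc_in N i n Vj ((y : comod_obj _ Vj) (iid Vj)).
Proof. exact: (svalP (coeval_ex n)). Qed.
Lemma coeval_d (n : int) y :
  coeval (n - 1) (cx_d (dsc CN) n Vj y) = cx_d (dsc N) n Vj (coeval n y).
Proof.
apply: (dsc_ext (f := coeval (n - 1) \o cx_d (dsc CN) n Vj)
  (g := cx_d (dsc N) n Vj \o coeval n)) => i x.
rewrite -[LHS]/(coeval (n - 1) (cx_d (dsc CN) n Vj (dsc_in CN i n Vj x))).
rewrite -[RHS]/(cx_d (dsc N) n Vj (coeval n (dsc_in CN i n Vj x))).
by rewrite coevalE !dsc_dE coevalE.
Qed.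
Lemma coeval_tau (n : int) h y : coeval n (tau n h y) = if h == iid Vj then y else 0.
Proof.
pose F : {linear dsc N n Vj -> dsc N n Vj} := if h == iid Vj then
  (idfun : {linear dsc N n Vj -> dsc N n Vj}) else (\0 : {linear dsc N n Vj -> dsc N n Vj}).
have FE z : (if h == iid Vj then z else 0) = F z by rewrite /F; case: eqP.
rewrite FE; apply: (dsc_ext (f := coeval n \o tau n h) (g := F)) => i x.
rewrite [LHS]/= tauE coevalE /dirac -FE eq_sym; case: eqP => // _.
exact: linear0.
Qed.
End Tau.

(** The transpose of g sends x to the sum over injections h of [tau h] applied to the value of g at
    h x. By compactness of Z it factors, up to homotopy, through finitely many summands, and
    evaluation at the identity injection transposes the factors and the homotopy back. *)
Lemma ind_hom_fin Z (kZ : kproj Z) (cZ : compact Z) (char0 : [pchar k]%R =i pred0)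
    (I : eqType) (N : I -> cplx p k) (g : chain_map (ind false j Z) (dsc N)) :
  exists (s : seq I) (c : forall i, chain_map (ind false j Z) (N i)),
    uniq s /\ htp g (csum s (fun i => cm_comp (dsc_in N i) (c i))).
Proof.
pose CN i := coind (N i).
pose G (n : int) : {linear Z n Vj -> dsc N n Vj} := g n Vj \o igen false Z n (iid Vj).
have Gd (n : int) z : G (n - 1) (cx_d Z n Vj z) = cx_d (dsc N) n Vj (G n z).
  exact: etrans (congr1 (g (n - 1) Vj) (esym (ind_dE _ _ _))) (cm_comm g _).
pose Gam (n : int) V (x : Z n V) : dsc CN n V :=
  \sum_(h <- vinjs V Vj) tau N n h (G n (act (Z n) h x)).
have GamL (n : int) V : linear (@Gam n V).
  move=> c x y; rewrite /Gam scaler_sumr -big_split; apply: eq_bigr => h _.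
  by rewrite !linearP.
have GamN (n : int) U V (u : vinj U V) x : Gam n V (act (Z n) u x) = act (dsc CN n) u (Gam n U x).
  rewrite /Gam linear_sum (eq_bigr _ (fun h _ => tau_act u h _)) exchange_big /=.
  apply: eq_bigr => l _; rewrite (bigD1_seq (icomp l u)) ?mem_vinjs ?vinjs_uniq //= eqxx.
  rewrite big1 ?addr0 ?actM // => h ne; by rewrite eq_sym (negbTE ne).
have GamC (n : int) V x : Gam (n - 1) V (cx_d Z n V x) = cx_d (dsc CN) n V (Gam n V x).
  rewrite /Gam linear_sum; apply: eq_bigr => h _.
  by rewrite tau_d -Gd nt_act.
pose Gm : chain_map Z (dsc CN) := @mkc p k Z (dsc CN)
  (fun n : int => @mkn p k (Z n) (dsc CN n) (fun V => mkl (@GamL n V)) (@GamN n)) GamC.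
have [s [c [us [H HH]]]] := compact_fin char0 cZ kZ (qi_id Z) Gm.
have EG (n : int) z : coeval N n (Gm n Vj z) = G n z.
  rewrite -[Gm n Vj z]/(Gam n Vj z) /Gam linear_sum.
  rewrite (bigD1_seq (iid Vj)) ?mem_vinjs ?vinjs_uniq //= coeval_tau eqxx act1.
  rewrite big1 ?addr0 // => h ne; by rewrite coeval_tau (negbTE ne).
have cL i (n : int) : linear (fun z : Z n Vj => (c i n Vj z : comod_obj (N i n Vj) Vj) (iid Vj)).
  by move=> a x y; rewrite linearP.
have /dchoice[c' Hc'] : forall i, exists c' : chain_map (ind false j Z) (N i),
    forall (n : int) V f z, c' n V (igen false Z n f z) =
      act (N i n) f ((c i n Vj z : comod_obj (N i n Vj) Vj) (iid Vj)).
  move=> i; apply: (ind_lift (phi := fun n => mkl (cL i n))) => // n z.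
  exact: (congr1 (fun y : comod_obj (N i (n - 1) Vj) Vj => y (iid Vj)) (cm_comm (c i) z)).
exists s, c'; split=> //.
have /dchoice[H' HH'] : forall n : int, exists H' : vi_nat (ind false j Z (n - 1)) (dsc N n),
    forall V f z, H' V (igen false Z (n - 1) f z) = act (dsc N n) f (coeval N n (H n Vj z)).
  by move=> n; apply: (ind_nt_lift (phi := coeval N n \o H n Vj)).
exists H' => n V x.
set R := cm_sub g _.
apply: (ind_ext (f := R (n - 1) V) (g := (cx_d (dsc N) n V \o H' n V) \+
  (H' (n - 1) V \o cx_d (ind false j Z) (n - 1) V))) => f z.
rewrite [RHS]/= ind_dE !HH' nt_act -linearD -coeval_d -linearD -HH.
rewrite -[in LHS](icompf1 f) -act_igen nt_act; congr (act _ _ _).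
rewrite /R -[LHS]/(G (n - 1) z - csum s (fun i => cm_comp (dsc_in N i) (c' i)) (n - 1) Vj
   (igen false Z (n - 1) (iid Vj) z)).
rewrite -[X in coeval N (n - 1) X]/(Gm (n - 1) Vj z - csum s (fun i => cm_comp (dsc_in CN i) (c
    i)) (n - 1) Vj z).
rewrite linearB EG; congr (_ - _); rewrite !csumE linear_sum; apply: eq_bigr => i _.
rewrite -[LHS]/(dsc_in N i (n - 1) Vj (c' i (n - 1) Vj (igen false Z (n - 1) (iid Vj) z))).
by rewrite -[cm_comp _ _ _ _ z]/(dsc_in CN i (n - 1) Vj (c i (n - 1) Vj z)) coevalE Hc' act1.
Qed.

End Coinduction.

(** * Structure of compact objects *)

Section Structure.
Variables (p : nat) (k : fieldType).
Hypothesis char0 : [pchar k]%R =i pred0.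
Local Notation VS := (vectType 'F_p).
Implicit Types (V : VS) (X Y Z G A B M : cplx p k).
Local Notation "u ~~ v" := (dhom_eq u v) (at level 70).
Local Notation "v ** u" := (dcomp v u) (at level 40, left associativity).
Local Notation P := (cell p k true).
Local Notation Vn n := 'rV['F_p]_n.

Section Ind.
Variable j : nat.
Local Notation Vj := 'rV['F_p]_j.

Lemma ind_kproj b Z : kproj (ind b j Z).
Proof. exact: ind_kp. Qed.

Lemma ind_map_ex b Z Z' (r : chain_map Z Z') :
  {F : chain_map (ind b j Z) (ind b j Z') |
    forall (n : int) V f z, F n V (igen b Z n f z) = igen b Z' n f (r n Vj z)}.
Proof.
apply: cid.
have [||F HF] := @ind_lift p k b j Z (ind b j Z') (fun n => igen b Z' n (iid Vj) \o r n Vj).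
- move=> bt n g z.
  by rewrite /= nt_act act_igen icompf1 -igen_act // icomp1f.
- by move=> n z; exact: etrans (congr1 (igen b Z' (n - 1) (iid Vj)) (cm_comm r z)) (esym (ind_dE
    _ _ _)).
by exists F => n V f z; rewrite HF [X in act _ f X]/= act_igen icompf1.
Qed.
Definition ind_map b Z Z' (r : chain_map Z Z') := sval (ind_map_ex b r).
Lemma ind_mapE b Z Z' (r : chain_map Z Z') (n : int) V f z :
  ind_map b r n V (igen b Z n f z) = igen b Z' n f (r n Vj z).
Proof. exact: (svalP (ind_map_ex b r)). Qed.

(** Plain induction commutes with cones, so the cone of the induced map is a retract of the complex
    induced from the cone of [r], which is acyclic. *)
Lemma ind_map_qia Z Z' (r : chain_map Z Z') V : qia r Vj -> qia (ind_map false r) V.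
Proof.
move=> qr; apply: qia_cone; apply: acy_of_rV.
set C := cone r.
apply: (@acy_retract p k _ (ind false j C)); last first.
  by apply: (ind_acy char0); apply: acy_cone.
have inlL (n : int) : linear (fun z : Z (n - 1) Vj => igen false C n (iid Vj) ((z, 0) : C n Vj)).
  by move=> c x y; rewrite -linearP; congr (igen _ _ _ _ _); congr (_, _); rewrite /= scaler0 addr0.
have inrL (n : int) : linear (fun z : Z' n Vj => igen false C n (iid Vj) ((0, z) : C n Vj)).
  by move=> c x y; rewrite -linearP; congr (igen _ _ _ _ _); congr (_, _); rewrite /= scaler0 addr0.
have /dchoice[a Ha] : forall n : int, exists a : vi_nat (ind false j Z (n - 1)) (ind false j C n),
    forall V f z, a V (igen false Z (n - 1) f z) = igen false C n f ((z, 0) : C n Vj).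
  move=> n; have [|a Ha] := @ind_nt_lift p k false j Z (n - 1) (ind false j C n) (mkl (inlL n))
      => //.
  by exists a => W f z; rewrite Ha [X in act _ f X]/= act_igen icompf1.
have /dchoice[a' Ha'] : forall n : int, exists a : vi_nat (ind false j Z' n) (ind false j C n),
    forall V f z, a V (igen false Z' n f z) = igen false C n f ((0, z) : C n Vj).
  move=> n; have [|a' Ha'] := @ind_nt_lift p k false j Z' n (ind false j C n) (mkl (inrL n)) => //.
  by exists a' => W f z; rewrite Ha' [X in act _ f X]/= act_igen icompf1.
have fstL (n : int) : linear (fun z : C n Vj => igen false Z (n - 1) (iid Vj) z.1).
  by move=> c x y; rewrite -linearP.
have sndL (n : int) : linear (fun z : C n Vj => igen false Z' n (iid Vj) z.2).
  by move=> c x y; rewrite -linearP.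
have /dchoice[r1 Hr1] : forall n : int, exists a : vi_nat (ind false j C n) (ind false j Z (n - 1)),
    forall V f z, a V (igen false C n f z) = igen false Z (n - 1) f z.1.
  move=> n; have [|a1 Ha1] := @ind_nt_lift p k false j C n (ind false j Z (n - 1)) (mkl (fstL n))
      => //.
  by exists a1 => W f z; rewrite Ha1 [X in act _ f X]/= act_igen icompf1.
have /dchoice[r2 Hr2] : forall n : int, exists a : vi_nat (ind false j C n) (ind false j Z' n),
    forall V f z, a V (igen false C n f z) = igen false Z' n f z.2.
  move=> n; have [|a1 Ha1] := @ind_nt_lift p k false j C n (ind false j Z' n) (mkl (sndL n)) => //.
  by exists a1 => W f z; rewrite Ha1 [X in act _ f X]/= act_igen icompf1.
set F := ind_map false r.
pose s (n : int) : vi_nat (cone F n) (ind false j C n) := nt_copair (a n) (a' n).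
have sE (n : int) W x y : s n W (x, y) = a n W x + a' n W y by [].
have a'C (n : int) W y : a' (n - 1) W (cx_d (ind false j Z') n W y) = cx_d (ind false j C) n W
    (a' n W y).
  apply: (ind_ext (f := a' (n - 1) W \o cx_d (ind false j Z') n W)
    (g := cx_d (ind false j C) n W \o a' n W)) => f z.
  rewrite -[LHS]/(a' (n - 1) W (cx_d (ind false j Z') n W (igen false Z' n f z))).
  rewrite -[RHS]/(cx_d (ind false j C) n W (a' n W (igen false Z' n f z))).
  rewrite Ha' !ind_dE Ha'; congr (igen _ _ _ _ _).
  by rewrite cone_dE2 !linear0 add0r ?oppr0.
have aC (n : int) W x : cx_d (ind false j C) n W (a n W x) =
    a' (n - 1) W (F (n - 1) W x) - a (n - 1) W (cx_d (ind false j Z) (n - 1) W x).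
  apply: (ind_ext (f := cx_d (ind false j C) n W \o a n W)
    (g := (a' (n - 1) W \o F (n - 1) W) \- (a (n - 1) W \o cx_d (ind false j Z) (n - 1) W))) => f z.
  rewrite -[LHS]/(cx_d (ind false j C) n W (a n W (igen false Z (n - 1) f z))).
  rewrite -[RHS]/(a' (n - 1) W (F (n - 1) W (igen false Z (n - 1) f z))
     - a (n - 1) W (cx_d (ind false j Z) (n - 1) W (igen false Z (n - 1) f z))).
  rewrite Ha !ind_dE ind_mapE Ha' Ha -linearB; congr (igen _ _ _ _ _).
  by rewrite cone_dE2 linear0 addr0; congr (_, _); rewrite /= ?sub0r ?subr0.
have sC (n : int) W x : s (n - 1) W (cx_d (cone F) n W x) = cx_d (ind false j C) n W (s n W x).
  case: x => x y; rewrite cone_dE2 !sE [RHS]linearD [in RHS]aC -a'C linearN linearD.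
  zabel.
pose t (n : int) : vi_nat (ind false j C n) (cone F n) := nt_pair (r1 n) (r2 n).
have tE (n : int) W x : t n W x = (r1 n W x, r2 n W x) by [].
have tC (n : int) W x : t (n - 1) W (cx_d (ind false j C) n W x) = cx_d (cone F) n W (t n W x).
  apply: (ind_ext (f := t (n - 1) W \o cx_d (ind false j C) n W)
    (g := cx_d (cone F) n W \o t n W)) => f z.
  rewrite -[LHS]/(t (n - 1) W (cx_d (ind false j C) n W (igen false C n f z))).
  rewrite -[RHS]/(cx_d (cone F) n W (t n W (igen false C n f z))).
  rewrite ind_dE !tE !Hr1 !Hr2 cone_dE2 !ind_dE ind_mapE -linearN -linearD.
  by case: z => z z'; rewrite cone_dE2.
apply: (dretract_strict (a := mkc sC) (r := mkc tC)); apply: htp_ext => n W [x y].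
rewrite -[LHS]/(t n W (s n W (x, y))) sE tE !linearD /=.
have E1 u : r1 n W (a n W u) = u.
  by apply: (ind_ext (f := r1 n W \o a n W) (g := idfun)) => f z; rewrite /= Ha Hr1.
have E2 u : r2 n W (a n W u) = 0.
  by apply: (ind_ext (f := r2 n W \o a n W) (g := \0)) => f z; rewrite /= Ha Hr2 linear0.
have E3 u : r1 n W (a' n W u) = 0.
  by apply: (ind_ext (f := r1 n W \o a' n W) (g := \0)) => f z; rewrite /= Ha' Hr1 linear0.
have E4 u : r2 n W (a' n W u) = u.
  by apply: (ind_ext (f := r2 n W \o a' n W) (g := idfun)) => f z; rewrite /= Ha' Hr2.
by rewrite E1 E2 E3 E4 addr0 add0r.
Qed.

Lemma ind_compact Z : compact Z -> compact (ind false j Z).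
Proof.
move=> cZ; have [Z' [r [kZ qr]]] := resolution char0 Z.
have cZ' : compact Z' := compact_diso (diso_qi qr) cZ.
apply: (compactI char0 (r := ind_map false r) (ind_kproj (Z:=Z'))).
  by apply/qiaP => V; apply: ind_map_qia; move/qiaP: qr; apply.
by move=> I N g; apply: ind_hom_fin.
Qed.

Section Free.
Variables (T : cplx p k -> Prop) (HT : thick T) (TP : forall i, T (P j i)).

(* The direct sum of one cell for each cycle [z] of [Z] at level [j] maps onto
   [ind false j Z]; a generalized inverse of the differential gives a section up
   to homotopy, and compactness leaves finitely many cells. *)
Lemma th_ind Z : compact Z -> T (ind false j Z).
Proof.
move=> /ind_compact cF.
pose Cy (n : int) := {z : Z n Vj | cx_d Z n Vj z = 0}.
pose I := {classic {n : int & Cy n}}.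
pose dg (m : I) : int := tag (m : {n : int & Cy n}).
pose Y (m : I) : cplx p k := P j (dg m).
have /dchoice[b Hb] : forall m : I, exists b : chain_map (Y m) (ind false j Z),
    forall (n : int) V (e : n = dg m) h, b n V (cg k e h) = tr (ind false j Z) (esym e) V
      (act _ (h : vinj Vj V) (igen false Z (dg m) (iid Vj) (sval (tagged (m : {n : int & Cy n}))))).
  by move=> [n [z dz]]; apply: yoneda; rewrite ind_dE dz linear0.
pose bb := dsc_lift b.
pose Fr (n : int) : lmodType k := pres (S := Cy n) (fun W f => True).
have /dchoice[ev Hev] : forall n : int, exists ev : {linear Fr n -> Z n Vj},
    forall c : Cy n, ev (pgen _ c) = sval c.
  by move=> n; exists (plift (resp := fun W f => True) (phi := fun c : Cy n => sval c) Logic.I)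
      => c; rewrite plift_gen.
have /dchoice[io Hio] : forall n : int, exists io : {linear Fr n -> dsc Y n Vj},
    forall c : Cy n, io (pgen _ c) = dsc_in Y (existT Cy n c) n Vj (cgid p k j n).
  move=> n; exists (plift (resp := fun W f => True) (phi := fun c : Cy n =>
    dsc_in Y (existT Cy n c) n Vj (cgid p k j n)) Logic.I) => c; by rewrite plift_gen.
have bio (n : int) c : bb n Vj (io n c) = igen false Z n (iid Vj) (ev n c).
  apply: (pres_ext (f := bb n Vj \o io n) (g := igen false Z n (iid Vj) \o ev n)) => c'.
  rewrite [LHS]/= [RHS]/= Hio Hev /bb dsc_liftE /cgid Hb tr_id.
  exact: (act1 (A := ind false j Z n)).
have /dchoice[s Hs] := fun n : int => generalized_inverse (cx_d Z n Vj).
have sgL (n : int) : linear (fun u : (Fr (n - 1) * Z n Vj)%type => ev (n - 1) u.1 + cx_d Z n Vj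
    u.2).
  by move=> c x y; rewrite !linearP /= scalerDr addrACA.
have /dchoice[sg Hsg] := fun n : int => generalized_inverse (mkl (sgL n)).
have fL (n : int) : linear (fun u : (Fr (n - 1) * Z n Vj)%type => u.1) by [].
(* [w1] projects onto cycles and [w2] kills boundaries. Hence [ga] vanishes on boundaries, and to a
   cycle it assigns a combination of generators representing the same homology class. *)
pose w1 (n : int) : {linear Z (n - 1) Vj -> Z (n - 1) Vj} :=
  idfun \- (s (n - 1) \o cx_d Z (n - 1) Vj).
pose w2 (n : int) : {linear Z (n - 1) Vj -> Z (n - 1) Vj} := idfun \- (cx_d Z n Vj \o s n).
have w1E (n : int) z : w1 n z = z - s (n - 1) (cx_d Z (n - 1) Vj z) by [].
have w2E (n : int) z : w2 n z = z - cx_d Z n Vj (s n z) by [].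
pose ga0 (n : int) : {linear Z (n - 1) Vj -> Fr (n - 1)} := mkl (fL n) \o sg n \o w2 n \o w1 n.
have ga0E (n : int) z : ga0 n z = (sg n (w2 n (w1 n z))).1 by [].
have [ga Hga] := reindex_pred (P := fun m => {linear Z m Vj -> Fr m}) ga0.
have gaE (n : int) z : ga (n - 1) z = ga0 n z by rewrite Hga.
have ga_d (n : int) z : ga (n - 1) (cx_d Z n Vj z) = 0.
  by rewrite gaE ga0E w1E cx_dd linear0 subr0 w2E Hs subrr linear0.
have ga_sd (n : int) z : ga (n - 1) (s (n - 1) (cx_d Z (n - 1) Vj z)) = 0.
  by rewrite gaE ga0E w1E Hs subrr !linear0.
have ga_cy (n : int) z : cx_d Z (n - 1) Vj z = 0 ->
    boundary (z - ev (n - 1) (ga (n - 1) z)).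
  move=> dz; rewrite gaE ga0E w1E dz linear0 subr0 w2E.
  set w := z - cx_d Z n Vj (s n z).
  have dw : cx_d Z (n - 1) Vj w = 0 by rewrite /w linearB dz cx_dd subrr.
  (* [w] is itself a cycle, hence a generator, so it lies in the image of [sgL], where the
     generalized inverse is a true section. *)
  have E : ev (n - 1) (sg n w).1 + cx_d Z n Vj (sg n w).2 = w.
    have sgE u : mkl (sgL n) u = ev (n - 1) u.1 + cx_d Z n Vj u.2 by [].
    have := Hsg n (pgen _ (exist (fun z => cx_d Z (n - 1) Vj z = 0) w dw), 0).
    by rewrite !sgE Hev linear0 addr0.
  exists (s n z + (sg n w).2); rewrite linearD.
  apply: (addrI (ev (n - 1) (sg n w).1)); rewrite addrCA E /w; zabel.
have aC (n : int) z : (io (n - 1) \o ga (n - 1)) (cx_d Z n Vj z) = cx_d (dsc Y) n Vj ((io n \o ga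
    n) z).
  rewrite /= ga_d linear0; apply/esym.
  apply: (dsc_ext (f := cx_d (dsc Y) n Vj) (g := \0)) => i x.
  by rewrite dsc_dE cell_d linear0.
have [a Ha] := @ind_lift p k false j Z (dsc Y) (fun n => io n \o ga n) ltac:(by []) aC.
have H1 : htp (cm_comp bb a) (cm_id _).
  apply: htp_sym; pose et (n : int) : {linear Z (n - 1) Vj -> Z n Vj} :=
    s n \o (idfun \- (ev (n - 1) \o ga (n - 1))) \o w1 n.
  have etE (n : int) z : et n z = s n (w1 n z - ev (n - 1) (ga (n - 1) (w1 n z))) by [].
  have et_d (n : int) z : cx_d Z n Vj (et n z) + et (n - 1) (cx_d Z (n - 1) Vj z) =
      z - ev (n - 1) (ga (n - 1) z).
    rewrite [et (n - 1) _]etE w1E cx_dd linear0 subr0 ga_d linear0 subr0 etE.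
    have dw : cx_d Z (n - 1) Vj (w1 n z) = 0 by rewrite w1E linearB Hs subrr.
    have [u Hu] := ga_cy n (w1 n z) dw; rewrite -Hu Hs Hu w1E.
    rewrite linearB ga_sd subr0; zabel.
  have /dchoice[h Hh] : forall n : int, exists h : vi_nat (ind false j Z (n - 1)) (ind false j Z n),
      forall V f z, h V (igen false Z (n - 1) f z) = igen false Z n f (et n z).
    move=> n; have [|h Hh] := @ind_nt_lift p k false j Z (n - 1) (ind false j Z n)
      (igen false Z n (iid Vj) \o et n) => //.
    by exists h => W f z; rewrite Hh [X in act _ f X]/= act_igen icompf1.
  exists h => n V x; set D := cm_sub _ _.
  apply: (ind_ext (f := D (n - 1) V) (g := (cx_d (ind false j Z) n V \o h n V) \+
    (h (n - 1) V \o cx_d (ind false j Z) (n - 1) V))) => f z.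
  rewrite -[RHS]/(cx_d (ind false j Z) n V (h n V (igen false Z (n - 1) f z)) +
    h (n - 1) V (cx_d (ind false j Z) (n - 1) V (igen false Z (n - 1) f z))).
  rewrite ind_dE !Hh ind_dE -linearD et_d linearB.
  rewrite -[LHS]/(igen false Z (n - 1) f z - bb (n - 1) V (a (n - 1) V (igen false Z (n - 1) f z))).
  by congr (_ - _); rewrite Ha [X in act _ f X]/= nt_act bio act_igen icompf1.
have [S [c [us Hc]]] := compact_fin char0 cF (ind_kproj (b := false) (Z := Z)) (qi_id _) (cm_comp
    a (cm_id _)).
apply: (th_sum HT (s := S) (Y := Y) (a := c) (b := b)) => [i|]; first exact: TP.
apply: htp_trans H1; apply: htp_sym.
apply: htp_trans (htp_compl bb Hc) _; apply: htp_ext => n V x.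
rewrite csum_comp !csumE; apply: eq_bigr => i _.
by rewrite -[LHS]/(bb n V (dsc_in Y i n V (c i n V x))) /bb dsc_liftE.
Qed.

End Free.
(** In characteristic zero coinvariants embed as invariants: the generator at z goes to the average
    over GL_j of the terms g^-1 (x) g z, and the quotient map retracts this. *)
Lemma ind_avg_retract Z : dretract (ind true j Z) (ind false j Z).
Proof.
pose av (n : int) : {linear Z n Vj -> ind false j Z n Vj} :=
  mkl (average_linear (A := Z n) (B := ind false j Z n) (igen false Z n (iid Vj))).
have avE (n : int) z : av n z = average (A := Z n) (B := ind false j Z n) (igen false Z n (iid
    Vj)) z by [].
have [a Ha] : exists F : chain_map (ind true j Z) (ind false j Z), forall (n : int) V f z,
    F n V (igen true Z n f z) = act (ind false j Z n) f (av n z).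
  apply: ind_lift => [_ n g z|n z]; first by rewrite !avE average_equiv.
  rewrite !avE /average [RHS]linearZ_LR [X in _ = _ *: X]linear_sum; congr (_ *: _);
      apply: eq_bigr => g _.
  by rewrite [in RHS]nt_act ind_dE nt_act.
have [r Hr] : exists F : chain_map (ind false j Z) (ind true j Z), forall (n : int) V f z,
    F n V (igen false Z n f z) = act (ind true j Z n) f (igen true Z n (iid Vj) z).
  by apply: (ind_lift (b := false)) => // n z; rewrite ind_dE.
apply: (dretract_strict (a := a) (r := r)); apply: htp_ext => n V x.
apply: (ind_ext (f := r n V \o a n V) (g := idfun)) => f z.
rewrite [LHS]/= Ha nt_act.
have -> : r n Vj (av n z) = igen true Z n (iid Vj) z.
  rewrite avE /average [LHS]linearZ_LR [X in _ *: X = _]linear_sum.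
  rewrite -[RHS](average_fix char0 (A := Z n) (B := ind true j Z n) (s := igen true Z n (iid Vj))
      (x := z)).
    rewrite /average; congr (_ *: _); apply: eq_bigr => g _.
    by rewrite nt_act Hr act1.
  move=> g; rewrite -igen_act // act_igen icomp1f icompVf.
  by [].
by rewrite act_igen icompf1.
Qed.

Lemma th_indG (T : cplx p k -> Prop) b Z : thick T -> (forall i, T (P j i)) ->
  compact Z -> T (ind b j Z).
Proof.
move=> HT TP cZ; case: b; last exact: th_ind.
exact: (th_retract HT (ind_avg_retract Z)) (th_ind HT TP cZ).
Qed.

End Ind.

Lemma Lam_compact j Z : compact Z -> compact (Lam j Z).
Proof.
move=> cZ; have cG := th_indG true (compact_thick p char0) (compact_P char0 j) cZ.
exact: (compact_cone char0 _ cG cZ).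
Qed.

Lemma Lt_compact X e : compact X -> compact (Lt X e).
Proof. by move=> cX; elim: e => [|e IH]; [exact: cX | exact: (@Lam_compact e _ IH)]. Qed.

(** If Z is already acyclic at level j, the complex induced from it is acyclic at every level, so
    coning it off destroys no acyclicity. *)
Lemma Lam_acy j Z V : acy Z (Vn j) -> acy Z V -> acy (Lam j Z) V.
Proof. by move=> aj aV; apply: acy_cone_of => //; apply: ind_acy. Qed.

Lemma Lam_acy_small j Z V : (\dim {:V} < j)%N -> acy Z V -> acy (Lam j Z) V.
Proof. by move=> lt aV; apply: acy_cone_of => //; apply: ind_small_acy. Qed.

Lemma Lt_acy_small X (M e : nat) V : (forall V, (\dim {:V} < M)%N -> acy X V) ->
  (\dim {:V} < M)%N -> acy (Lt X e) V.
Proof.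
move=> aX; elim: e V => [|e IH] V lt; first exact: aX.
have [eM|Me] := ltnP e M.
  by apply: Lam_acy; apply: IH => //; rewrite dim_rV.
by apply: Lam_acy_small; [apply: leq_trans lt Me | apply: IH].
Qed.

(* The telescope of the tower [Lt X] is acyclic, so by compactness [lt_in X e]
   vanishes in the derived category for some [e]; then [Lt X e] is a retract of
   [Rt X e], which has no nonzero maps to it. *)
Lemma Lt_stop X : compact X -> exists e, forall V, acy (Lt X e) V.
Proof.
move=> cX; pose L := Lt X; pose sg e : chain_map (L e) (L e.+1) := lam_in e (L e).
have qt : quasi_iso (tone sg).
  apply/qiaP => V; apply: (@tel_acy p k L sg V (\dim {:V}).+1) => e lt.
  exact: Lt_acy.
have [H _] := cX _ L _ _ (dsc_coproduct char0 (N := L)).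
have [s [h [us Hs]]] := H (dinv qt ** dmap (dsc_in L 0%N)).
(* The component at stage e of the preimage, under 1 minus the shift, of the inclusion of stage 0.
   The equation for the preimage gives v 0 = id and v (e+1) = sg e v e, so these are the maps of the
   tower. *)
pose v e := dmap (dsc_proj L e) ** (dinv qt ** dmap (dsc_in L 0%N)).
have ve e : v e ~~ dmap (lt_in X e).
  elim: e => [|e IH].
    have E : dmap (dsc_proj L 0%N) ~~ dmap (dsc_proj L 0%N) ** dmap (tone sg).
      rewrite -dmap_comp; apply: dmap_ext => n V x.
      apply: (dsc_ext (f := dsc_proj L 0%N n V) (g := dsc_proj L 0%N n V \o tone sg n V)) => e y.
      by rewrite -[RHS]/(dsc_proj L 0%N n V (tone sg n V (dsc_in L e n V y))) toneE tshE linearB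
          (@dsc_proj_ne p k _ L e.+1 0%N) // subr0.
    rewrite /v E -dcompA (dcompA (dmap (tone sg))) dinvK dcomp1l -dmap_comp.
    by apply: dmap_ext => n V x; rewrite [LHS]/= dsc_proj_in.
  have E : dmap (dsc_proj L e.+1) ~~ dadd (dmap (dsc_proj L e.+1) ** dmap (tone sg))
      (dmap (sg e) ** dmap (dsc_proj L e)).
    rewrite -!dmap_comp -dmap_add; apply: dmap_ext => n V x.
    apply: (dsc_ext (f := dsc_proj L e.+1 n V) (g := (dsc_proj L e.+1 n V \o tone sg n V) \+
      (sg e n V \o dsc_proj L e n V))) => e' y.
    rewrite -[RHS]/(dsc_proj L e.+1 n V (tone sg n V (dsc_in L e' n V y)) +
      sg e n V (dsc_proj L e n V (dsc_in L e' n V y))) toneE tshE linearB.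
    have [<-|ne] := eqVneq e' e; first by rewrite !dsc_proj_in addrNK.
    by rewrite (@dsc_proj_ne p k _ L e'.+1 e.+1) ?(dsc_proj_ne _ ne) // !linear0 !addr0.
  rewrite /v E dcompDl -!dcompA -/(v e) IH (dcompA (dmap (tone sg))) dinvK dcomp1l -!dmap_comp
      -dmap_add.
  apply: dmap_ext => n V x;
      rewrite -[LHS]/(dsc_proj L e.+1 n V (dsc_in L 0%N n V x) + sg e n V (lt_in X e n V x)).
  by rewrite dsc_proj_ne // add0r.
(* Compactness confines the preimage to the finite set s; the first stage beyond s has component
   zero. *)
pose e := (\max_(i <- s) i).+1.
have es : e \notin s.
  apply/negP => ie; have := @leq_bigmax_seq _ s xpredT (fun i => i) e ie isT.
  by rewrite /= /e ltnn.
have z0 : dmap (lt_in X e) ~~ dzero X (Lt X e).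
  rewrite -ve /v -Hs dsum_compl; apply: dsum_zero => i is0.
  rewrite dcompA -dmap_comp (dmap_zero (f := cm_comp _ _)) ?dcomp0l // => n V x.
  by rewrite [LHS]/= dsc_proj_ne //; apply: contraNneq es => <-.
have [|c Hc] := triangle_left char0 (f := lt_in X e) (u := did (Lt X e)).
  by rewrite dcomp1l.
exists e => V; apply: zero_acy; rewrite -Hc.
have [c' Hc'] := d_liftP c (Rt_kproj char0 (X := X) (e := e)).
rewrite Hc' (dmap_null (f := c')) ?dcomp0l //.
by apply: (Rt_kp char0) => W; apply: Lt_acy.
Qed.

(** Descends from the acyclic stage of the tower. Each stage is recovered from the next one and the
    complex induced from its level, which is acyclic when that level is below M and is built from
    cells in T otherwise. *)
Lemma th_structure (T : cplx p k -> Prop) (M : nat) X : thick T -> compact X ->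
  (forall V, (\dim {:V} < M)%N -> acy X V) ->
  (forall r i, (M <= r)%N -> T (P r i)) -> T X.
Proof.
move=> HT cX aX TP; have [e ae] := Lt_stop cX.
suff H d : (d <= e)%N -> T (Lt X (e - d)) by have := H e (leqnn e); rewrite subnn.
elim: d => [_|d IH lt]; first by rewrite subn0; apply: (th_acy HT).
have E : (e - d = (e - d.+1).+1)%N by rewrite subnSK.
have := IH (ltnW lt); rewrite E => TL.
apply: (th_mid HT) TL; have [small|big] := ltnP (e - d.+1) M.
  apply: (th_acy HT) => V; apply: ind_acy => //; apply: (Lt_acy_small aX).
  by rewrite dim_rV.
by apply: th_indG => // [i|]; [apply: TP | apply: Lt_compact].
Qed.

End Structure.

(** * Tensor products *)

Section Tensor.
Variables (p : nat) (k : fieldType).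
Local Notation VS := (vectType 'F_p).

Lemma te1 (i j n : int) : i + j = n -> i - 1 + j = n - 1.
Proof. by move=> <-; rewrite addrAC. Qed.
Lemma te2 (i j n : int) : i + j = n -> i + (j - 1) = n - 1.
Proof. by move=> <-; rewrite addrA. Qed.
Lemma te1V (i j n : int) : i - 1 + j = n - 1 -> i + j = n.
Proof. by rewrite addrAC => /addIr. Qed.
Lemma sgP (R : pzRingType) (i : int) : (-1) ^+ `|(i - 1)%R|%N = - (-1) ^+ `|i|%N :> R.
Proof.
case: i => [[|n]|n].
- by rewrite add0r abszN expr1 expr0.
- by rewrite -addn1 PoszD addrK /= addn1 exprS mulN1r opprK.
- by rewrite NegzE -opprD !abszN -PoszD /= addn1 [LHS]exprS mulN1r.
Qed.

Section Tens.
Variables X Y : cplx p k.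
Implicit Types (V : VS).

Definition tgs (n : int) V :=
  {i : int & {j : int & (((i + j)%R = n) * (X i V * Y j V))%type}}.
Definition tmk (n : int) V (i j : int) (e : i + j = n) (x : X i V) (y : Y j V) : tgs n V :=
  existT _ i (existT _ j (e, (x, y))).
Definition t_resp (n : int) V (W : lmodType k) (phi : tgs n V -> W) : Prop :=
  forall i j e, bilinear_map (fun x y => phi (tmk (n := n) (V := V) (i := i) (j := j) e x y)).

Definition t_gfun (n : int) : gfun p k.
Proof.
refine (@GFun p k (tgs n) (fun U V f s =>
  tmk (tagged (tagged s)).1 (act (X (tag s)) f (tagged (tagged s)).2.1)
   (act (Y (tag (tagged s))) f (tagged (tagged s)).2.2)) (@t_resp n) _ _ _ _).
- by move=> U [i [j [e [x y]]]] /=; rewrite !act1.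
- by move=> U V W g f [i [j [e [x y]]]] /=; rewrite (actM g f x) (actM g f y).
- move=> U V f W phi H i j e; have [H1 H2] := H i j e; split=> z c a b /=.
    by rewrite linearP H1.
  by rewrite linearP H2.
- move=> V i j e; split=> z c a b; apply: pres_sep => W phi H; have [H1 H2] := H i j e;
    by rewrite !linearP /= !plift_gen ?H1 ?H2.
Defined.

Definition tensm (n : int) : vi_mod p k := pmod (t_gfun n).
Definition tg V (i j n : int) (e : i + j = n) (x : X i V) (y : Y j V) : tensm n V :=
  @pg p k (t_gfun n) V (tmk e x y).
Lemma tg_irr V (i j n : int) (e e' : i + j = n) (x : X i V) (y : Y j V) : tg e x y = tg e' x y.
Proof. by rewrite (eq_irrelevance e e'). Qed.
Lemma tg_bil V (i j n : int) (e : i + j = n) : bilinear_map (tg (V := V) e).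
Proof. exact: (gen_resp (t_gfun n) V). Qed.
Definition tgl V (i j n : int) (e : i + j = n) (y : Y j V) : {linear X i V -> tensm n V} :=
  mkl ((tg_bil V e).1 y).
Definition tgr V (i j n : int) (e : i + j = n) (x : X i V) : {linear Y j V -> tensm n V} :=
  mkl ((tg_bil V e).2 x).
Lemma act_tg U V (f : vinj U V) (i j n : int) (e : i + j = n) x y :
  act (tensm n) f (tg e x y) = tg e (act (X i) f x) (act (Y j) f y).
Proof. exact: (act_pg (F := t_gfun n)). Qed.
Lemma tens_lin (n : int) V (W : lmodType k) (b : forall i j : int, i + j = n -> X i V -> Y j V ->
    W) :
  (forall i j e, bilinear_map (b i j e)) ->
  {F : {linear tensm n V -> W} | forall i j e x y, F (tg e x y) = b i j e x y}.
Proof.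
move=> H; pose phi (s : t_gfun n V) := b (tag s) (tag (tagged s)) (tagged (tagged s)).1
  (tagged (tagged s)).2.1 (tagged (tagged s)).2.2.
have r : gr phi by move=> i j e; exact: H.
by exists (plift r) => i j e x y; rewrite plift_gen.
Qed.
Lemma tens_ext (n : int) V (W : lmodType k) (f g : {linear tensm n V -> W}) :
  (forall i j e x y, f (@tg V i j n e x y) = g (tg e x y)) -> f =1 g.
Proof. by move=> H; apply: (@pmod_lin_ext p k (t_gfun n)) => -[i [j [e [x y]]]]; apply: H. Qed.
Lemma tens_nt (n : int) (A : vi_mod p k)
    (b : forall V (i j : int), i + j = n -> X i V -> Y j V -> A V) :
  (forall V i j e, bilinear_map (b V i j e)) ->
  (forall U V (f : vinj U V) i j e x y,
     b V i j e (act (X i) f x) (act (Y j) f y) = act A f (b U i j e x y)) ->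
  {F : vi_nat (tensm n) A | forall V i j e x y, F V (tg e x y) = b V i j e x y}.
Proof.
move=> H N; have /cid[F HF] := dchoice (fun V => (let: exist F E := tens_lin (H V) in
   ex_intro _ F E : exists F : {linear tensm n V -> A V}, forall i j e x y, F (tg e x y) = b V i
       j e x y)).
have C U V (f : vinj U V) x : F V (act (tensm n) f x) = act A f (F U x).
  apply: (tens_ext (f := F V \o act (tensm n) f) (g := act A f \o F U)) => i j e a c.
  by rewrite [LHS]/= act_tg HF N -HF.
by exists (mkn C).
Qed.

Definition td_b (n : int) V (i j : int) (e : i + j = n) (x : X i V) (y : Y j V) : tensm (n - 1) V :=
  tg (te1 e) (cx_d X i V x) y + (-1) ^+ `|i|%N *: tg (te2 e) x (cx_d Y j V y).
Lemma td_bil (n : int) V (i j : int) (e : i + j = n) : bilinear_map (td_b (V := V) e).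
Proof.
split=> z c a b; rewrite /td_b.
  rewrite linearP ((tg_bil V (te1 e)).1 z) ((tg_bil V (te2 e)).1 _).
  by rewrite scalerDr scalerA mulrC -scalerA addrACA scalerDr.
rewrite linearP ((tg_bil V (te1 e)).2 _) ((tg_bil V (te2 e)).2 _).
by rewrite scalerDr scalerA mulrC -scalerA addrACA scalerDr.
Qed.
Lemma td_ex (n : int) : {F : vi_nat (tensm n) (tensm (n - 1)) |
  forall V i j e x y, F V (tg e x y) = @td_b n V i j e x y}.
Proof.
apply: tens_nt => [V i j e|U V f i j e x y]; first exact: td_bil.
by rewrite /td_b linearD linearZ /= !act_tg !nt_act.
Qed.
Definition td (n : int) := sval (td_ex n).
Lemma tdE (n : int) V i j e x y : td n V (tg e x y) = @td_b n V i j e x y.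
Proof. exact: (svalP (td_ex n)). Qed.
Lemma tg0l V (i j n : int) (e : i + j = n) y : tg e (0 : X i V) y = 0.
Proof. exact: (linear0 (tgl e y)). Qed.
Lemma tg0r V (i j n : int) (e : i + j = n) x : tg e x (0 : Y j V) = 0.
Proof. exact: (linear0 (tgr e x)). Qed.

Definition tens : cplx p k.
Proof.
refine (@Cplx p k tensm td _) => n V x.
apply: (tens_ext (f := td (n - 1) V \o td n V) (g := \0)) => i j e a b.
rewrite [LHS]/= tdE /td_b linearD linearZ /= !tdE /td_b !cx_dd tg0l tg0r scaler0 add0r addr0.
by rewrite sgP scaleNr (tg_irr (te2 (te1 e)) (te1 (te2 e))) addNr.
Defined.

Lemma tens_dE (n : int) V i j (e : i + j = n) (x : X i V) (y : Y j V) :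
  cx_d tens n V (tg e x y) =
  tg (te1 e) (cx_d X i V x) y + (-1) ^+ `|i|%N *: tg (te2 e) x (cx_d Y j V y).
Proof. exact: tdE. Qed.

Lemma tens_is_tensor : is_tensor X Y tens.
Proof.
exists (fun V i j n e x y => tg e x y); split.
- by move=> V i j n e; apply: tg_bil.
- move=> V n W b H; have [F HF] := tens_lin H; exists F; split=> // psi Hpsi.
  by apply: tens_ext => i j e x y; rewrite HF Hpsi.
- move=> V i j n e e1 e2 x y.
  by rewrite tens_dE (tg_irr e1 (te1 e)) (tg_irr e2 (te2 e)).
- move=> U V f fi i j n e x y; apply: (etrans (vi_mapE (A := tensm n) fi _)); rewrite act_tg.
  by congr (tg _ _ _); apply/esym/vi_mapE.
Qed.

Lemma tens_lift (C : cplx p k)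
    (b : forall V (i j n : int), i + j = n -> X i V -> Y j V -> C n V) :
  (forall V i j n e, bilinear_map (b V i j n e)) ->
  (forall U V (f : vinj U V) i j n e x y,
     b V i j n e (act (X i) f x) (act (Y j) f y) = act (C n) f (b U i j n e x y)) ->
  (forall V i j n (e : i + j = n) x y, cx_d C n V (b V i j n e x y) =
     b V (i - 1) j (n - 1) (te1 e) (cx_d X i V x) y +
     (-1) ^+ `|i|%N *: b V i (j - 1) (n - 1) (te2 e) x (cx_d Y j V y)) ->
  exists F : chain_map tens C, forall V i j n e x y, F n V (tg e x y) = b V i j n e x y.
Proof.
move=> H N D; pose G (n : int) := tens_nt (fun V i j e => H V i j n e) (fun U V f i j e => N U V
    f i j n e).
pose F (n : int) : vi_nat (tensm n) (C n) := sval (G n).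
have HF (n : int) V i j e x y : F n V (tg e x y) = b V i j n e x y by exact: (svalP (G n)).
have Cm (n : int) V x : F (n - 1) V (cx_d tens n V x) = cx_d C n V (F n V x).
  apply: (tens_ext (f := F (n - 1) V \o cx_d tens n V) (g := cx_d C n V \o F n V)) => i j e a c.
  rewrite -[LHS]/(F (n - 1) V (cx_d tens n V (tg e a c))) -[RHS]/(cx_d C n V (F n V (tg e a c))).
  by rewrite tens_dE linearD linearZ /= !HF D.
exists (mkc Cm) => V i j n; exact: HF.
Qed.

Lemma is_tensor_diso T : is_tensor X Y T -> diso T tens.
Proof.
move=> [t [tb tu td' tn]]; apply: diso_sym.
have [|U V f i j n e x y|V i j n e x y|F HF] := @tens_lift T (fun V i j n e => t V i j n e).
- exact: tb.
- by rewrite /act -tn.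
- exact: td'.
apply: diso_qi; apply/qiaP => V.
have /dchoice[G HG] : forall n : int, exists G : {linear T n V -> tens n V},
    forall i j e x y, G (t V i j n e x y) = tg e x y.
  move=> n; have [G [HG _]] := tu V n (tens n V) (fun i j e => tg e) (fun i j e => tg_bil V e).
  by exists G.
apply: (@qia_bij p k _ _ F V G) => n x.
  apply: (tens_ext (f := G n \o F n V) (g := idfun)) => i j e a c.
  by rewrite [LHS]/= HF HG.
have [phi [_ Hphi]] := tu V n (T n V) (fun i j e => t V i j n e) (fun i j e => tb V i j n e).
rewrite -[LHS]/((F n V \o G n) x) (Hphi (F n V \o G n)) => [|i j e a c]; last by rewrite /= HG HF.
by rewrite -(Hphi idfun).
Qed.

End Tens.
End Tensor.

(** * Functoriality and exactness of the tensor product *)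

Section TensorMap.
Variables (p : nat) (k : fieldType).
Hypothesis char0 : [pchar k]%R =i pred0.
Local Notation VS := (vectType 'F_p).
Implicit Types (V : VS) (X Y T : cplx p k).

Section Map.
Variable Y : cplx p k.
Local Notation tY X := (tens X Y).

Lemma tmap_ex X X' (f : chain_map X X') : {F : chain_map (tY X) (tY X') |
  forall V i j n (e : i + j = n) x y, F n V (tg e x y) = tg e (f i V x) y}.
Proof.
apply: cid; apply: (@tens_lift p k X Y (tY X') (fun V i j n e x y => tg e (f i V x) y)).
- move=> V i j n e; split=> z c a b; last exact: (tg_bil X' Y V e).2.
  by rewrite linearP; apply: (tg_bil X' Y V e).1.
- by move=> U V g i j n e x y; rewrite act_tg nt_act.
- by move=> V i j n e x y; rewrite tens_dE cm_comm.
Qed.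
Definition tmap X X' (f : chain_map X X') := sval (tmap_ex f).
Lemma tmapE X X' (f : chain_map X X') V i j n (e : i + j = n) x y :
  tmap f n V (tg e x y) = tg e (f i V x) y.
Proof. exact: (svalP (tmap_ex f)). Qed.

Lemma tens_ceq X C (F G : chain_map (tY X) C) :
  (forall V i j n (e : i + j = n) x y, F n V (tg e x y) = G n V (tg e x y)) -> ceq F G.
Proof. by move=> H n V; apply: tens_ext => i j e x y; apply: H. Qed.

Lemma tmap_id X : ceq (tmap (cm_id X)) (cm_id (tY X)).
Proof. by apply: tens_ceq => V i j n e x y; rewrite tmapE. Qed.
Lemma tmap_comp X X' X'' (f : chain_map X X') (g : chain_map X' X'') :
  ceq (tmap (cm_comp g f)) (cm_comp (tmap g) (tmap f)).
Proof.
apply: tens_ceq => V i j n e x y.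
by rewrite -[RHS]/(tmap g n V (tmap f n V (tg e x y))) !tmapE.
Qed.
Lemma tmap_sub X X' (f g : chain_map X X') :
  ceq (tmap (cm_sub f g)) (cm_sub (tmap f) (tmap g)).
Proof.
apply: tens_ceq => V i j n e x y.
rewrite -[RHS]/(tmap f n V (tg e x y) - tmap g n V (tg e x y)) !tmapE.
exact: (linearB (tgl X' e y) (f i V x) (g i V x)).
Qed.

(** Formulated at a single V, without naturality of h, so that it serves for natural homotopies and
    also for a contraction at one level, which need not be natural. *)
Lemma tens_h_ex X X' V (h : forall n : int, {linear X (n - 1) V -> X' n V}) :
  {H : forall n : int, {linear tY X (n - 1) V -> tY X' n V} |
   forall (n i j : int) (e : i - 1 + j = n - 1) x y, H n (tg e x y) = tg (te1V e) (h i x) y}.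
Proof.
apply: cid; apply: (@dchoice _ (fun n : int => {linear tY X (n - 1) V -> tY X' n V}) (fun n H =>
  forall (i j : int) (e : i - 1 + j = n - 1) x y, H (tg e x y) = tg (te1V e) (h i x) y)) => n.
have [b Hb] := reindex_pred (P := fun i => forall j, i + j = n - 1 -> X i V -> Y j V -> tensm X'
    Y n V)
  (fun (i j : int) e x y => tg (te1V e) (h i x) y).
have bil i j e : bilinear_map (b i j e).
  elim/int_pred_ind: i j e => i j e; rewrite Hb; split=> z c a a'.
    by rewrite linearP; apply: (tg_bil X' Y V (te1V e)).1.
  exact: (tg_bil X' Y V (te1V e)).2.
have [F HF] := tens_lin bil.
by exists F => i j e x y; rewrite HF Hb.
Qed.
Definition tens_h X X' V h := sval (@tens_h_ex X X' V h).
Lemma tens_hE X X' V (h : forall n : int, {linear X (n - 1) V -> X' n V})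
   (n i j : int) (e : i - 1 + j = n - 1) (x : X (i - 1) V) (y : Y j V) :
   tens_h h n (tg e x y) = tg (te1V e) (h i x) y.
Proof. exact: (svalP (@tens_h_ex X X' V h)). Qed.

Lemma tens_h_eq X X' (f : chain_map X X') V (h : forall n : int, {linear X (n - 1) V -> X' n V}) :
  (forall (n : int) x, f (n - 1) V x = cx_d X' n V (h n x) + h (n - 1) (cx_d X (n - 1) V x)) ->
  forall (n : int) x, tmap f (n - 1) V x = cx_d (tY X') n V (tens_h h n x) +
    tens_h h (n - 1) (cx_d (tY X) (n - 1) V x).
Proof.
move=> H n; apply: (tens_ext (f := tmap f (n - 1) V)
  (g := (cx_d (tY X') n V \o tens_h h n) \+ (tens_h h (n - 1) \o cx_d (tY X) (n - 1) V))) => i.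
elim/int_pred_ind: i => i j e x y.
rewrite -[RHS]/(cx_d (tY X') n V (tens_h h n (tg e x y)) +
  tens_h h (n - 1) (cx_d (tY X) (n - 1) V (tg e x y))).
have E : tens_h h (n - 1) (cx_d (tY X) (n - 1) V (tg e x y)) =
    tg e (h (i - 1) (cx_d X (i - 1) V x)) y - (-1) ^+ `|i|%N *: tg (te2 (te1V e)) (h i x) (cx_d Y
        j V y).
  apply: (etrans (congr1 (tens_h h (n - 1)) (tens_dE e x y))); rewrite linearD linearZ_LR.
  rewrite (tens_hE h (te1 e) _ y) (tens_hE h (te2 e) x _) sgP scaleNr.
  by rewrite (tg_irr (te1V (te2 e)) (te2 (te1V e))) (tg_irr (te1V (te1 e)) e).
rewrite E (tens_hE h e x y) (tens_dE (te1V e) (h i x) y) (tmapE f e x y) H.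
rewrite (tg_irr (te1 (te1V e)) e) addrACA addrN addr0; exact: (linearD (tgl X' e y)).
Qed.

Lemma tmap_null X X' (f : chain_map X X') : nullh f -> nullh (tmap f).
Proof.
move=> [h Hh]; pose H V := tens_h (fun n : int => h n V : {linear X (n - 1) V -> X' n V}).
have N (n : int) U V (g : vinj U V) x : H V n (act (tY X (n - 1)) g x) = act (tY X' n) g (H U n x).
  apply: (tens_ext (f := H V n \o act (tY X (n - 1)) g) (g := act (tY X' n) g \o H U n)) => i.
  elim/int_pred_ind: i => i j e a b.
  apply: (etrans (congr1 (H V n) (act_tg g e a b))).
  apply: (etrans (tens_hE _ e _ _)).
  apply: (etrans _ (congr1 (act (tY X' n) g) (esym (tens_hE _ e a b)))).
  apply: (etrans _ (esym (act_tg g (te1V e) (h i U a) b))).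
  by have E := nt_act (h i) g a; rewrite -E.
by exists (fun n : int => mkn (N n)) => n V x; apply: (tens_h_eq (Hh^~ V)).
Qed.

Lemma tmap_htp X X' (f g : chain_map X X') : htp f g -> htp (tmap f) (tmap g).
Proof. by move=> /tmap_null; apply: nullh_ext; apply: tmap_sub. Qed.

Lemma tens_acy X V : acy X V -> acy (tY X) V.
Proof.
move=> /(equivariant_contraction char0)[h [hd _]] n z dz.
have H (m : int) x : cm_id X (m - 1) V x = cx_d X m V (h m x) + h (m - 1) (cx_d X (m - 1) V x).
  by rewrite hd.
have := tens_h_eq H z; rewrite (tmap_id z) dz linear0 addr0 => E.
by exists (tens_h h n z); rewrite -E.
Qed.

(** The summand X of the cone is placed one degree higher; the change of sign of (-1)^i from i - 1
    to i accounts for the minus sign in the differential of the cone. *)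
Lemma tens_cone X X' (f : chain_map X X') : is_tensor (cone f) Y (cone (tmap f)).
Proof.
exists (fun V i j n e x y => (tg (te1 e) x.1 y, tg e x.2 y)); split.
- move=> V i j n e; split=> [y c [a a'] [b b']|[a a'] c y y'].
    by congr (_, _); [exact: (tg_bil X Y V (te1 e)).1|exact: (tg_bil X' Y V e).1].
  by congr (_, _); [exact: (tg_bil X Y V (te1 e)).2|exact: (tg_bil X' Y V e).2].
- move=> V n W b Hb.
  have Hb2 i j e : bilinear_map (fun (x : X' i V) (y : Y j V) => b i j e (0, x) y).
    have [H1 H2] := Hb i j e; split=> [y c a a'|x c a a']; last exact: H2.
    by rewrite -H1; congr b; congr (_, _); rewrite /= scaler0 addr0.
  have [b1 Hb1] := reindex_pred (P := fun i => forall j, i + j = n - 1 -> X i V -> Y j V -> W)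
    (fun (i j : int) e x y => b i j (te1V e) (x, 0) y).
  have bil1 i j e : bilinear_map (b1 i j e).
    elim/int_pred_ind: i j e => i j e; rewrite Hb1; have [H1 H2] := Hb i j (te1V e).
    split=> [y c a a'|x c a a']; last exact: H2.
    by rewrite -H1; congr b; congr (_, _); rewrite /= scaler0 addr0.
  have [F1 HF1] := tens_lin bil1; have [F2 HF2] := tens_lin Hb2.
  have L : linear (fun u : cone (tmap f) n V => F1 u.1 + F2 u.2).
    by move=> c u v; rewrite !linearP /= scalerDr addrACA.
  exists (mkl L); split=> [i j e [x x'] y|psi Hpsi [u u']].
    rewrite /= HF1 HF2 Hb1 (eq_irrelevance (te1V (te1 e)) e).
    have [H1 _] := Hb i j e; have := H1 y 1 (x, 0) (0, x').
    rewrite !scale1r => <-; congr b; congr (_, _); rewrite /= ?scale1r ?add0r ?addr0 //.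
  have -> : (u, u') = ((u, 0) : cone (tmap f) n V) + (0, u').
    by congr (_, _); rewrite ?addr0 ?add0r.
  rewrite !linearD; congr (_ + _).
    have L1 : linear (fun u : tens X Y (n - 1) V => psi (u, 0)).
      by move=> c a b'; rewrite -linearP; congr (psi _); congr (_, _); rewrite /= scaler0 addr0.
    rewrite -[LHS]/(mkl L1 u) /= linear0 addr0.
    apply: (tens_ext (f := mkl L1) (g := F1)) => i; elim/int_pred_ind: i => i j e x y.
    rewrite HF1 Hb1 -(Hpsi i j (te1V e) (x, 0) y) /=; congr (psi (_, _)).
      exact: tg_irr.
    by rewrite tg0l.
  have L2 : linear (fun u : tens X' Y n V => psi (0, u)).
    by move=> c a b'; rewrite -linearP; congr (psi _); congr (_, _); rewrite /= scaler0 addr0.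
  rewrite -[LHS]/(mkl L2 u') /= linear0 add0r.
  apply: (tens_ext (f := mkl L2) (g := F2)) => i j e x y.
  by rewrite HF2 -(Hpsi i j e (0, x) y) /= tg0l.
- move=> V i j n e e1 e2 [x x'] y.
  rewrite -[LHS]/(- cx_d (tY X) (n - 1) V (tg (te1 e) x y),
    tmap f (n - 1) V (tg (te1 e) x y) + cx_d (tY X') n V (tg e x' y)).
  rewrite (tens_dE (te1 e) x y) (tens_dE e x' y) (tmapE f (te1 e) x y).
  congr (_, _).
    rewrite /= sgP scaleNr opprD opprK; congr (_ + _).
      rewrite (tg_irr (te1 (te1 e)) (te1 e1)); exact: esym (linearN (tgl _ _ _) _).
    by congr (_ *: _); apply: tg_irr.
  rewrite /= (tg_irr e1 (te1 e)) (tg_irr e2 (te2 e)) addrA; congr (_ + _).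
  exact: esym (linearD (tgl _ _ _) _ _).
- move=> U V g gi i j n e [x x'] y.
  have Ex : vi_map (cone f i) gi (x, x') = (act (X (i - 1)) (vinjOf gi) x, act (X' i) (vinjOf gi)
      x').
    exact: etrans (vi_mapE (A := cone f i) gi _) (act_sum _ _).
  rewrite Ex (vi_mapE gi y); apply: (etrans (vi_mapE (A := cone (tmap f) n) gi _)).
  by apply: (etrans (act_sum _ _)); congr (_, _); apply: act_tg.
Qed.

Lemma tmap_qia X X' (f : chain_map X X') V : qia f V -> qia (tmap f) V.
Proof.
move=> /acy_cone aC; apply: qia_cone; apply: acy_of_rV.
apply: (@acy_retract p k _ (tens (cone f) Y)).
  exact: diso_retract (is_tensor_diso (tens_cone f)).
by apply: tens_acy; apply: acy_iso aC; rewrite dim_rV.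
Qed.

End Map.
End TensorMap.

Section TensorSym.
Variables (p : nat) (k : fieldType).
Hypothesis char0 : [pchar k]%R =i pred0.
Local Notation VS := (vectType 'F_p).
Implicit Types (V : VS) (X Y T : cplx p k).

Lemma tcomm (i j n : int) : i + j = n -> j + i = n.
Proof. by rewrite addrC. Qed.

(** The exchange of factors in degrees i and j carries the Koszul sign (-1)^(ij), which makes it
    compatible with the differentials and is its own inverse. *)
Lemma is_tensor_sym X Y T : is_tensor X Y T -> is_tensor Y X T.
Proof.
move=> [t [tb tu td tn]].
pose sg (i j : int) : k := (-1) ^+ (`|i|%N * `|j|%N).
have sgK i j : sg i j * sg i j = 1 by rewrite /sg -expr2 sqrr_sign.
have sgC i j : sg i j = sg j i by rewrite /sg mulnC.
have sg1 (i j : int) : sg (i - 1) j = (-1) ^+ `|j|%N * sg i j.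
  by rewrite /sg exprM sgP -mulN1r exprMn -exprM.
exists (fun V j i n e y x => sg i j *: t V i j n (tcomm e) x y); split.
- move=> V j i n e; have [H1 H2] := tb V i j n (tcomm e).
  split=> [x c a b|y c a b]; first by rewrite H2 scalerDr !scalerA mulrC.
  by rewrite H1 scalerDr !scalerA mulrC.
- move=> V n W b Hb.
  have [|phi [Hp Up]] := tu V n W (fun i j e x y => sg i j *: b j i (tcomm e) y x).
    move=> i j e; have [H1 H2] := Hb j i (tcomm e).
    split=> [y c a a'|x c a a']; first by rewrite H2 scalerDr !scalerA mulrC.
    by rewrite H1 scalerDr !scalerA mulrC.
  exists phi; split=> [i j e x y|psi Hpsi].
    by rewrite linearZ /= Hp scalerA sgK scale1r; congr b; apply: eq_irrelevance.
  apply: Up => i j e x y; rewrite -Hpsi linearZ /= scalerA sgK scale1r.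
  by congr (psi (t _ _ _ _ _ _ _)); apply: eq_irrelevance.
- move=> V j i n e e1 e2 y x.
  rewrite linearZ /= (td V i j n (tcomm e) (tcomm e2) (tcomm e1)) scalerDr !scalerA.
  apply: (etrans (addrC _ _)); congr (_ + _); congr (_ *: _).
    rewrite [sg i (j - 1)]sgC sg1 mulrC [sg j i]sgC //.
  by rewrite sg1 mulrA -expr2 sqrr_sign mul1r.
- move=> U V f fi j i n e y x; rewrite -tn; exact: linearZ.
Qed.

Lemma th_tens (T : cplx p k -> Prop) Y : thick T ->
  thick (fun X => compact X /\ T (tens X Y)).
Proof.
move=> HT; split.
- by move=> X [].
- move=> X aX; split; first exact: compact_acy.
  by apply: (th_acy HT) => V; apply: tens_acy.
- move=> X X' f [cX TX] [cX' TX']; split; first exact: (compact_cone char0 f cX cX').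
  apply: (th_diso HT (diso_sym (is_tensor_diso (tens_cone Y f)))); exact: (th_cone HT).
- move=> X [/(compact_unshift char0) cX TX]; split; first exact: cX.
  (* The shift of X is replaced by the cone of a zero map to a contractible complex, because
     tensoring is known to commute with cones. *)
  pose Z := cone (cm_id X); have aZ V : acy Z V by apply/null_acy/cone_id_null.
  pose c := cm_zero X Z.
  have q : quasi_iso (tmap Y (cone_out c)).
    by apply/qiaP => V; apply: tmap_qia => //; apply: qia_cone_out.
  have T1 := th_diso HT (diso_qi q) TX.
  have T2 := th_diso HT (is_tensor_diso (tens_cone Y c)) T1.
  by apply: (th_fib HT) T2; apply: (th_acy HT) => V; apply: tens_acy.
- move=> X X' rX [cX' TX']; split; first exact: (compact_retract rX).
  (* The functor [tmap] applies to chain maps only, so the retract is first realized, up to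
     homotopy, between K-projective resolutions. *)
  have [G [r [kG qr]]] := resolution char0 X; have [G' [r' [kG' qr']]] := resolution char0 X'.
  have qt A B (f : chain_map A B) : quasi_iso f -> diso (tens A Y) (tens B Y).
    move=> /qiaP qf; apply: diso_qi; apply/qiaP => V; exact: (tmap_qia char0 Y (qf V)).
  have [i [s H]] : dretract G G'.
    apply: dretract_trans (diso_retract (diso_qi qr)) _.
    exact: dretract_trans rX (diso_retract (diso_sym (diso_qi qr'))).
  have [a Ha] := d_liftP i kG; have [b Hb] := d_liftP s kG'.
  have h : htp (cm_comp b a) (cm_id G) by apply: (d_faith kG); rewrite dmap_comp -Ha -Hb.
  apply: (th_retract HT) (th_diso HT (qt _ _ _ qr') TX').
  apply: dretract_trans (diso_retract (diso_sym (qt _ _ _ qr))) _.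
  apply: (dretract_strict (a := tmap Y a) (r := tmap Y b)).
  apply: (htp_trans (htp_sym (htp_ext (@tmap_comp _ _ Y _ _ _ a b)))).
  exact: htp_trans (tmap_htp Y h) (htp_ext (@tmap_id _ _ Y G)).
Qed.

Lemma cell_bilin b n i (m : int) V (A W : lmodType k)
    (phi : m = i -> chom (p:=p) b n V -> {linear A -> W}) :
  {B : cell p k b n i m V -> A -> W | bilinear_map B /\
    forall e h y, B (cg k e h) y = phi e h y}.
Proof.
apply: cid.
have /dchoice[F HF] := fun y : A => @cell_lin p k b n i m V W (fun e h => phi e h y).
exists (fun x y => F y x); split; last by move=> e h y; rewrite HF.
split=> [y|x] ; first exact: linearP.
move=> c y y'; rewrite -[RHS]/((c \*: F y \+ F y') x).
apply: (cell_ext (f := F (c *: y + y')) (g := c \*: F y \+ F y')) => e h.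
by rewrite /= !HF linearP.
Qed.

End TensorSym.

(** * The tensor unit and tensor products of cells *)

Section TensorCells.
Variables (p : nat) (k : fieldType).
Hypothesis char0 : [pchar k]%R =i pred0.
Local Notation VS := (vectType 'F_p).
Local Notation Vn n := 'rV['F_p]_n.
Local Notation P := (cell p k true).
Local Notation Q := (cell p k false).
Implicit Types (V : VS) (X Y T : cplx p k).

Lemma unit_e (i j n : int) : i = 0 -> i + j = n -> j = n.
Proof. by move=> ->; rewrite add0r. Qed.

Lemma chom0_eq b V (f g : chom (p:=p) b 0 V) : f = g.
Proof. by apply: chom_eq => x; rewrite (thinmx0 x) !linear0. Qed.
Lemma chom0_ex V : exists f : chom (p:=p) true 0 V, True.
Proof.
have H : true ==> (lker (0 : 'Hom(Vn 0, V)) == 0%VS).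
  by apply/lker0P => x y _; rewrite (thinmx0 x) (thinmx0 y).
by exists (exist _ (0 : 'Hom(Vn 0, V)) H).
Qed.

(** There is exactly one injection from the zero space into any V, so P(0) is the constant functor k
    in degree 0. *)
Lemma tensor_unit Y : is_tensor (P 0%N 0) Y Y.
Proof.
pose B V (i j n : int) (e : i + j = n) := cell_bilin (b := true) (n := 0%N)
  (fun (ei : i = 0) (f : chom (p:=p) true 0 V) => tr Y (unit_e ei e) V : {linear Y j V -> Y n V}).
pose t V (i j n : int) (e : i + j = n) := sval (B V i j n e).
have tb V i j n e : bilinear_map (t V i j n e) by have [] := svalP (B V i j n e).
have tE V (i j n : int) e ei f y : t V i j n e (cg k ei f) y = tr Y (unit_e ei e) V y.
  exact: (svalP (B V i j n e)).2.
exists t; split=> //.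
- move=> V n W b Hb; have [f0 _] := chom0_ex V.
  exists (mkl ((Hb 0 n (add0r n)).2 (cg k erefl f0))); split=> [i j e x y|psi Hpsi y].
    have L : linear (fun x => b 0 n (add0r n) (cg k erefl f0) (t V i j n e x y)).
      by move=> c a a'; rewrite ((tb V i j n e).1 y) ((Hb 0 n (add0r n)).2).
    rewrite -[LHS]/(mkl L x) -[RHS]/(mkl ((Hb i j e).1 y) x); apply: cell_ext => ei f /=.
    have ej := unit_e ei e; subst i; subst j.
    by rewrite tE tr_id (chom0_eq f f0) (eq_irrelevance (add0r n) e).
  rewrite /= -(Hpsi 0 n (add0r n)) tE tr_id.
  by [].
- move=> V i j n e e1 e2 x y.
  have t0 : t V (i - 1) j (n - 1) e1 0 y = 0 by exact: (linear0 (mkl ((tb V (i - 1) j (n - 1)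
      e1).1 y))).
  rewrite cell_d t0 add0r.
  have L : linear (fun x => (-1) ^+ `|i|%N *: t V i (j - 1) (n - 1) e2 x (cx_d Y j V y)).
    by move=> c a a'; rewrite ((tb V i (j - 1) (n - 1) e2).1 _) scalerDr !scalerA mulrC.
  rewrite -[LHS]/((cx_d Y n V \o mkl ((tb V i j n e).1 y)) x) -[RHS]/(mkl L x).
  apply: cell_ext => ei f; rewrite [LHS]/= [RHS]/= !tE.
  have ej := unit_e ei e; subst i; subst j.
  by rewrite !tr_id expr0 scale1r.
- move=> U V f fi i j n e x y.
  rewrite (vi_mapE (A := Y n) fi) (vi_mapE (A := P 0%N 0 i) fi) (vi_mapE (A := Y j) fi).
  rewrite -[LHS]/((act (Y n) (vinjOf fi) \o mkl ((tb U i j n e).1 y)) x).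
  rewrite -[RHS]/((mkl ((tb V i j n e).1 (act (Y j) (vinjOf fi) y)) \o act (P 0%N 0 i) (vinjOf
      fi)) x).
  apply: cell_ext => ei g.
  apply: (etrans (congr1 (act (Y n) (vinjOf fi)) (tE _ _ _ _ _ _ _ _))).
  rewrite -[RHS]/(t V i j n e (act (P 0%N 0 i) (vinjOf fi) (cg k ei g)) (act (Y j) (vinjOf fi) y)).
  by rewrite act_cg tE nt_act.
Qed.

Section QQ.
Variables (n m : nat) (a c : int).
Lemma hpair_ex V (f : chom (p:=p) false n V) (g : chom (p:=p) false m V) :
  {h : chom (p:=p) false (n + m) V | forall v, sval h v = sval f (lsubmx v) + sval g (rsubmx v)}.
Proof.
apply: cid; have L : linear (fun v : Vn (n + m) => sval f (lsubmx v) + sval g (rsubmx v)).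
  by move=> x u v; rewrite !linearP /= scalerDr addrACA.
by have [F HF] := linfun_ex L; exists (exist _ F isT).
Qed.
Definition hpair V f g := sval (@hpair_ex V f g).
Lemma hpairE V f g v : sval (@hpair V f g) v = sval f (lsubmx v) + sval g (rsubmx v).
Proof. exact: (svalP (@hpair_ex V f g)). Qed.
Lemma hleft_ex V (h : chom (p:=p) false (n + m) V) :
  {f : chom (p:=p) false n V | forall v, sval f v = sval h (row_mx v 0)}.
Proof.
apply: cid; have L : linear (fun v : Vn n => sval h (row_mx v 0)).
  by move=> x u v; rewrite -linearP scale_row_mx add_row_mx scaler0 addr0.
by have [F HF] := linfun_ex L; exists (exist _ F isT).
Qed.
Definition hleft V h := sval (@hleft_ex V h).
Lemma hleftE V h v : sval (@hleft V h) v = sval h (row_mx v 0).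
Proof. exact: (svalP (@hleft_ex V h)). Qed.
Lemma hright_ex V (h : chom (p:=p) false (n + m) V) :
  {f : chom (p:=p) false m V | forall v, sval f v = sval h (row_mx 0 v)}.
Proof.
apply: cid; have L : linear (fun v : Vn m => sval h (row_mx 0 v)).
  by move=> x u v; rewrite -linearP scale_row_mx add_row_mx scaler0 addr0.
by have [F HF] := linfun_ex L; exists (exist _ F isT).
Qed.
Definition hright V h := sval (@hright_ex V h).
Lemma hrightE V h v : sval (@hright V h) v = sval h (row_mx 0 v).
Proof. exact: (svalP (@hright_ex V h)). Qed.
Lemma hpairK V h : hpair (hleft h) (hright h) = h :> chom false (n + m) V.
Proof.
apply: chom_eq => v; rewrite hpairE hleftE hrightE -linearD add_row_mx addr0 add0r.
by rewrite hsubmxK.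
Qed.
Lemma hleftK V (f : chom false n V) g : hleft (hpair f g) = f.
Proof.
by apply: chom_eq => v; rewrite hleftE hpairE row_mxKl row_mxKr linear0 addr0.
Qed.
Lemma hrightK V f (g : chom false m V) : hright (hpair f g) = g.
Proof.
by apply: chom_eq => v; rewrite hrightE hpairE row_mxKl row_mxKr linear0 add0r.
Qed.
Lemma hpair_comp U V (u : vinj U V) f g :
  chom_comp u (hpair f g) = hpair (chom_comp u f) (chom_comp u g).
Proof. by apply: chom_eq => v; rewrite chom_compE !hpairE !chom_compE linearD. Qed.

Lemma qq_e (i j l : int) : i = a -> j = c -> i + j = l -> l = a + c.
Proof. by move=> -> ->. Qed.

(** A pair of linear maps out of F_p^n and F_p^m is one linear map out of F_p^(n+m); for injections
    this would fail. *)
Lemma tensor_QQ : is_tensor (Q n a) (Q m c) (Q (n + m)%N (a + c)).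
Proof.
pose ph V (i j l : int) (e : i + j = l) (ei : i = a) (f : chom (p:=p) false n V) :=
  cid (@cell_lin p k false m c j V (Q (n + m)%N (a + c) l V) (fun ej g => cg k (qq_e ei ej e)
      (hpair f g))).
pose B V (i j l : int) (e : i + j = l) := cell_bilin (b := false) (n := n) (k := k)
  (fun (ei : i = a) (f : chom (p:=p) false n V) => sval (ph V i j l e ei f)).
pose t V (i j l : int) (e : i + j = l) := sval (B V i j l e).
have tb V i j l e : bilinear_map (t V i j l e) by have [] := svalP (B V i j l e).
have tE V (i j l : int) (e : i + j = l) ei f ej g :
    t V i j l e (cg k ei f) (cg k ej g) = cg k (qq_e ei ej e) (hpair f g).
  exact: etrans ((svalP (B V i j l e)).2 ei f (cg k ej g)) (svalP (ph V i j l e ei f) ej g).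
have text V (i j : int) (W : lmodType k) (F G : Q n a i V -> Q m c j V -> W) :
    bilinear_map F -> bilinear_map G ->
    (forall ei f ej g, F (cg k ei f) (cg k ej g) = G (cg k ei f) (cg k ej g)) ->
    forall x y, F x y = G x y.
  move=> [F1 F2] [G1 G2] H x y; rewrite -[LHS]/(mkl (F1 y) x) -[RHS]/(mkl (G1 y) x).
  apply: cell_ext => ei f; rewrite -[LHS]/(mkl (F2 (cg k ei f)) y) -[RHS]/(mkl (G2 (cg k ei f)) y).
  by apply: cell_ext => ej g; apply: H.
exists t; split=> //.
- move=> V l W b Hb.
  have [phi Hphi] := @cell_lin p k false (n + m)%N (a + c) l V W (fun el h =>
    b a c (esym el) (cg k erefl (hleft h)) (cg k erefl (hright h))).
  exists phi; split=> [i j e|psi Hpsi].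
    apply: (text V i j W (fun x y => phi (t V i j l e x y)) (b i j e)) => //.
      have [H1 H2] := tb V i j l e.
      by split=> [y|x] r u v; rewrite ?H1 ?H2 linearP.
    move=> ei f ej g; rewrite tE Hphi hleftK hrightK; subst i; subst j.
    by rewrite (eq_irrelevance (esym _) e).
  apply: cell_ext => el h; rewrite Hphi -(Hpsi _ _ (esym el)) tE hpairK.
  by congr (psi (cg k _ h)); apply: eq_irrelevance.
- move=> V i j l e e1 e2 x y.
  have t1 : t V (i - 1) j (l - 1) e1 0 y = 0 by exact: (linear0 (mkl ((tb V (i - 1) j (l - 1)
      e1).1 y))).
  have t2 : t V i (j - 1) (l - 1) e2 x 0 = 0 by exact: (linear0 (mkl ((tb V i (j - 1) (l - 1)
      e2).2 x))).
  by rewrite !cell_d t1 t2 scaler0 addr0.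
- move=> U V f fi i j l e x y.
  rewrite (vi_mapE (A := Q (n + m)%N (a + c) l) fi) (vi_mapE (A := Q n a i) fi) (vi_mapE (A := Q
      m c j) fi).
  have [H1 H2] := tb U i j l e; have [H1' H2'] := tb V i j l e.
  apply: (text U i j _ (fun x y => act (Q (n + m)%N (a + c) l) (vinjOf fi) (t U i j l e x y))
    (fun x y => t V i j l e (act (Q n a i) (vinjOf fi) x) (act (Q m c j) (vinjOf fi) y))).
  + by split=> [z|z] r u v; rewrite ?H1 ?H2 linearP.
  + by split=> [z|z] r u v; rewrite linearP ?H1' ?H2'.
  + move=> ei g ej h; rewrite tE !act_cg.
    by rewrite tE hpair_comp.
Qed.
End QQ.

Lemma th_all (T : cplx p k -> Prop) X : thick T -> (forall r i, T (P r i)) -> compact X -> T X.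
Proof. by move=> HT HP cX; apply: (th_structure char0 (M := 0%N) HT cX). Qed.

Lemma th_allQ (T : cplx p k -> Prop) X : thick T -> (forall r i, T (Q r i)) -> compact X -> T X.
Proof.
move=> HT HQ; apply: th_all => // r i; have [a [b H]] := cellP_retract p k r i.
exact: (th_retract HT (dretract_strict (htp_ext H)) (HQ r i)).
Qed.

(** Reduction to cells in each variable in turn: for a fixed second factor the admissible first
    factors form a thick class, and [tensor_QQ] settles the case of two cells. *)
Lemma compact_tens X Y : compact X -> compact Y -> compact (tens X Y).
Proof.
move=> cX cY; have HC := compact_thick p char0.
have sym A B : compact (tens A B) -> compact (tens B A).
  move=> H; exact: compact_diso (diso_sym (is_tensor_diso (is_tensor_sym (tens_is_tensor A B)))) H.
have H r i : compact (tens X (Q r i)).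
  have HQ r' i' : compact (Q r' i') /\ compact (tens (Q r' i') (Q r i)).
    split; first exact: compact_Q.
    apply: compact_diso (diso_sym (is_tensor_diso (tensor_QQ r' r i' i))) _.
    exact: compact_Q.
  have [_ H] := th_allQ (th_tens char0 (Q r i) HC) HQ cX; exact: H.
have HX r i : compact (Q r i) /\ compact (tens (Q r i) X).
  by split; [exact: compact_Q | exact: sym].
have [_ HY] := th_allQ (th_tens char0 X HC) HX cY; exact: sym.
Qed.

End TensorCells.

(** * Maps between cells and tensor products *)

Section CellMaps.
Variables (p : nat) (k : fieldType).
Hypothesis char0 : [pchar k]%R =i pred0.
Local Notation VS := (vectType 'F_p).
Local Notation Vn n := 'rV['F_p]_n.
Local Notation P := (cell p k true).
Implicit Types (V : VS) (X Y Z N : cplx p k).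

Lemma cell_ceq n i X (f g : chain_map (P n i) X) :
  f i _ (cgid p k n i) = g i _ (cgid p k n i) -> ceq f g.
Proof.
move=> H m V; apply: cell_ext => e h; subst m.
have E : cg k erefl h = act (P n i i) (h : vinj (Vn n) V) (cgid p k n i).
  by rewrite act_cg; congr (cg _ _ _); apply: chom_eq => x; rewrite chom_compE iidE.
by rewrite E !nt_act H.
Qed.

Lemma cell_into X n (m : int) (be : vi_nat (X (m - 1)) (P n (m - 1) (m - 1))) :
  (forall V x, be V (cx_d X m V x) = 0) ->
  exists F : chain_map X (P n (m - 1)), forall V x, F (m - 1) V x = be V x.
Proof.
move=> H.
have /dchoice[F HF] : forall l : int, exists F : vi_nat (X l) (P n (m - 1) l),
    forall (e : l = m - 1) V x, F V x = tr (P n (m - 1)) (esym e) V (be V (tr X e V x)).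
  move=> l; case: (l =P m - 1) => [e|ne].
    exists (nt_comp (tr (P n (m - 1)) (esym e)) (nt_comp be (tr X e))) => e' V x.
    by rewrite (eq_irrelevance e' e).
  by exists (nt_zero _ _) => e; case: ne.
have C (l : int) V x : F (l - 1) V (cx_d X l V x) = cx_d (P n (m - 1)) l V (F l V x).
  rewrite cell_d; case: (l - 1 =P m - 1) => [e|ne].
    have el : l = m by apply: (addIr (-1)).
    by subst l; rewrite (HF _ e) (eq_irrelevance e erefl) !tr_id H.
  set y := F _ _ _; rewrite -[y]/((idfun : {linear _ -> P n (m - 1) (l - 1) V}) y).
  by apply: (cell_ext (f := idfun) (g := \0)) => e; case: ne.
by exists (mkc C) => V x; rewrite -[LHS]/(F (m - 1) V x) (HF _ erefl) !tr_id.
Qed.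

Section Functionals.
Variables (X : cplx p k) (n : nat) (m : int).
Variable mu : forall V, vinj (Vn n) V -> {linear X (m - 1) V -> k^o}.
Hypothesis mu_nat : forall U V (u : vinj U V) f x,
  mu (icomp u f) (act (X (m - 1)) u x) = mu f x.
Hypothesis mu_d : forall V f x, @mu V f (cx_d X m V x) = 0.

Lemma fe_e (i j l : int) : j = 0 -> i + j = l -> i = l.
Proof. by move=> ->; rewrite addr0. Qed.

(** [mu f] acts as a coefficient functional at f: its invariance makes the map natural, and its
    vanishing on boundaries makes it a chain map. *)
Lemma tens_cell_out : exists F : chain_map (tens X (P n 0)) (P n (m - 1)),
  forall V (f : chom (p:=p) true n V) x,
    F (m - 1) V (tg (addr0 (m - 1)) x (cg k erefl f)) = mu (f : vinj (Vn n) V) x *: cg k erefl f.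
Proof.
pose ph V (i j : int) (e : i + j = m - 1) (ej : j = 0) (f : chom (p:=p) true n V) (x : X i V) :
   P n (m - 1) (m - 1) V := (mu (f : vinj (Vn n) V) (tr X (fe_e ej e) V x) : k) *: cg k erefl f.
have phl V i j e ej f : linear (@ph V i j e ej f).
  by move=> c x y; rewrite /ph !linearP /= scalerDl scalerA.
pose B V (i j : int) (e : i + j = m - 1) := cell_bilin (b := true) (n := n) (i := 0)
  (fun (ej : j = 0) (f : chom (p:=p) true n V) => mkl (@phl V i j e ej f)).
pose b V (i j : int) (e : i + j = m - 1) x y := sval (B V i j e) y x.
have bb V i j e : bilinear_map (b V i j e).
  by have [[H1 H2] _] := svalP (B V i j e); split=> [y|x]; [apply: H2 | apply: H1].
have bE V (i j : int) e ej f x : b V i j e x (cg k ej f) = ph V i j e ej f x.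
  exact: (svalP (B V i j e)).2 ej f x.
have nat U V (u : vinj U V) i j e x y :
    b V i j e (act (X i) u x) (act (P n 0 j) u y) = act (P n (m - 1) (m - 1)) u (b U i j e x y).
  rewrite -[LHS]/((mkl ((bb V i j e).2 (act (X i) u x)) \o act (P n 0 j) u) y).
  rewrite -[RHS]/((act (P n (m - 1) (m - 1)) u \o mkl ((bb U i j e).2 x)) y).
  apply: cell_ext => ej f.
  rewrite -[LHS]/(b V i j e (act (X i) u x) (act (P n 0 j) u (cg k ej f))).
  rewrite -[RHS]/(act (P n (m - 1) (m - 1)) u (b U i j e x (cg k ej f))).
  rewrite act_cg !bE /ph [RHS]linearZ_LR act_cg nt_act; congr (_ *: _).
  rewrite -[RHS](mu_nat u); congr (@mu V _ _).
  exact: vinj_eq.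
have [be Hbe] := tens_nt bb nat.
have [|F HF] := @cell_into (tens X (P n 0)) n m be.
  move=> V; apply: (tens_ext (f := be V \o cx_d (tens X (P n 0)) m V) (g := \0)) => i j e x y.
  apply: (etrans (congr1 (be V) (tens_dE e x y))); rewrite linearD linearZ_LR.
  have -> : tg (te2 e) x (cx_d (P n 0) j V y) = 0 by exact: tg0r.
  rewrite linear0 scaler0 addr0 Hbe.
  rewrite -[LHS]/(mkl ((bb V (i - 1) j (te1 e)).2 (cx_d X i V x)) y).
  rewrite -[RHS]/((\0 : {linear P n 0 j V -> _}) y); apply: cell_ext => ej f.
  apply: (etrans (bE _ _ _ _ _ _ _)); rewrite /ph; subst j.
  have ei : i = m by rewrite -e addr0.
  by subst i; rewrite tr_id mu_d scale0r.
exists F => V f x; rewrite HF Hbe bE /ph tr_id.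
by [].
Qed.

(* The two maps are [f |-> f x (x) f], and [y (x) f |-> mu f y *: f] after lifting
   along [q]. *)
Lemma retract_tens N Z (u : chain_map N Z) (q : chain_map X Z)
    (x : N (m - 1) (Vn n)) (x' : X (m - 1) (Vn n)) :
  quasi_iso q -> cx_d N (m - 1) _ x = 0 -> cx_d X (m - 1) _ x' = 0 ->
  u (m - 1) _ x = q (m - 1) _ x' -> mu (iid (Vn n)) x' = 1 ->
  dretract (P n (m - 1)) (tens N (P n 0)).
Proof.
move=> /qiaP qq dx dx' e mu1.
have cyc Y (z : Y (m - 1) (Vn n)) : cx_d Y (m - 1) _ z = 0 ->
    cx_d (tens Y (P n 0)) (m - 1) _ (tg (addr0 (m - 1)) z (cgid p k n 0)) = 0.
  move=> dz; apply: (etrans (tens_dE _ _ _)); rewrite dz tg0l add0r.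
  by rewrite cell_d tg0r scaler0.
have [y Hy] := yoneda (cyc _ _ dx); have [y' Hy'] := yoneda (cyc _ _ dx').
have yE : y (m - 1) _ (cgid p k n (m - 1)) = tg (addr0 (m - 1)) x (cgid p k n 0).
  by rewrite /cgid Hy tr_id; apply: (act1 (A := tensm N (P n 0) (m - 1))).
have y'E : y' (m - 1) _ (cgid p k n (m - 1)) = tg (addr0 (m - 1)) x' (cgid p k n 0).
  by rewrite /cgid Hy' tr_id; apply: (act1 (A := tensm X (P n 0) (m - 1))).
have tq : quasi_iso (tmap (P n 0) q) by apply/qiaP => V; apply: (tmap_qia char0).
have [F HF] := tens_cell_out.
have sq : ceq (cm_comp (tmap (P n 0) u) y) (cm_comp (tmap (P n 0) q) y').
  apply: cell_ceq; apply: (etrans (congr1 (tmap (P n 0) u (m - 1) (Vn n)) yE)).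
  apply: (etrans _ (esym (congr1 (tmap (P n 0) q (m - 1) (Vn n)) y'E))).
  by rewrite (tmapE u (addr0 (m - 1)) x _) (tmapE q (addr0 (m - 1)) x' _) e.
have Fy : ceq (cm_comp F y') (cm_id _).
  apply: cell_ceq; apply: (etrans (congr1 (F (m - 1) (Vn n)) y'E)).
  by apply: (etrans (HF _ _ _)); rewrite mu1 scale1r.
exists (dmap y), (dcomp (dmap F) (dcomp (dinv tq) (dmap (tmap (P n 0) u)))).
rewrite -!dcompA -dmap_comp (dmap_ext sq) dmap_comp (dcompA (dinv tq)) dmapK dcomp1l -dmap_comp.
exact: dmap_ext.
Qed.

End Functionals.

Lemma vinj_le n r : (n <= r)%N -> exists i : vinj (Vn n) (Vn r), True.
Proof.
move=> le.
have L : linear (fun v : Vn n => v *m (pid_mx n : 'M_(n, r))).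
  by move=> c x y; rewrite mulmxDl scalemxAl.
have [F HF] := linfun_ex L.
have H : lker F == 0%VS.
  apply/lker0P => x y; rewrite !HF => /(congr1 (fun v => v *m (pid_mx n : 'M_(r, n)))).
  by rewrite -!mulmxA pid_mx_id // pid_mx_1 !mulmx1.
by exists (vinjOf H).
Qed.

(** With a fixed injection i0 of F_p^n into F_p^r, the class used is i0 and the functional attached
    to f reads off the coefficient of f i0. *)
Lemma cell_up n r (m : int) : (n <= r)%N ->
  dretract (P r (m - 1)) (tens (P n (m - 1)) (P r 0)).
Proof.
move=> /vinj_le[i0 _].
have /dchoice[mu0 Hmu] : forall s : {V : VS & vinj (Vn r) V},
   exists F : {linear P n (m - 1) (m - 1) (tag s) -> k^o},
   forall e g, F (cg k e g) = (sval g == (sval (tagged s) \o sval i0)%VF)%:R.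
  move=> s; exact: (@cell_lin p k true n (m - 1) (m - 1) (tag s) k^o
    (fun e g => (sval g == (sval (tagged s) \o sval i0)%VF)%:R)).
pose mu V f := mu0 (existT (fun V => vinj (Vn r) V) V f).
have muE V f e g : mu V f (cg k e g) = (sval g == (sval f \o sval i0)%VF)%:R by exact: Hmu.
pose x : P n (m - 1) (m - 1) (Vn r) := cg k erefl (i0 : chom true n (Vn r)).
apply: (@retract_tens (P n (m - 1)) r m mu _ _ (P n (m - 1)) (P n (m - 1)) (cm_id _) (cm_id _) x
    x) => //.
- move=> U V u f y.
  apply: (cell_ext (f := mu V (icomp u f) \o act (P n (m - 1) (m - 1)) u) (g := mu U f)) => e g.
  rewrite [LHS]/= act_cg !muE; congr (_ %:R); congr (nat_of_bool _).
  have E v : (sval (icomp u f) \o sval i0)%VF v = sval u (sval f (sval i0 v)).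
    by rewrite comp_lfunE icompE.
  apply/eqP/eqP => /lfunP H; apply/lfunP => v; last first.
    by rewrite E; apply: (etrans (chom_compE u g v)); rewrite H comp_lfunE.
  apply: (vinjI (f := u)); rewrite [RHS](congr1 _ (comp_lfunE _ _ _)) -E -H.
  exact: esym (chom_compE u g v).
- by move=> V f y; rewrite cell_d linear0.
- exact: qi_id.
- rewrite muE; have -> // : (sval i0 == (sval (iid (Vn r)) \o sval i0)%VF).
  by apply/eqP/lfunP => v; rewrite comp_lfunE iidE.
Qed.

Lemma cell_shift n (i : int) : diso (shift (P n (i - 1))) (P n i).
Proof.
have /dchoice[F HF] : forall l : int, exists F : vi_nat (P n (i - 1) (l - 1)) (P n i l),
    forall V e f, F V (cg k e f) = cg k (addIr (-1) e) f.
  move=> l; apply: (cell_nt_lift (phi := fun V e f => cg k (addIr (-1) e) f)).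
  by move=> U V u e f; rewrite act_cg.
have /dchoice[G HG] : forall l : int, exists F : vi_nat (P n i l) (P n (i - 1) (l - 1)),
    forall V e f, F V (cg k e f) = cg k (congr1 (fun z => z - 1) e) f.
  move=> l; apply: (cell_nt_lift (phi := fun V e f => cg k (congr1 (fun z => z - 1) e) f)).
  by move=> U V u e f; rewrite act_cg.
have C (l : int) V x : F (l - 1) V (cx_d (shift (P n (i - 1))) l V x) = cx_d (P n i) l V (F l V x).
  by rewrite /= oppr0 linear0.
apply: (diso_qi (f := mkc C)); apply/qiaP => V.
apply: (@qia_bij p k _ _ (mkc C) V (fun l => G l V)) => l y.
  apply: (cell_ext (f := G l V \o F l V) (g := idfun)) => e f.
  by rewrite [LHS]/= HF HG; congr (cg k _ f); apply: eq_irrelevance.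
apply: (cell_ext (f := F l V \o G l V) (g := idfun)) => e f.
by rewrite [LHS]/= HG HF; congr (cg k _ f); apply: eq_irrelevance.
Qed.

Lemma th_cells (T : cplx p k -> Prop) n i : thick T -> T (P n i) -> forall i', T (P n i').
Proof.
move=> HT; suff H (i0 : int) : T (P n (i0 - 1)) <-> T (P n i0).
  move=> Ti i'; have up (l : nat) (a : int) : T (P n a) <-> T (P n (a + l%:Z)).
    elim: l => [|l IH]; first by rewrite addr0.
    by rewrite IH -(H (a + l.+1%:Z)) -addrA -addn1 PoszD addrK.
  have -> : i' = i + (i' - i) by rewrite addrC subrK.
  case: (i' - i) => l; first by rewrite -up.
  by rewrite NegzE (up l.+1) subrK.
split=> [T1|T1].
  exact: (th_diso HT (diso_sym (cell_shift n i0))) (th_shift HT T1).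
exact: (th_unshift HT) (th_diso HT (cell_shift n i0) T1).
Qed.

End CellMaps.

(** * Cells in the ideal of a nonacyclic complex *)

Section Alternating.
Variables (p : nat) (k : fieldType).
Hypothesis char0 : [pchar k]%R =i pred0.
Local Notation VS := (vectType 'F_p).
Local Notation Vn n := 'rV['F_p]_n.
Local Notation P := (cell p k true).
Implicit Types (V : VS) (X Y Z N : cplx p k).

(** The operator 1 - d s kills boundaries and does not kill w; a second generalized inverse, of c
    |-> c v, gives a functional with value 1 on the image v of w. *)
Lemma cycle_functional Z (m : int) V (w : Z (m - 1) V) : ~ boundary w ->
  exists la : {linear Z (m - 1) V -> k^o}, (forall x, la (cx_d Z m V x) = 0) /\ la w = 1.
Proof.
move=> nb; have [s Hs] := generalized_inverse (cx_d Z m V).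
pose v := w - cx_d Z m V (s w).
have v0 : v != 0.
  by apply/eqP => /subr0_eq e; apply: nb; exists (s w).
have L : linear (fun c : k^o => c *: v) by move=> a b c; rewrite scalerDl scalerA.
have [t Ht] := generalized_inverse (mkl L).
exists (t \o (idfun \- (cx_d Z m V \o s))); split=> [x|] /=.
  by rewrite Hs subrr linear0.
rewrite -/v; have := Ht 1; rewrite /= scale1r => H; apply/eqP; rewrite -subr_eq0.
have : (t v - 1) *: v == 0 by rewrite scalerBl H scale1r subrr.
by rewrite scaler_eq0 (negbTE v0) orbF.
Qed.

Variable e : nat.
Local Notation Ve := 'rV['F_p]_e.
Definition fnl := {ph : 'cV['F_p]_e | ph != 0}.
Local Notation h := #|{: fnl}|.
Implicit Types S : {set fnl}.

(** Functionals outside S contribute zero columns instead of being omitted, so that all the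
    injections [ginj S] have the same target and can be added. *)
Definition gmx S : 'M['F_p]_(e, h) :=
  \matrix_(i, c) if enum_val c \in S then sval (enum_val c) i 0 else 0.
Lemma gmx_col S (v : Ve) c : (v *m gmx S) 0 c =
  if enum_val c \in S then (v *m sval (enum_val c)) 0 0 else 0.
Proof.
rewrite !mxE; case: ifP => H; first by apply: eq_bigr => i _; rewrite !mxE H.
by rewrite big1 // => i _; rewrite !mxE H mulr0.
Qed.

Lemma ginj_ex S : {g : vinj Ve (Vn (e + h)) | forall v, sval g v = row_mx v (v *m gmx S)}.
Proof.
apply: cid; have L : linear (fun v : Ve => row_mx v (v *m gmx S)).
  by move=> c x y; rewrite mulmxDl -scalemxAl scale_row_mx add_row_mx.
have [F HF] := linfun_ex L.
have H : lker F == 0%VS by apply/lker0P => x y; rewrite !HF => /eq_row_mx[].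
by exists (vinjOf H).
Qed.
Definition ginj S := sval (ginj_ex S).
Lemma ginjE S v : sval (ginj S) v = row_mx v (v *m gmx S).
Proof. exact: (svalP (ginj_ex S)). Qed.

(** The first block of coordinates forces ga to be the identity; then the second block says that
    every functional in S vanishes, whereas S contains only nonzero ones. *)
Lemma ginj0 S (ga : vinj Ve Ve) : ginj S = icomp (ginj finset.set0) ga -> S = finset.set0 /\ ga =
    iid Ve.
Proof.
move=> E; have E' v : (v = sval ga v) /\ v *m gmx S = 0.
  have := congr1 (fun g : vinj _ _ => sval g v) E; rewrite icompE !ginjE.
  move=> /eq_row_mx[E1 E2]; split=> //; rewrite E2; apply/rowP => c.
  by rewrite gmx_col finset.in_set0 mxE.
split; last by apply: vinj_eq => v; rewrite -(E' v).1 iidE.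
apply/finset.setP => ph; rewrite finset.in_set0; apply/negbTE/negP => Sph.
have /negP[] := svalP ph; apply/eqP/colP => i; rewrite mxE.
have := congr1 (fun M : 'rV_h => M 0 (enum_rank ph)) (E' (delta_mx 0 i)).2.
by rewrite gmx_col enum_rankK Sph -rowE !mxE.
Qed.

(* A map [f] of rank below [e] is annihilated by some functional [ph], and then
   [S] and [S] with [ph] toggled contribute opposite terms to [aop (act A f x)].
   By [ginj0], no other term meets the GL_e-orbit of the one of the empty set. *)
Definition aop (A : vi_mod p k) (x : A Ve) : A (Vn (e + h)) :=
  \sum_(S : {set fnl}) (-1) ^+ #|S| *: act A (ginj S) x.
Lemma aop_linear A : linear (@aop A).
Proof.
move=> c x y; rewrite /aop scaler_sumr -big_split; apply: eq_bigr => S _.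
by rewrite linearP scalerDr !scalerA mulrC.
Qed.
Lemma aop_nt A B (f : vi_nat A B) x : aop (f _ x) = f _ (aop x).
Proof.
rewrite /aop linear_sum; apply: eq_bigr => S _.
by rewrite linearZ_LR nt_act.
Qed.

Lemma kill_functional j (f : vinj (Vn j) Ve) : (j < e)%N ->
  exists ph : fnl, forall v, sval f v *m sval ph = 0.
Proof.
move=> lt; pose M : 'M['F_p]_(j, e) := \matrix_i sval f (delta_mx 0 i).
have ME v : sval f v = v *m M.
  rewrite {1}(row_sum_delta v) linear_sum mulmx_sum_row; apply: eq_bigr => i _.
  by rewrite linearZ rowK.
have : kermx M^T != 0.
  rewrite kermx_eq0 /row_free mxrank_tr neq_ltn.
  by rewrite (leq_ltn_trans (rank_leq_row M) lt).
case/rowV0Pn => u /sub_kermxP Hu u0.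
have uT0 : u^T != 0 by rewrite trmx_eq0.
exists (exist _ u^T uT0) => v; rewrite ME -mulmxA -[M]trmxK -trmx_mul Hu.
by rewrite trmx0 mulmx0.
Qed.

Lemma aop_kill (A : vi_mod p k) j (f : vinj (Vn j) Ve) (x : A (Vn j)) : (j < e)%N -> aop (act A f
    x) = 0.
Proof.
move=> /(kill_functional f)[ph Hph].
pose fl S := if ph \in S then S :\ ph else ph |: S.
have flK : involutive fl.
  move=> S; rewrite /fl; case: (boolP (ph \in S)) => H.
    by rewrite finset.setD11 finset.setD1K.
  by rewrite finset.setU11 finset.setU1K.
have fls S : (-1) ^+ #|fl S| = - (-1) ^+ #|S| :> k.
  rewrite /fl; case: (boolP (ph \in S)) => H; last by rewrite cardsU1 H exprS mulN1r.
  by rewrite [in RHS](cardsD1 ph) H exprS mulN1r opprK.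
have flg S : icomp (ginj (fl S)) f = icomp (ginj S) f.
  have fE R v : sval (icomp (ginj R) f) v = row_mx (sval f v) (sval f v *m gmx R).
    exact: etrans (icompE _ _ _) (ginjE _ _).
  apply: vinj_eq => v; rewrite !fE; congr (row_mx _ _).
  apply/rowP => c; rewrite !gmx_col /fl; case: (eqVneq (enum_val c) ph) => [->|ne].
    by rewrite Hph mxE !if_same.
  by case: (boolP (ph \in S)) => H; rewrite !inE ?(negbTE ne).
have E : aop (act A f x) = - aop (act A f x).
  rewrite {1}/aop (reindex_inj (inv_inj flK)) /aop -sumrN; apply: eq_bigr => S _.
  by rewrite fls scaleNr -(actM (ginj (fl S)) f x) -(actM (ginj S) f x) flg.
have /eqP : aop (act A f x) *+ 2 = 0 by rewrite mulr2n {1}E addNr.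
rewrite -scaler_nat scaler_eq0 => /orP[|/eqP //].
by have /pcharf0P -> := char0.
Qed.

Lemma lt_in_inj N j (i : int) V x : lt_in N j i V x = 0 -> x = 0.
Proof.
elim: j => [//|j IH] H; apply: IH.
exact: (congr1 snd (H : (0, lt_in N j i V x) = (0, 0) :> Lam j (Lt N j) i V)).
Qed.

Lemma aop_ind_small b Z j (i : int) x : (j < e)%N -> @aop (ind b j Z i) x = 0.
Proof.
move=> lt; rewrite -[LHS]/(mkl (@aop_linear (ind b j Z i)) x) -[RHS]/((\0 : {linear ind b j Z i
    Ve -> _}) x).
apply: ind_ext => f z; rewrite -[f]icompf1 -act_igen.
exact: aop_kill.
Qed.

(** A stage of the tower is degreewise the sum of N and of modules induced from levels below e, on
    which the alternating operator vanishes; so its values lie in N. *)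
Lemma aop_Lt N j : (j <= e)%N -> forall (i : int) (w : Lt N j i Ve),
  exists x, aop w = lt_in N j i _ x.
Proof.
elim: j => [_ i w|j IH lt i w]; first by exists (aop w).
have [x Hx] := IH (ltnW lt) i w.2; exists x.
pose A := ind true j (Lt N j) (i - 1); pose B := Lt N j i.
have E1 : (aop w).1 = 0 by rewrite -(nt_fstE (A := A) (B := B)) -aop_nt aop_ind_small.
have E2 : (aop w).2 = lt_in N j i _ x by rewrite -Hx -!(nt_sndE (A := A) (B := B)) -aop_nt.
have -> : aop w = ((aop w).1, (aop w).2) by case: (aop w).
by rewrite E1 E2.
Qed.

(** Reads the coefficient, through [la], on the GL_e-orbit of f g0. The sum over ga makes it well
    defined on coinvariants. *)
Lemma ind_mu Z (m : int) (la : {linear Z (m - 1) Ve -> k^o}) n (g0 : vinj Ve (Vn n)) :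
  exists mu : forall V, vinj (Vn n) V -> {linear ind true e Z (m - 1) V -> k^o},
  forall V f g z, mu V f (igen true Z (m - 1) g z) =
    \sum_(ga <- vinjs Ve Ve) if g == icomp (icomp f g0) ga then la (act (Z (m - 1)) ga z) else 0.
Proof.
have /dchoice[mu Hmu] : forall s : {V : VS & vinj (Vn n) V},
    exists F : {linear ind true e Z (m - 1) (tag s) -> k^o}, forall g z,
      F (igen true Z (m - 1) g z) = \sum_(ga <- vinjs Ve Ve)
        if g == icomp (icomp (tagged s) g0) ga then la (act (Z (m - 1)) ga z) else 0.
  move=> s; apply: (ind_lin (phi := fun g z => \sum_(ga <- vinjs Ve Ve)
        if g == icomp (icomp (tagged s) g0) ga then la (act (Z (m - 1)) ga z) else 0 : k^o)).
    move=> g c x y; rewrite scaler_sumr -big_split; apply: eq_bigr => ga _ /=.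
    by case: ifP => _; rewrite ?linearP // scaler0 addr0.
  move=> _ g g' z; rewrite -[LHS](sum_vinjs_comp g'); apply: eq_bigr => ga _.
  rewrite actM; congr (if _ then _ else _); rewrite icompA.
  apply/eqP/eqP => [E|-> //].
  by rewrite -(icompf1 g) -(icompfV g') icompA E -icompA icompfV icompf1.
exists (fun V f => mu (existT (fun V => vinj (Vn n) V) V f)) => V f g z.
  exact: (Hmu (existT (fun V => vinj (Vn n) V) V f) g z).
Qed.

(** As the next stage is acyclic, [Lt N e] is quasi-isomorphic to the complex induced from its level
    e. A class there is moved into N by the alternating operator and detected on the induced
    complex, which is what [retract_tens] requires. *)
Lemma cell_retract_tens N : (forall V, acy (Lt N e.+1) V) -> ~ (forall V, acy (Lt N e) V) ->
  exists n (m : int), dretract (P n (m - 1)) (tens N (P n 0)).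
Proof.
set Z := Lt N e => aL naZ.
have qq : quasi_iso (counit true e Z) by apply/qiaP => V; apply: qia_cone; exact: aL.
have [m [w [dw nb]]] : exists (m : int) (w : Z (m - 1) Ve), cycle w /\ ~ boundary w.
  apply: contrapT => H; apply: naZ => V.
  (* Without homology at level e the induced complex would be acyclic everywhere, and so would Z. *)
  have aI : acy (ind true e Z) V.
    apply: ind_acy => // m w dw; apply: contrapT => nb; apply: H; by exists m, w.
  by move/qiaP: qq => /(_ V) /qia_acyr; apply.
have [la [lad law]] := cycle_functional nb.
have [x Hx] := aop_Lt (leqnn e) w.
(* One coordinate for each nonzero functional is added to F_p^e. *)
pose n := (e + h)%N; exists n, m.
have [mu Hmu] := ind_mu la (ginj finset.set0).
pose x' : ind true e Z (m - 1) (Vn n) := aop (igen true Z (m - 1) (iid Ve) w).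
have x'E : x' = \sum_(S : {set fnl}) (-1) ^+ #|S| *: igen true Z (m - 1) (ginj S) w.
  by rewrite /x' /aop; apply: eq_bigr => S _; rewrite act_igen icompf1.
have muext V (f g : {linear ind true e Z (m - 1) V -> k^o}) :
    (forall l z, f (igen true Z (m - 1) l z) = g (igen true Z (m - 1) l z)) -> f =1 g by apply:
        ind_ext.
apply: (@retract_tens p k char0 (ind true e Z) n m mu _ _ N Z (lt_in N e) (counit true e Z) x x')
    => //.
- move=> U V u f y.
  apply: (muext U (mu V (icomp u f) \o act (ind true e Z (m - 1)) u) (mu U f)) => g z.
  rewrite -[LHS]/(mu V (icomp u f) (act (ind true e Z (m - 1)) u (igen true Z (m - 1) g z))).
  rewrite act_igen !Hmu; apply: eq_bigr => ga _; congr (if _ then _ else _).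
  rewrite -!icompA; apply/eqP/eqP => [/icompI //|-> //].
- move=> V f y.
  have E : mu V f \o cx_d (ind true e Z) m V =1 (\0 : {linear ind true e Z m V -> k^o}).
    apply: ind_ext => g z.
    rewrite -[LHS]/(mu V f (cx_d (ind true e Z) m V (igen true Z m g z))) ind_dE Hmu.
    by apply: big1 => ga _; rewrite -nt_act lad if_same.
  exact: E.
- apply: (@lt_in_inj N e); rewrite cm_comm -Hx -aop_nt dw.
  exact: (linear0 (mkl (@aop_linear _))).
- rewrite /x' -aop_nt ind_dE dw linear0; exact: (linear0 (mkl (@aop_linear _))).
- by rewrite /x' -aop_nt counitE act1 Hx.
(* By [ginj0] only S empty and ga the identity contribute, with coefficient [la w] = 1. *)
- rewrite x'E linear_sum (bigD1 finset.set0) //= big1 => [|S S0].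
    rewrite addr0 cards0 expr0 scale1r Hmu icomp1f.
    rewrite (bigD1_seq (iid Ve)) ?mem_vinjs ?vinjs_uniq //= icompf1 eqxx act1 big1 ?addr0 // =>
        ga ne.
    case: eqP => // E; have [_ e'] := @ginj0 finset.set0 ga E; by rewrite e' eqxx in ne.
  rewrite linearZ_LR Hmu big1 ?scaler0 // => ga _; rewrite icomp1f.
  case: eqP => // E; have [e' _] := @ginj0 S ga E; by rewrite e' eqxx in S0.
Qed.

End Alternating.

Section Nonzero.
Variables (p : nat) (k : fieldType).
Hypothesis char0 : [pchar k]%R =i pred0.
Local Notation P := (cell p k true).
Implicit Types (V : vectType 'F_p) (X Y Z N : cplx p k).

Lemma nonacyclic_cell N : compact N -> ~ (forall V, acy N V) ->
  exists n (m : int), dretract (P n (m - 1)) (tens N (P n 0)).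
Proof.
move=> cN nN; have [e0 He0] := Lt_stop char0 cN.
suff [e [H1 H2]] : exists e, (forall V, acy (Lt N e.+1) V) /\ ~ (forall V, acy (Lt N e) V).
  exact: (cell_retract_tens char0 H1 H2).
elim: e0 He0 => [//|e IH] H.
have [a|na] := pselect (forall V, acy (Lt N e) V); first exact: IH.
by exists e.
Qed.

End Nonzero.

(** * Killing the levels between two cells *)

Section Tower.
Variables (p : nat) (k : fieldType).
Hypothesis char0 : [pchar k]%R =i pred0.
Local Notation VS := (vectType 'F_p).
Local Notation Vn n := 'rV['F_p]_n.
Local Notation P := (cell p k true).
Implicit Types (V : VS) (X Y Z N : cplx p k).

Lemma counit_ind_map j X Y (f : chain_map X Y) :
  ceq (cm_comp f (counit true j X)) (cm_comp (counit true j Y) (ind_map j true f)).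
Proof.
move=> n V x; apply: (ind_ext (f := f n V \o counit true j X n V)
  (g := counit true j Y n V \o ind_map j true f n V)) => g z.
by rewrite [LHS]/= [RHS]/= ind_mapE !counitE nt_act.
Qed.

Definition Lam_map j X Y (f : chain_map X Y) : chain_map (Lam j X) (Lam j Y) :=
  cone_map2 (counit_ind_map (j := j) f).

Lemma Lam_map_retract j X Y (a : chain_map X Y) (r : chain_map Y X) :
  ceq (cm_comp r a) (cm_id X) -> ceq (cm_comp (Lam_map j r) (Lam_map j a)) (cm_id _).
Proof.
move=> e n V [x y].
have Ea : Lam_map j a n V (x, y) = (ind_map j true a (n - 1) V x, a n V y) by exact: cone_map2E.
have Er u v : Lam_map j r n V (u, v) = (ind_map j true r (n - 1) V u, r n V v) by exact: cone_map2E.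
rewrite -[LHS]/(Lam_map j r n V (Lam_map j a n V (x, y))) Ea Er.
congr (_, _); last exact: (e n V y).
apply: (ind_ext (f := ind_map j true r (n - 1) V \o ind_map j true a (n - 1) V) (g := idfun)) =>
    g z.
rewrite [LHS]/= !ind_mapE; exact: (congr1 (igen true X (n - 1) g) (e (n - 1) _ z)).
Qed.

Lemma Lam_map_qia j X Y (f : chain_map X Y) V : (\dim {:V} < j)%N -> qia f V -> qia (Lam_map j f) V.
Proof.
move=> lt q; apply: (qia_cone_map (a := ind_map j true f) (b := f)) => //.
- by move=> n W x; rewrite -[LHS]/(Lam_map j f n W (0, x)) /Lam_map cone_map2E linear0.
- by move=> n W [x y]; rewrite /Lam_map cone_map2E.
- by apply: acy_qia; apply: ind_small_acy.
Qed.

(** The killing tower started at level m: it kills the levels m, ..., m + c - 1 and leaves those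
    below m unchanged. *)
Fixpoint Kt (m c : nat) X := if c is c'.+1 then Lam (m + c') (Kt m c' X) else X.
Fixpoint kt_in m c X : chain_map X (Kt m c X) :=
  match c with
  | 0 => cm_id X
  | c'.+1 => cm_comp (lam_in (m + c') (Kt m c' X)) (kt_in m c' X)
  end.
Fixpoint Kt_map m c X Y (f : chain_map X Y) : chain_map (Kt m c X) (Kt m c Y) :=
  match c with
  | 0 => f
  | c'.+1 => Lam_map (m + c') (Kt_map m c' f)
  end.

Lemma Kt_map_retract m c X Y (a : chain_map X Y) (r : chain_map Y X) :
  ceq (cm_comp r a) (cm_id X) -> ceq (cm_comp (Kt_map m c r) (Kt_map m c a)) (cm_id _).
Proof. by move=> e; elim: c => [|c IH]; [exact: e | exact: Lam_map_retract]. Qed.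

Lemma Kt_compact m c X : compact X -> compact (Kt m c X).
Proof. by move=> cX; elim: c => [|c IH]; [exact: cX | exact: (Lam_compact char0 _ IH)]. Qed.

Lemma Kt_acy_small m c X V : (\dim {:V} < m)%N -> acy X V -> acy (Kt m c X) V.
Proof.
move=> lt aX; elim: c => [|c IH]; first exact: aX.
by apply: Lam_acy_small IH; rewrite (leq_trans lt) ?leq_addr.
Qed.

Lemma Kt_acy m c X V : (m <= \dim {:V} < m + c)%N -> acy (Kt m c X) V.
Proof.
elim: c => [|c IH]; first by rewrite addn0 leqNgt andNb.
rewrite addnS ltnS => /andP[le]; rewrite leq_eqVlt => /orP[/eqP e|lt].
  exact: (@Lam_acy_eq p k (m + c) (Kt m c X) V e).
by apply: Lam_acy_small => //; apply: IH; rewrite le.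
Qed.

Lemma kt_in_qia m c X V : (\dim {:V} < m)%N -> qia (kt_in m c X) V.
Proof.
move=> lt; elim: c => [|c IH]; first exact: qia_id.
by apply: qia_comp IH _; apply: lam_in_qia; rewrite (leq_trans lt) ?leq_addr.
Qed.

Lemma Kt_map_qia m c X Y (f : chain_map X Y) V : (\dim {:V} < m)%N -> qia f V ->
  qia (Kt_map m c f) V.
Proof.
move=> lt q; elim: c => [|c IH]; first exact: q.
by apply: Lam_map_qia IH; rewrite (leq_trans lt) ?leq_addr.
Qed.

(** Each step cones off a complex induced from a level at least m, which is built from cells in T,
    so X is recovered from the last stage. *)
Lemma th_Kt (T : cplx p k -> Prop) m c X : thick T -> (forall r i, (m <= r)%N -> T (P r i)) ->
  compact X -> T (Kt m c X) -> T X.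
Proof.
move=> HT TP cX; elim: c => [//|c IH] TL; apply: IH.
have TG := th_indG char0 true HT (TP (m + c)%N ^~ (leq_addr c m)) (Kt_compact m c cX).
exact: (th_mid HT) TG TL.
Qed.

Lemma cell_small_acy n i V : (\dim {:V} < n)%N -> acy (P n i) V.
Proof.
move=> lt m z _; have -> : z = 0; last exact: boundary0.
apply: (cell_ext (f := idfun) (g := \0)) => e f.
by have := vinj_dim (f : vinj (Vn n) V); rewrite dim_rV leqNgt lt.
Qed.

Section Evaluation.
Variables (n : nat) (N : cplx p k).

Lemma ev_ex : {F : chain_map (ind false n N) (tens (P n 0) N) |
  forall (l : int) V (f : vinj (Vn n) V) z, F l V (igen false N l f z) =
    tg (add0r l) (cg k erefl (f : chom true n V)) (act (N l) f z)}.
Proof.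
apply: cid.
have [//||F HF] := @ind_lift p k false n N (tens (P n 0) N)
  (fun l : int => tgr N (add0r l) (cgid p k n 0)).
  move=> l z; apply/esym; apply: (etrans (tens_dE (add0r l) (cgid p k n 0) z)).
  rewrite cell_d tg0l add0r expr0 scale1r.
  exact: tg_irr.
exists F => l V f z; rewrite HF; apply: (etrans (act_tg f (add0r l) _ _)).
rewrite act_cg; congr (tg _ (cg _ _ _) _); apply: chom_eq => x.
by rewrite chom_compE iidE.
Qed.
Definition ev := sval ev_ex.
Lemma evE (l : int) V (f : vinj (Vn n) V) z : ev l V (igen false N l f z) =
    tg (add0r l) (cg k erefl (f : chom true n V)) (act (N l) f z).
Proof. exact: (svalP ev_ex). Qed.

(** At level n every f is invertible, and f (x) y |-> f (x) f^-1 y undoes the twist f (x) z |-> f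
    (x) f z. *)
Lemma ev_qia : qia ev (Vn n).
Proof.
pose ph (i j l : int) (e : i + j = l) (ei : i = 0) (f : chom (p:=p) true n (Vn n)) :
    {linear N j (Vn n) -> ind false n N l (Vn n)} :=
  igen false N l (f : vinj (Vn n) (Vn n)) \o
   (act (N l) (iinv (f : vinj (Vn n) (Vn n))) \o tr N (unit_e ei e) (Vn n)).
pose B (i j l : int) (e : i + j = l) := cell_bilin (b := true) (n := n) (ph i j l e).
have [G HG] := dchoice (fun l : int => let: exist F E := tens_lin (fun i j e => (svalP (B i j l
    e)).1) in
  ex_intro _ F E : exists F : {linear tens (P n 0) N l (Vn n) -> ind false n N l (Vn n)}, _).
have GE (l j : int) (e : 0 + j = l) f y : G l (tg e (cg k erefl f) y) =
    igen false N l (f : vinj (Vn n) (Vn n)) (act (N l) (iinv (f : vinj (Vn n) (Vn n))) (tr N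
        (unit_e erefl e) (Vn n) y)).
  by rewrite HG; exact: ((svalP (B 0 j l e)).2 erefl f y).
apply: (@qia_bij p k _ _ ev (Vn n) G) => l x.
  apply: (ind_ext (f := G l \o ev l (Vn n)) (g := idfun)) => f z.
  apply: (etrans (congr1 (G l) (evE f z))); rewrite GE tr_id -actM icompVf act1.
  by [].
apply: (tens_ext (f := ev l (Vn n) \o G l) (g := idfun)) => i j e a y.
rewrite -[LHS]/((ev l (Vn n) \o (G l \o tgl (P n 0) e y)) a) -[RHS]/(tgl (P n 0) e y a).
apply: cell_ext => ei f; subst i.
have ej : j = l by rewrite -e add0r.
subst j.
apply: (etrans (congr1 (ev l (Vn n)) (GE _ _ _ _ _))); rewrite evE -actM icompfV act1 tr_id.
exact: tg_irr.
Qed.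

(** A nonzero class w and a functional detecting it split k off N(F_p^n) as a complex; plain
    induction turns this splitting into one of P(n). *)
Lemma cell_ind_retract (m : int) (w : N (m - 1) (Vn n)) : cycle w -> ~ boundary w ->
  exists (a : chain_map (P n (m - 1)) (ind false n N)) (r : chain_map (ind false n N) (P n (m -
      1))),
    ceq (cm_comp r a) (cm_id _).
Proof.
move=> dw nb; have [la [lad law]] := cycle_functional nb.
have L : linear (fun z => la z *: cgid p k n (m - 1)).
  by move=> c x y; rewrite linearP scalerDl scalerA.
have [//|be Hbe] := @ind_nt_lift p k false n N (m - 1) (P n (m - 1) (m - 1)) (mkl L).
have [|F HF] := @cell_into p k (ind false n N) n m be.
  move=> V; apply: (ind_ext (f := be V \o cx_d (ind false n N) m V) (g := \0)) => f z.
  rewrite -[LHS]/(be V (cx_d (ind false n N) m V (igen false N m f z))) ind_dE Hbe.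
  by rewrite [mkl L _]/= lad scale0r linear0.
have [|a Ha] := @yoneda p k n (m - 1) (ind false n N) (igen false N (m - 1) (iid _) w).
  by rewrite ind_dE dw linear0.
exists a, F; apply: cell_ceq; rewrite -[LHS]/(F _ _ (a _ _ _)) /cgid Ha tr_id HF.
have -> : act (ind false n N (m - 1)) (iid (Vn n)) (igen false N (m - 1) (iid (Vn n)) w) =
   igen false N (m - 1) (iid (Vn n)) w by apply: act1.
rewrite Hbe [X in act _ _ X]/= law scale1r.
exact: (act1 (A := P n (m - 1) (m - 1))).
Qed.

End Evaluation.
End Tower.

(** * The classification *)

Section Main.
Variables (p : nat) (k : fieldType).
Hypothesis char0 : [pchar k]%R =i pred0.
Local Notation VS := (vectType 'F_p).
Local Notation Vn n := 'rV['F_p]_n.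
Local Notation P := (cell p k true).
Implicit Types (V : VS) (X Y Z N : cplx p k).

Lemma ideal_thick (I : cplx p k -> Prop) : thick_ideal I -> thick I.
Proof.
move=> HI; split.
- exact: ti_compact HI.
- by move=> X aX; apply: (ti_zero HI); apply: acy_dzero.
- move=> X Y f IX IY; have cX := ti_compact HI IX; have cY := ti_compact HI IY.
  have tri : in_triangle X Y (cone f) by exists X, Y, f; split; apply: diso_refl.
  by have [H _ _] := ti_triangle HI cX cY (compact_cone char0 f cX cY) tri; apply: H.
- move=> X IX; have cX := compact_unshift char0 (ti_compact HI IX).
  exact/(ti_shift HI cX).
- move=> X Y r IY; have cY : compact Y := ti_compact HI IY.
  have cX : compact X := compact_retract r cY; exact: (ti_retract HI cX r IY).
Qed.

Lemma homology_acy X V : homology_nonzero X V <-> ~ acy X V.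
Proof.
split=> [[n [z [dz nb]]] a|na]; first exact/nb/a.
apply: contrapT => H; apply: na => n z dz; apply: contrapT => nb; apply: H.
by exists n, z.
Qed.

Lemma tens_acyr X Y V : acy Y V -> acy (tens X Y) V.
Proof.
move=> aY; apply: acy_of_rV.
apply: (@acy_retract p k _ (tens Y X)).
  exact: diso_retract (is_tensor_diso (is_tensor_sym (tens_is_tensor X Y))).
by apply: (tens_acy char0); apply: acy_iso aY; rewrite dim_rV.
Qed.

Lemma acy_diso X Y V : diso X Y -> acy Y V -> acy X V.
Proof.
move=> d aY; apply: acy_of_rV; apply: (acy_retract (diso_retract d)).
by apply: acy_iso aY; rewrite dim_rV.
Qed.

Lemma ideal_tens (I : cplx p k -> Prop) X Y : thick_ideal I -> I X -> compact Y ->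
  I (tens X Y).
Proof. by move=> HI IX cY; exact: (@ti_tensor _ _ _ HI X Y _ IX cY (tens_is_tensor X Y)). Qed.

(** Tensoring with P(n) puts one cell into the ideal; tensoring that cell with P(r) gives all r >= n
    by [cell_up], and shifts give all degrees. *)
Lemma ideal_cells (I : cplx p k -> Prop) N : thick_ideal I -> I N -> ~ (forall V, acy N V) ->
  exists M : nat, forall r i, (M <= r)%N -> I (P r i).
Proof.
move=> HI IN nN; have HT := ideal_thick HI.
have [n [m rt]] := nonacyclic_cell char0 (ti_compact HI IN) nN.
have In i : I (P n i).
  apply: (th_cells HT (i := m - 1)); apply: (th_retract HT) rt _.
  exact: (ideal_tens HI IN (compact_P char0 n 0)).
exists n => r i le; apply: (th_cells HT (i := m - 1)).
apply: (th_retract HT (@cell_up p k char0 n r m le)).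
exact: (ideal_tens HI (In _) (compact_P char0 r 0)).
Qed.

Section Descent.
Variables (I : cplx p k -> Prop) (N1 N2 : cplx p k) (M : nat).
Hypotheses (HI : thick_ideal I) (cN1 : compact N1) (IN2 : I N2).
Hypothesis N12 : forall n, acy N2 (Vn n) -> acy N1 (Vn n).
Hypothesis IP : forall r i, (M <= r)%N -> I (P r i).
Let T X := compact X /\ I (tens X N1).

Lemma T_thick : thick T.
Proof. exact: (@th_tens p k char0 I N1 (ideal_thick HI)). Qed.

Lemma T_of_ideal X : I X -> T X.
Proof.
by move=> IX; split; [exact (ti_compact HI IX) | exact: (ideal_tens HI IX cN1)].
Qed.

Lemma I_structure X : compact X -> (forall d, (d < M)%N -> acy X (Vn d)) -> I X.
Proof.
move=> cX aX; apply: (th_structure char0 (M := M) (ideal_thick HI) cX) IP => V lt.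
exact/acy_of_rV/aX.
Qed.

(* [s i] differs from [P n i] by cells of levels above [n], and is acyclic at all
   levels below [M] except [n].  If [N1] is acyclic at level [n], then
   [tens (s i) N1] is acyclic below [M].  If not, then neither is [N2], and a shift
   of [s 0] is a retract of a complex that agrees below [M] with
   [tens (s 0) N2]. *)
Lemma descent_step n : (n < M)%N -> (forall r i, (n < r)%N -> T (P r i)) ->
  forall i, T (P n i).
Proof.
(* With this c the killed levels are n + 1, ..., M - 1. *)
move=> nM IH; pose c := (M - n.+1)%N; pose s i := Kt n.+1 c (P n i).
have cs i : compact (s i) := Kt_compact char0 n.+1 c (compact_P char0 n i).
have Mc : (n.+1 + c = M)%N by rewrite subnKC.
have as_ i d : (d < M)%N -> d != n -> acy (s i) (Vn d).
  move=> dM; rewrite neq_ltn => /orP[lt|gt].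
    by apply: Kt_acy_small; [rewrite dim_rV ltnW | apply: cell_small_acy; rewrite dim_rV].
  by apply: Kt_acy; rewrite dim_rV Mc gt.
suff [i Ts] : exists i, T (s i).
  have TPn := th_Kt char0 T_thick IH (compact_P char0 n i) Ts.
  exact: th_cells T_thick TPn.
have [a1|na1] := pselect (acy N1 (Vn n)).
  exists 0; split; first exact: cs.
  apply: I_structure; first exact: (compact_tens char0 (cs 0) cN1).
  move=> d dM; have [->|ne] := eqVneq d n; first exact: tens_acyr.
  by apply: (tens_acy char0); apply: as_.
have /homology_acy[m [w [dw nb]]] : ~ acy N2 (Vn n) by move=> /N12.
have [a [r ra]] := cell_ind_retract dw nb.
exists (m - 1); apply: T_of_ideal.
pose B := tens (s 0) N2; pose W := ind false n N2.
have cN2 := ti_compact HI IN2.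
have IB : I B := @ti_tensor _ _ _ HI _ _ _ IN2 (cs 0) (is_tensor_sym (tens_is_tensor (s 0) N2)).
have cB := ti_compact HI IB; have cW : compact W := ind_compact char0 n cN2.
pose psi : chain_map W B := cm_comp (tmap N2 (kt_in n.+1 c (P n 0))) (ev n N2).
have aB d : (d < M)%N -> d != n -> acy B (Vn d).
  by move=> dM ne; apply: (tens_acy char0); apply: as_.
have HT := ideal_thick HI.
(* B and [Kt n.+1 c B] agree at all levels below M: up to n nothing is killed, and beyond n both are
   acyclic. Their difference lies in the ideal by [I_structure]. *)
have IKB : I (Kt n.+1 c B).
  apply: (th_mid HT (f := kt_in n.+1 c B) IB); apply: I_structure.
    exact: (compact_cone char0 _ cB (Kt_compact char0 n.+1 c cB)).
  move=> d dM; have [dn|nd] := leqP d n.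
    by apply/acy_cone/kt_in_qia; rewrite dim_rV.
  apply: acy_cone_of; first by apply: aB => //; rewrite neq_ltn nd orbT.
  by apply: Kt_acy; rewrite dim_rV Mc nd.
(* The map induced by [psi] is a quasi-isomorphism below M: both sides are acyclic below n and
   between n and M, and at level n the map [psi] is one by [ev_qia]. *)
have IKW : I (Kt n.+1 c W).
  apply: (th_fib HT (f := Kt_map n.+1 c psi) IKB); apply: I_structure.
    exact: (compact_cone char0 _ (Kt_compact char0 n.+1 c cW) (Kt_compact char0 n.+1 c cB)).
  move=> d dM; have [lt|gt|->] := ltngtP d n.
  - apply: acy_cone_of; apply: Kt_acy_small; rewrite ?dim_rV 1?ltnW //.
      by apply: ind_small_acy; rewrite dim_rV.
    by apply: aB => //; rewrite neq_ltn lt.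
  - by apply: acy_cone_of; apply: Kt_acy; rewrite dim_rV Mc gt.
  - apply/acy_cone/Kt_map_qia; first by rewrite dim_rV.
    apply: qia_comp (@ev_qia p k n N2) _; apply: (tmap_qia char0).
    by apply: kt_in_qia; rewrite dim_rV.
(* Functoriality of the killing tower carries the splitting of P(n) off W to one of [s (m - 1)] off
   [Kt n.+1 c W]. *)
apply: (th_retract HT) IKW.
exact: (dretract_strict (htp_ext (@Kt_map_retract p k n.+1 c _ _ a r ra))).
Qed.

Lemma descent : I N1.
Proof.
(* Descending induction on n, run as ascending induction on a bound d for M - n. *)
have TP d : forall n, (M <= n + d)%N -> forall i, T (P n i).
  elim: d => [|d IH] n; first by rewrite addn0 => le i; apply/T_of_ideal/IP.
  move=> le; have [/IH //|lt] := leqP M (n + d).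
  apply: descent_step => [|r i nr]; first exact: leq_ltn_trans (leq_addr d n) lt.
  by apply: IH; apply: leq_trans le _; rewrite addnS -addSn leq_add2r.
have [_ H] := TP M 0%N (leqnn M) 0.
exact: (th_diso (ideal_thick HI) (is_tensor_diso (tensor_unit N1))) H.
Qed.
End Descent.

Lemma ideal_of_type (I : cplx p k -> Prop) N1 N2 : thick_ideal I -> compact N1 -> I N2 ->
  (forall n, acy N2 (Vn n) -> acy N1 (Vn n)) -> I N1.
Proof.
move=> HI cN1 IN2 N12; have [a|na] := pselect (forall V, acy N2 V).
  by apply: (th_acy (ideal_thick HI)) => V; apply/acy_of_rV/N12/a.
have [M HM] := ideal_cells HI IN2 na.
exact: descent HI cN1 IN2 N12 HM.
Qed.

Definition typed (S : set nat) X := compact X /\ forall n, ~ S n -> acy X (Vn n).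

(** Serves twice: it shows that the type depends only on the generated ideal, and, taken with S the
    type of a given complex, that types are cofinite or empty. *)
Lemma typed_ideal S : thick_ideal (typed S).
Proof.
split.
- by move=> X [].
- by move=> X z; split=> [|n _]; [exact: compact_zero | exact: zero_acy].
- move=> X cX; split=> -[_ H]; split=> //; last by move=> n nS; apply/acy_shift/H.
    exact: compact_shift.
  by move=> n nS; apply/acy_shift/H.
- move=> X Y Z cX cY cZ [A [B [f [dX dY dZ]]]]; split=> -[_ H1] [_ H2]; split=> // n nS.
  + apply: acy_diso dZ _; apply: acy_cone_of.
      exact: acy_diso (diso_sym dX) (H1 n nS).
    exact: acy_diso (diso_sym dY) (H2 n nS).
  + apply: acy_diso dX _; apply: (qia_acyl (f := f)).
      exact/qia_cone/(acy_diso (diso_sym dZ))/H2.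
    exact: acy_diso (diso_sym dY) (H1 n nS).
  + apply: acy_diso dY _; apply: (qia_acyr (f := f)).
      exact/qia_cone/(acy_diso (diso_sym dZ))/H2.
    exact: acy_diso (diso_sym dX) (H1 n nS).
- by move=> X Y cX r [_ H]; split=> // n nS; apply: acy_retract r (H n nS).
- move=> X Y T [cX H] cY t; have d := is_tensor_diso t; split.
    exact: compact_diso d (compact_tens char0 cX cY).
  by move=> n nS; apply: acy_diso d _; apply: (tens_acy char0); apply: H.
Qed.

Lemma typed_type X : compact X -> typed (tt_type X) X.
Proof.
by move=> cX; split=> // n; rewrite /tt_type /= homology_acy => /contrapT.
Qed.

Lemma cell_nonacy n r i : (n <= r)%N -> ~ acy (P n i) (Vn r).
Proof.
move=> le; have [f _] := @vinj_le p n r le; elim/int_pred_ind: i => i a.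
have [|y Hy] := a i (cg k erefl (f : chom true n (Vn r))); first by [].
have [F HF] := @cell_lin p k true n (i - 1) (i - 1) (Vn r) k^o (fun _ _ => 1).
have : F 0 = 1 by rewrite -(HF erefl f) -Hy cell_d.
by rewrite linear0 => /esym/eqP; rewrite oner_eq0.
Qed.

(** The ideal of complexes supported on the type of X contains X, hence all cells P(r) for large r
    when X is not acyclic; each of these is nonzero at its own level r. *)
Lemma type_cofinite X : compact X -> cofinite_set (tt_type X) \/ tt_type X = set0.
Proof.
move=> cX; have [a|na] := pselect (forall V, acy X V).
  by right; apply/seteqP; split=> n //= /homology_acy; apply.
left; have [M HM] := ideal_cells (typed_ideal (tt_type X)) (typed_type cX) na.
apply: (@sub_finite_set _ _ `I_M); last exact: finite_II.
move=> n /= nX; rewrite ltnNge; apply/negP => le.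
by have [_ /(_ n nX)] := HM n 0 le; apply: cell_nonacy.
Qed.

Lemma acy_cone_zero X Y V : acy (cone (cm_zero X Y)) V -> acy X V /\ acy Y V.
Proof.
move=> a; have aY : acy Y V.
  move=> n z dz; have [|[u v] E] := a n (0, z).
    by rewrite /cycle cone_dE2 dz !linear0 addr0 ?oppr0.
  exists v; have := congr1 snd E; rewrite cone_dE2 /=.
  by rewrite add0r.
by split=> //; apply: qia_acyl (qia_cone a) aY.
Qed.

(** The cell P(M) accounts for all levels from M on. For each d in S below M one adds P(d) with the
    levels d + 1, ..., M - 1 killed, which below M lives at level d only; sums are cones of zero
    maps. *)
Lemma type_surj (S : set nat) M : (forall n, (M <= n)%N -> S n) ->
  exists X, compact X /\ tt_type X = S.
Proof.
move=> HS.
suff H d : (d <= M)%N -> exists X, compact X /\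
    forall n, acy X (Vn n) <-> ~ ((M <= n)%N \/ ((n < d)%N /\ S n)).
  have [X [cX HX]] := H M (leqnn M); exists X; split=> //.
  apply/seteqP; split=> n; rewrite /tt_type /= homology_acy HX.
    by move=> /contrapT[/HS|[]].
  move=> Sn; apply; have [lt|le] := ltnP n M; [by right | by left].
elim: d => [_|d IH dM].
  exists (P M 0); split=> [|n]; first exact: compact_P.
  split=> [a [le|[]//]|nle]; first exact: cell_nonacy le a.
  apply: cell_small_acy; rewrite dim_rV ltnNge; apply/negP => le; apply: nle; by left.
have [X [cX HX]] := IH (ltnW dM).
have [Sd|nSd] := pselect (S d); last first.
  exists X; split=> // n; rewrite HX; split=> H [le|[lt Sn]]; apply: H; try by left.
    right; split=> //; move: lt; rewrite ltnS leq_eqVlt => /orP[/eqP e|//].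
    by rewrite e in Sn.
  by right; split=> //; apply: leq_trans lt _.
pose A := Kt d.+1 (M - d.+1) (P d 0).
have cA : compact A := Kt_compact char0 _ _ (compact_P char0 d 0).
exists (cone (cm_zero A X)); split; first exact: (compact_cone char0 _ cA cX).
move=> n; split=> [/acy_cone_zero[aA aX] [le|[lt Sn]]|H].
- exact: (proj1 (HX n) aX (or_introl le)).
- move: lt; rewrite ltnS leq_eqVlt => /orP[/eqP e|lt].
    2: exact: (proj1 (HX n) aX (or_intror (conj lt Sn))).
  subst n; apply: (@cell_nonacy d d 0 (leqnn d)).
  apply: qia_acyl (kt_in_qia (m := d.+1) (M - d.+1) (P d 0) _) aA.
  by rewrite dim_rV.
- have nM : (n < M)%N by rewrite ltnNge; apply/negP => le; apply: H; left.
  apply: acy_cone_of; last first.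
    apply/HX => -[le|[lt Sn]]; apply: H; first by left.
    by right; split=> //; apply: leq_trans lt _.
  have [lt|gt|e] := ltngtP n d.
  + by apply: Kt_acy_small; [rewrite dim_rV ltnW | apply: cell_small_acy; rewrite dim_rV].
  + by apply: Kt_acy; rewrite dim_rV subnKC // gt.
  + by exfalso; apply: H; right; rewrite e.
Qed.

End Main.

Lemma sig_inj (T : Type) (Q : T -> Prop) (x y : {t | Q t}) : sval x = sval y -> x = y.
Proof.
case: x y => [x Qx] [y Qy] /= e; subst y; congr exist; exact: Prop_irrelevance.
Qed.

Lemma gen_self (p : nat) (k : fieldType) (X : cplx p k) : thick_ideal_gen X X.
Proof. by move=> I _. Qed.

(** From left to right, each complex lies in the ideal of complexes supported on the type of the
    other; from right to left, [ideal_of_type] applies in both directions. *)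
Lemma tt_equiv_type (p : nat) (k : fieldType) (char0 : [pchar k]%R =i pred0)
    (M N : compact_obj p k) : tt_equiv M N <-> tt_type (sval M) = tt_type (sval N).
Proof.
have sub (A B : compact_obj p k) : thick_ideal_gen (sval B) (sval A) ->
    (tt_type (sval A) `<=` tt_type (sval B))%classic.
  move=> H; have [_ a] := H _ (@typed_ideal p k char0 _) (typed_type (svalP B)).
  move=> n /homology_acy nA; apply: contrapT => nB; exact/nA/a.
have gen (A B : compact_obj p k) : tt_type (sval A) = tt_type (sval B) ->
    forall X, thick_ideal_gen (sval A) X -> thick_ideal_gen (sval B) X.
  move=> e X H I HI IB; apply: H => //.
  apply: (ideal_of_type char0 HI (svalP A) IB) => n aB; apply: contrapT => nA.
  have : tt_type (sval A) n by apply/homology_acy.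
  by rewrite e => /homology_acy.
split=> [H|e X]; last by split; apply: gen.
by apply/seteqP; split; apply: sub; [apply/H | apply/H]; apply: gen_self.
Qed.

Theorem theorem1 (p : nat) (k : fieldType) (p_prime : prime p)
    (k_char0 : [pchar k]%R =i pred0) :
  exists F : tt_classes p k -> cofinite_or_empty,
    (forall M : compact_obj p k, sval (F (tt_class M)) = tt_type (sval M)) /\
    bijective F.
Proof.
pose rep (C : tt_classes p k) : compact_obj p k := sval (cid (svalP C)).
have repE C : sval C = tt_equiv (rep C) by exact: svalP (cid (svalP C)).
pose F C : cofinite_or_empty := exist _ (tt_type (sval (rep C)))
  (type_cofinite k_char0 (svalP (rep C))).
have FE M : sval (F (tt_class M)) = tt_type (sval M).
  apply/esym/(tt_equiv_type k_char0).
  have /= -> := repE (tt_class M).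
  by move=> X.
exists F; split=> //.
have surj S : exists C, F C = S.
  case: S => S [Sfin|S0].
    have [M HM] : exists M, forall n, (M <= n)%N -> S n.
      have /finite_seqP[s Es] := Sfin; exists (\max_(i <- s) i).+1 => n le.
      apply: contrapT => nS; have : (~` S)%classic n by [].
      rewrite Es /= => ns; have := @leq_bigmax_seq _ s xpredT (fun i => i) n ns isT.
      by rewrite leqNgt le.
    have [X [cX tX]] := @type_surj p k k_char0 S M HM.
    by exists (tt_class (exist _ X cX)); apply: sig_inj; rewrite FE.
  (* The empty type is realized by a contractible complex. *)
  have a V : acy (cone (cm_id (cell p k true 0 0))) V by apply/null_acy/cone_id_null.
  exists (tt_class (exist _ _ (compact_acy a))); apply: sig_inj; rewrite FE /= S0.
  by apply/seteqP; split=> n //= /homology_acy; apply.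
have /dchoice[G HG] := surj.
exists G => [C|S]; last exact: HG.
have e : tt_type (sval (rep (G (F C)))) = tt_type (sval (rep C)).
  exact: (congr1 (fun S : cofinite_or_empty => sval S) (HG (F C))).
apply: sig_inj; rewrite !repE; apply/funext => X; apply/propext.
have /(tt_equiv_type k_char0) H := e.
by split=> HX Y; rewrite -HX H.
Qed.
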